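(* Let $R$ be an arbitrary ring. Let $D_A:\mathrm{fp}(R\text{-}\mathrm{Mod},\mathrm{Ab})\to(\mathrm{mod}\text{-}R,\mathrm{Ab})^{\mathrm{op}}$ be the Auslander-Gruson-Jensen functor, and let $D_L,D_R:(\mathrm{mod}\text{-}R,\mathrm{Ab})^{\mathrm{op}}\to\mathrm{fp}(R\text{-}\mathrm{Mod},\mathrm{Ab})$ be the functors defined in the context. Let $\mathrm{Ker}(D_A)$ be the full subcategory of $\mathrm{fp}(R\text{-}\mathrm{Mod},\mathrm{Ab})$ consisting of those $F$ with $D_AF=0$. Then there is a recollement of abelian categories with $\mathcal{A}'=\mathrm{Ker}(D_A)$, $\mathcal{A}=\mathrm{fp}(R\text{-}\mathrm{Mod},\mathrm{Ab})$, $\mathcal{A}''=(\mathrm{mod}\text{-}R,\mathrm{Ab})^{\mathrm{op}}$, in which $i_*$ is the inclusion $\mathrm{Ker}(D_A)\subseteq\mathrm{fp}(R\text{-}\mathrm{Mod},\mathrm{Ab})$, $j^*=D_A$, $j_!=D_L$ and $j_*=D_R$. That is, $D_L\dashv D_A\dashv D_R$, the functors $D_L$ and $D_R$ are fully faithful, and the inclusion $\mathrm{Ker}(D_A)\to\mathrm{fp}(R\text{-}\mathrm{Mod},\mathrm{Ab})$ has both a left adjoint and a right adjoint.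
   Context: All categories and functors are additive. $R\text{-}\mathrm{Mod}$ is the category of left $R$-modules and $\mathrm{mod}\text{-}R$ is the category of finitely presented right $R$-modules. $(X,-)$ denotes the representable (Hom) functor and $(F,G)$ denotes the group of natural transformations $F\to G$; $\otimes=\otimes_R$. $\mathrm{fp}(R\text{-}\mathrm{Mod},\mathrm{Ab})$ is the category of finitely presented functors, i.e. additive functors $F:R\text{-}\mathrm{Mod}\to\mathrm{Ab}$ for which there is an exact sequence $(Y,-)\to(X,-)\to F\to0$ with $X,Y\in R\text{-}\mathrm{Mod}$. $(\mathrm{mod}\text{-}R,\mathrm{Ab})$ is the category of all additive functors $\mathrm{mod}\text{-}R\to\mathrm{Ab}$. Both are abelian with kernels and cokernels computed objectwise. The functor $D_A$ is defined by $(D_AF)M=(F,M\otimes-)$ for $F\in\mathrm{fp}(R\text{-}\mathrm{Mod},\mathrm{Ab})$ and $M\in\mathrm{mod}\text{-}R$, where $M\otimes-:R\text{-}\mathrm{Mod}\to\mathrm{Ab}$. The functor $D_R$ is defined by $(D_RG)M=(G,-\otimes M)$ for $G\in(\mathrm{mod}\text{-}R,\mathrm{Ab})$ and $M\in R\text{-}\mathrm{Mod}$, where $-\otimes M:\mathrm{mod}\text{-}R\to\mathrm{Ab}$; the functor $D_RG$ is finitely presented. The functor $D_L$ is $D_L=L_0(Y\circ\mathrm{ev}_R^{\mathrm{op}})$, the $0$-th left derived functor of $Y\circ\mathrm{ev}_R^{\mathrm{op}}:(\mathrm{mod}\text{-}R,\mathrm{Ab})^{\mathrm{op}}\to\mathrm{fp}(R\text{-}\mathrm{Mod},\mathrm{Ab})$,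 where $\mathrm{ev}_R:(\mathrm{mod}\text{-}R,\mathrm{Ab})\to R\text{-}\mathrm{Mod}$, $F\mapsto F(R_R)$, is evaluation at the ring and $Y:(R\text{-}\mathrm{Mod})^{\mathrm{op}}\to\mathrm{fp}(R\text{-}\mathrm{Mod},\mathrm{Ab})$, $X\mapsto(X,-)$, is the Yoneda embedding. The injective objects of $(\mathrm{mod}\text{-}R,\mathrm{Ab})$ are, up to isomorphism, the functors $-\otimes U$ with $U$ a pure-injective left $R$-module (Gruson-Jensen), so $D_L$ is the unique right exact functor agreeing with $-\otimes U\mapsto(U,-)$ on injectives: if $0\to G\to-\otimes U\to-\otimes V$ is exact with $U,V$ pure-injective, then $D_LG$ is the cokernel of the induced map $(V,-)\to(U,-)$. A recollement of abelian categories consists of abelian categories $\mathcal{A}',\mathcal{A},\mathcal{A}''$ and additive functors $i_*:\mathcal{A}'\to\mathcal{A}$, $i^*,i^!:\mathcal{A}\to\mathcal{A}'$, $j^*:\mathcal{A}\to\mathcal{A}''$, $j_!,j_*:\mathcal{A}''\to\mathcal{A}$ such that: $\mathrm{Im}(i_* )=\mathrm{Ker}(j^* )$; $i_*$ is fully faithful and $i^*\dashv i_*\dashv i^!$; $j_!\dashv j^*\dashv j_*$ and $j_!$, $j_*$ are fully faithful. *)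

(* Defs.v *)
From HB Require Import structures.
From mathcomp Require Import all_boot all_algebra generic_quotient.
From mathcomp Require Import boolp.

Set Implicit Arguments.
Unset Strict Implicit.
Unset Printing Implicit Defensive.

Import GRing.Theory.
Local Open Scope ring_scope.
Local Open Scope quotient_scope.

Declare Scope cat_scope.
Delimit Scope cat_scope with cat.
Local Open Scope cat_scope.

(* A [cat] is a preadditive category.  The group structure on hom-sets is
   spelled out, rather than being a [zmodType], because the hom-sets of functor
   categories on all R-modules live in a larger universe than [zmodType]. *)
Record cat := Cat {
  ob :> Type;
  hom : ob -> ob -> Type;
  idm : forall a, hom a a;
  cmp : forall a b c, hom b c -> hom a b -> hom a c;
  hzero : forall a b, hom a b;
  hadd : forall a b, hom a b -> hom a b -> hom a b;
  hopp : forall a b, hom a b -> hom a b;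
  cmp1m : forall a b (f : hom a b), cmp (idm b) f = f;
  cmpm1 : forall a b (f : hom a b), cmp f (idm a) = f;
  cmpA : forall a b c d (h : hom c d) (g : hom b c) (f : hom a b),
    cmp h (cmp g f) = cmp (cmp h g) f;
  haddA : forall a b (f g h : hom a b),
    hadd f (hadd g h) = hadd (hadd f g) h;
  haddC : forall a b (f g : hom a b), hadd f g = hadd g f;
  hadd0 : forall a b (f : hom a b), hadd (hzero a b) f = f;
  haddN : forall a b (f : hom a b), hadd (hopp f) f = hzero a b;
  cmpDl : forall a b c (g g' : hom b c) (f : hom a b),
    cmp (hadd g g') f = hadd (cmp g f) (cmp g' f);
  cmpDr : forall a b c (g : hom b c) (f f' : hom a b),
    cmp g (hadd f f') = hadd (cmp g f) (cmp g f')
}.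

Arguments hom {_} _ _.
Arguments idm {_} _.
Arguments hzero {_} _ _.

Notation "g \oc f" := (cmp g f) (at level 50, left associativity) : cat_scope.

Definition op (C : cat) : cat.
Proof.
refine (@Cat C (fun a b => @hom C b a) (@idm C) (fun a b c g f => cmp f g)
  (fun a b => hzero b a) (fun a b => @hadd C b a) (fun a b => @hopp C b a)
  _ _ _ _ _ _ _ _ _).
- by move=> a b f; exact: cmpm1.
- by move=> a b f; exact: cmp1m.
- by move=> a b c d h g f; rewrite cmpA.
- by move=> a b f g h; exact: haddA.
- by move=> a b f g; exact: haddC.
- by move=> a b f; exact: hadd0.
- by move=> a b f; exact: haddN.
- by move=> a b c g g' f; exact: cmpDr.
- by move=> a b c g f f'; exact: cmpDl.
Defined.

Definition full_sub (C : cat) (P : C -> Prop) : cat.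
Proof.
refine (@Cat {x : C | P x} (fun a b => @hom C (sval a) (sval b))
  (fun a => idm (sval a)) (fun a b c g f => cmp g f)
  (fun a b => hzero (sval a) (sval b)) (fun a b => @hadd C (sval a) (sval b))
  (fun a b => @hopp C (sval a) (sval b)) _ _ _ _ _ _ _ _ _).
- by move=> a b f; exact: cmp1m.
- by move=> a b f; exact: cmpm1.
- by move=> a b c d h g f; exact: cmpA.
- by move=> a b f g h; exact: haddA.
- by move=> a b f g; exact: haddC.
- by move=> a b f; exact: hadd0.
- by move=> a b f; exact: haddN.
- by move=> a b c g g' f; exact: cmpDl.
- by move=> a b c g f f'; exact: cmpDr.
Defined.

Record functor (C D : cat) := Functor {
  fob :> C -> D;
  fmap : forall a b : C, hom a b -> hom (fob a) (fob b);
  fmap1 : forall a, fmap (idm a) = idm (fob a);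
  fmapM : forall a b c (g : hom b c) (f : hom a b),
    fmap (g \oc f) = fmap g \oc fmap f;
  fmapD : forall a b (f g : hom a b), fmap (hadd f g) = hadd (fmap f) (fmap g)
}.

Arguments fmap {_ _} _ {_ _} _.

Definition functor_comp (C D E : cat) (G : functor D E) (F : functor C D) :
  functor C E.
Proof.
refine (@Functor C E (fun a => G (F a)) (fun a b f => fmap G (fmap F f)) _ _ _).
- by move=> a; rewrite !fmap1.
- by move=> a b c g f; rewrite !fmapM.
- by move=> a b f g; rewrite !fmapD.
Defined.

Definition functor_op (C D : cat) (F : functor C D) : functor (op C) (op D).
Proof.
refine (@Functor (op C) (op D) F (fun a b f => @fmap C D F b a f) _ _ _).
- by move=> a; exact: fmap1.
- by move=> a b c g f; exact: fmapM.
- by move=> a b f g; exact: fmapD.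
Defined.

Definition incl (C : cat) (P : C -> Prop) : functor (full_sub P) C.
Proof.
exact: (@Functor (full_sub P) C (fun a => sval a) (fun a b f => f)).
Defined.

Record nat_trans (C D : cat) (F G : functor C D) := NatTrans {
  component :> forall a : C, hom (F a) (G a);
  naturality : forall (a b : C) (f : hom a b),
    component b \oc fmap F f = fmap G f \oc component a
}.

Lemma nat_ext (C D : cat) (F G : functor C D) (s t : nat_trans F G) :
  (forall a, s a = t a) -> s = t.
Proof.
case: s t => [s Hs] [t Ht] /= st.
have {}st : s = t by apply/functional_extensionality_dep.
by case: t / st Ht => Ht; rewrite (Prop_irrelevance Hs Ht).
Qed.

Lemma cmp0m (C : cat) (a b c : C) (f : hom a b) :
  hzero b c \oc f = hzero a c.
Proof.
set z := _ \oc f.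
have zz : hadd z z = z by rewrite /z -cmpDl hadd0.
by rewrite -(hadd0 z) -(haddN z) -haddA zz.
Qed.

Lemma cmpm0 (C : cat) (a b c : C) (f : hom b c) :
  f \oc hzero a b = hzero a c.
Proof. exact: (@cmp0m (op C) c b a f). Qed.

Lemma cmpNm (C : cat) (a b c : C) (g : hom b c) (f : hom a b) :
  hopp g \oc f = hopp (g \oc f).
Proof.
rewrite -[LHS]hadd0 -(haddN (g \oc f)) -haddA -cmpDl.
by rewrite (haddC g) haddN cmp0m haddC hadd0.
Qed.

Lemma cmpmN (C : cat) (a b c : C) (g : hom b c) (f : hom a b) :
  g \oc hopp f = hopp (g \oc f).
Proof. exact: (@cmpNm (op C) c b a f g). Qed.

Definition nat_id (C D : cat) (F : functor C D) : nat_trans F F.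
Proof.
apply: (@NatTrans _ _ F F (fun a => idm (F a))).
by move=> a b f; rewrite cmp1m cmpm1.
Defined.

Definition nat_comp (C D : cat) (F G H : functor C D)
  (t : nat_trans G H) (s : nat_trans F G) : nat_trans F H.
Proof.
apply: (@NatTrans _ _ F H (fun a => t a \oc s a)).
by move=> a b f; rewrite -cmpA naturality cmpA naturality cmpA.
Defined.

Definition nat_zero (C D : cat) (F G : functor C D) : nat_trans F G.
Proof.
apply: (@NatTrans _ _ F G (fun a => hzero (F a) (G a))).
by move=> a b f; rewrite cmp0m cmpm0.
Defined.

Definition nat_add (C D : cat) (F G : functor C D) (s t : nat_trans F G) :
  nat_trans F G.
Proof.
apply: (@NatTrans _ _ F G (fun a => hadd (s a) (t a))).
by move=> a b f; rewrite cmpDl cmpDr !naturality.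
Defined.

Definition nat_opp (C D : cat) (F G : functor C D) (s : nat_trans F G) :
  nat_trans F G.
Proof.
apply: (@NatTrans _ _ F G (fun a => hopp (s a))).
by move=> a b f; rewrite cmpNm cmpmN naturality.
Defined.

Definition functor_cat (C D : cat) : cat.
Proof.
refine (@Cat (functor C D) (@nat_trans C D) (@nat_id C D) (@nat_comp C D)
  (@nat_zero C D) (@nat_add C D) (@nat_opp C D) _ _ _ _ _ _ _ _ _).
- by move=> a b f; apply: nat_ext => x; exact: cmp1m.
- by move=> a b f; apply: nat_ext => x; exact: cmpm1.
- by move=> a b c d h g f; apply: nat_ext => x; exact: cmpA.
- by move=> a b f g h; apply: nat_ext => x; exact: haddA.
- by move=> a b f g; apply: nat_ext => x; exact: haddC.
- by move=> a b f; apply: nat_ext => x; exact: hadd0.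
- by move=> a b f; apply: nat_ext => x; exact: haddN.
- by move=> a b c g g' f; apply: nat_ext => x; exact: cmpDl.
- by move=> a b c g f f'; apply: nat_ext => x; exact: cmpDr.
Defined.

Section CategoricalNotions.
Variable C : cat.

Definition is_zero (z : C) : Prop :=
  (forall (x : C) (f : hom x z), f = hzero x z) /\
  (forall (x : C) (f : hom z x), f = hzero z x).

Definition is_iso (a b : C) (f : hom a b) : Prop :=
  exists g : hom b a, g \oc f = idm a /\ f \oc g = idm b.

Definition isomorphic (a b : C) : Prop := exists f : hom a b, is_iso f.

Definition mono (a b : C) (f : hom a b) : Prop :=
  forall (x : C) (g h : hom x a), f \oc g = f \oc h -> g = h.

Definition epi (a b : C) (f : hom a b) : Prop :=
  forall (x : C) (g h : hom b x), g \oc f = h \oc f -> g = h.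

Definition is_kernel (k a b : C) (i : hom k a) (f : hom a b) : Prop :=
  f \oc i = hzero k b /\
  forall (x : C) (g : hom x a), f \oc g = hzero x b ->
    exists! h : hom x k, i \oc h = g.

Definition is_cokernel (a b q : C) (f : hom a b) (p : hom b q) : Prop :=
  p \oc f = hzero a q /\
  forall (x : C) (g : hom b x), g \oc f = hzero a x ->
    exists! h : hom q x, h \oc p = g.

Definition is_biproduct (a b s : C) (i1 : hom a s) (i2 : hom b s)
    (p1 : hom s a) (p2 : hom s b) : Prop :=
  [/\ p1 \oc i1 = idm a, p2 \oc i2 = idm b,
      p1 \oc i2 = hzero b a, p2 \oc i1 = hzero a b &
      hadd (i1 \oc p1) (i2 \oc p2) = idm s].

Record abelian : Prop := {
  abelian_zero : exists z : C, is_zero z;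
  abelian_biproduct : forall a b : C,
    exists (s : C) (i1 : hom a s) (i2 : hom b s) (p1 : hom s a) (p2 : hom s b),
      is_biproduct i1 i2 p1 p2;
  abelian_kernel : forall (a b : C) (f : hom a b),
    exists (k : C) (i : hom k a), is_kernel i f;
  abelian_cokernel : forall (a b : C) (f : hom a b),
    exists (q : C) (p : hom b q), is_cokernel f p;
  abelian_mono : forall (a b : C) (f : hom a b), mono f ->
    exists (c : C) (g : hom b c), is_kernel f g;
  abelian_epi : forall (a b : C) (f : hom a b), epi f ->
    exists (c : C) (g : hom c a), is_cokernel g f
}.

Definition projective (P : C) : Prop :=
  forall (a b : C) (e : hom a b) (f : hom P b), epi e ->
    exists g : hom P a, e \oc g = f.

(* In an abelian category, P1 -> P0 -> G -> 0 is exact exactly when p is a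
   cokernel of d. *)
Definition proj_presentation (P1 P0 G : C) (d : hom P1 P0) (p : hom P0 G) :
    Prop :=
  [/\ projective P1, projective P0 & is_cokernel d p].

End CategoricalNotions.

(* [D] is the 0-th left derived functor of [T]: for every projective
   presentation d : P1 -> P0 of G, D G is the cokernel of T d, by way of a
   projection T P0 -> D G; and D f is the map induced by T from any lift
   (f1, f0) of f to projective presentations. *)
Definition is_L0 (C B : cat) (T D : functor C B) : Prop :=
  exists q : forall (P1 P0 G : C) (d : hom P1 P0) (p : hom P0 G),
      proj_presentation d p -> hom (T P0) (D G),
    (forall (P1 P0 G : C) (d : hom P1 P0) (p : hom P0 G)
       (H : proj_presentation d p), is_cokernel (fmap T d) (q _ _ _ _ _ H)) /\
    (forall (P1 P0 G : C) (d : hom P1 P0) (p : hom P0 G)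
       (P1' P0' G' : C) (d' : hom P1' P0') (p' : hom P0' G')
       (H : proj_presentation d p) (H' : proj_presentation d' p')
       (f1 : hom P1 P1') (f0 : hom P0 P0') (f : hom G G'),
       f0 \oc d = d' \oc f1 -> f \oc p = p' \oc f0 ->
       fmap D f \oc q _ _ _ _ _ H = q _ _ _ _ _ H' \oc fmap T f0).

Definition adjoint (C D : cat) (L : functor C D) (R : functor D C) : Prop :=
  exists phi : forall (a : C) (b : D), hom (L a) b -> hom a (R b),
  [/\ forall a b, bijective (@phi a b),
      forall (a : C) (b b' : D) (g : hom b b') (f : hom (L a) b),
        phi a b' (g \oc f) = fmap R g \oc phi a b f &
      forall (a a' : C) (b : D) (h : hom a' a) (f : hom (L a) b),
        phi a' b (f \oc fmap L h) = phi a b f \oc h].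

Definition fully_faithful (C D : cat) (F : functor C D) : Prop :=
  forall a b : C, bijective (@fmap C D F a b).

Record recollement (A' A A'' : cat) (i_lower : functor A' A)
    (i_upper i_shriek : functor A A') (j_upper : functor A A'')
    (j_shriek j_lower : functor A'' A) : Prop := {
  rec_abelian' : abelian A';
  rec_abelian : abelian A;
  rec_abelian'' : abelian A'';
  (* Im(i_lower) is the essential image. *)
  rec_im_ker : forall x : A,
    (exists x' : A', isomorphic (i_lower x') x) <-> is_zero (j_upper x);
  rec_i_ff : fully_faithful i_lower;
  rec_i_left : adjoint i_upper i_lower;
  rec_i_right : adjoint i_lower i_shriek;
  rec_j_left : adjoint j_shriek j_upper;
  rec_j_right : adjoint j_upper j_lower;
  rec_jshriek_ff : fully_faithful j_shriek;
  rec_jlower_ff : fully_faithful j_lower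
}.

Definition Ker (A B : cat) (F : functor A B) : cat :=
  full_sub (fun x => is_zero (F x)).

Definition Ker_incl (A B : cat) (F : functor A B) : functor (Ker F) A :=
  incl (fun x => is_zero (F x)).

Lemma additive_ext (A B : zmodType) (f g : {additive A -> B}) :
  f =1 g -> f = g.
Proof.
case: f g => [f [[Hf]]] [g [[Hg]]] /= fg.
have {}fg : f = g by apply/funext.
by case: g / fg Hg => Hg; rewrite (Prop_irrelevance Hf Hg).
Qed.

Definition Ab : cat.
Proof.
refine (@Cat zmodType (fun A B => {additive A -> B})
  (fun A => (idfun : {additive A -> A}))
  (fun A B C g f => (g \o f : {additive A -> C}))
  (fun A B => (\0 : {additive A -> B}))
  (fun A B f g => (f \+ g : {additive A -> B}))
  (fun A B f => (\- f : {additive A -> B})) _ _ _ _ _ _ _ _ _).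
- by move=> A B f; apply: additive_ext.
- by move=> A B f; apply: additive_ext.
- by move=> A B C D h g f; apply: additive_ext.
- by move=> A B f g h; apply: additive_ext => x /=; rewrite addrA.
- by move=> A B f g; apply: additive_ext => x /=; rewrite addrC.
- by move=> A B f; apply: additive_ext => x /=; rewrite add0r.
- by move=> A B f; apply: additive_ext => x /=; rewrite addNr.
- by move=> A B C g g' f; apply: additive_ext.
- by move=> A B C g f f'; apply: additive_ext => x /=; rewrite raddfD.
Defined.

Section Modules.
Variable R : pzRingType.

Lemma linear_ext (X Y : lmodType R) (f g : {linear X -> Y}) :
  f =1 g -> f = g.
Proof.
case: f g => [f [[Hf] [Hf']]] [g [[Hg] [Hg']]] /= fg.
have {}fg : f = g by apply/funext.
case: g / fg Hg Hg' => Hg Hg'.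
by rewrite (Prop_irrelevance Hf Hg) (Prop_irrelevance Hf' Hg').
Qed.

Definition Mod : cat.
Proof.
refine (@Cat (lmodType R) (fun X Y => {linear X -> Y})
  (fun X => (idfun : {linear X -> X}))
  (fun X Y Z g f => (g \o f : {linear X -> Z}))
  (fun X Y => (\0 : {linear X -> Y}))
  (fun X Y f g => (f \+ g : {linear X -> Y}))
  (fun X Y f => (\- f : {linear X -> Y})) _ _ _ _ _ _ _ _ _).
- by move=> A B f; apply: linear_ext.
- by move=> A B f; apply: linear_ext.
- by move=> A B C D h g f; apply: linear_ext.
- by move=> A B f g h; apply: linear_ext => x /=; rewrite addrA.
- by move=> A B f g; apply: linear_ext => x /=; rewrite addrC.
- by move=> A B f; apply: linear_ext => x /=; rewrite add0r.
- by move=> A B f; apply: linear_ext => x /=; rewrite addNr.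
- by move=> A B C g g' f; apply: linear_ext.
- by move=> A B C g f f'; apply: linear_ext => x /=; rewrite raddfD.
Defined.

Definition fp_module (M : lmodType R) : Prop :=
  exists (m n : nat) (f : {linear 'rV[R]_m -> 'rV[R]_n})
         (g : {linear 'rV[R]_n -> M}),
    (forall y, exists x, g x = y) /\
    (forall x, g x = 0 <-> exists z, f z = x).

Definition lhom (X Y : lmodType R) := {linear X -> Y}.

Section LhomZmod.
Variables X Y : lmodType R.

HB.instance Definition _ := gen_eqMixin (lhom X Y).
HB.instance Definition _ := gen_choiceMixin (lhom X Y).

Let lhom_addA : associative (@hadd Mod X Y : lhom X Y -> _).
Proof. by move=> f g h; exact: (@haddA Mod X Y). Qed.
Let lhom_addC : commutative (@hadd Mod X Y : lhom X Y -> _).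
Proof. by move=> f g; exact: (@haddC Mod X Y). Qed.
Let lhom_add0 : left_id (@hzero Mod X Y) (@hadd Mod X Y : lhom X Y -> _).
Proof. by move=> f; exact: (@hadd0 Mod X Y). Qed.
Let lhom_addN :
  left_inverse (@hzero Mod X Y) (@hopp Mod X Y)
               (@hadd Mod X Y : lhom X Y -> _).
Proof. by move=> f; exact: (@haddN Mod X Y). Qed.

HB.instance Definition _ :=
  GRing.isZmodule.Build (lhom X Y) lhom_addA lhom_addC lhom_add0 lhom_addN.
End LhomZmod.

Definition lpost (X Y Z : lmodType R) (f : {linear Y -> Z}) (g : lhom X Y) :
  lhom X Z := @cmp Mod X Y Z f g.

Lemma lpost_zmod (X Y Z : lmodType R) (f : {linear Y -> Z}) :
  zmod_morphism (@lpost X Y Z f).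
Proof. by move=> g h; apply: linear_ext => x; exact: (raddfB f). Qed.

HB.instance Definition _ (X Y Z : lmodType R) (f : {linear Y -> Z}) :=
  GRing.isZmodMorphism.Build (lhom X Y) (lhom X Z) (lpost f)
    (@lpost_zmod X Y Z f).

Definition lpre (X Y Z : lmodType R) (h : {linear X -> Y}) (g : lhom Y Z) :
  lhom X Z := @cmp Mod X Y Z g h.

Lemma lpre_zmod (X Y Z : lmodType R) (h : {linear X -> Y}) :
  zmod_morphism (@lpre X Y Z h).
Proof. by move=> f g; apply: linear_ext. Qed.

HB.instance Definition _ (X Y Z : lmodType R) (h : {linear X -> Y}) :=
  GRing.isZmodMorphism.Build (lhom Y Z) (lhom X Z) (lpre h)
    (@lpre_zmod X Y Z h).

Definition rep (X : Mod) : functor Mod Ab.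
Proof.
refine (@Functor Mod Ab (fun Y => lhom X Y)
  (fun Y Z f => (lpost f : {additive lhom X Y -> lhom X Z})) _ _ _).
- by move=> Y; apply: additive_ext => g; exact: (@cmp1m Mod X Y).
- by move=> Y Z W g f; apply: additive_ext => h; exact: esym (@cmpA Mod X Y Z W g f h).
- by move=> Y Z f g; apply: additive_ext => h; exact: (@cmpDl Mod X Y Z).
Defined.

Definition rep_map (X Y : Mod) (h : hom X Y) : nat_trans (rep Y) (rep X).
Proof.
apply: (@NatTrans _ _ (rep Y) (rep X)
  (fun Z => (lpre h : {additive lhom Y Z -> lhom X Z}))).
by move=> Z W f; apply: additive_ext => g; exact: esym (@cmpA Mod X Y Z W f g h).
Defined.

(* The sequence (Y,-) -> (X,-) -> F -> 0 is exact; exactness in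
   [functor_cat Mod Ab] is objectwise. *)
Definition fp_functor (F : functor Mod Ab) : Prop :=
  exists (X Y : Mod) (a : nat_trans (rep Y) (rep X)) (b : nat_trans (rep X) F),
    forall M : Mod,
      (forall y, exists x, b M x = y) /\
      (forall x, b M x = 0 <-> exists z, a M z = x).

Definition fp : cat := @full_sub (functor_cat Mod Ab) fp_functor.

Lemma rep_fp (X : Mod) : fp_functor (rep X).
Proof.
exists X, X, (nat_zero _ _), (nat_id _) => M; split; first by move=> y; exists y.
by move=> x; split=> [x0 | [z <-]] //; exists x; exact: esym x0.
Qed.

Definition yoneda : functor (op Mod) fp.
Proof.
refine (@Functor (op Mod) fp (fun X => exist _ (rep X) (rep_fp X))
  (fun X Y h => @rep_map Y X h) _ _ _).
- move=> X; apply: nat_ext => Z; apply: additive_ext => g.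
  exact: (@cmpm1 Mod X Z).
- move=> X Y Z g f; apply: nat_ext => W; apply: additive_ext => h.
  exact: (@cmpA Mod Z Y X W).
- move=> X Y f g; apply: nat_ext => W; apply: additive_ext => h.
  exact: (@cmpDr Mod Y X W).
Defined.

End Modules.

(* Right R-modules are modules over the converse ring R^c: the scalar action
   r *: m, for r : R^c, stands for m r. *)
Definition modr (R : pzRingType) : cat :=
  @full_sub (Mod R^c) (@fp_module R^c).

Definition modrAb (R : pzRingType) : cat := functor_cat (modr R) Ab.

Section Tensor.
Variables (R : pzRingType) (M : lmodType R^c) (N : lmodType R).

(* The tensor product is the abelian group generated by the symbols [Tpure m n]
   subject to biadditivity and m r (x) n = m (x) r n. *)
Inductive texp : Type :=
  | Tzero
  | Tadd of texp & texp
  | Topp of texp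
  | Tpure of M & N.

Inductive tcong : texp -> texp -> Prop :=
  | tcong_refl s : tcong s s
  | tcong_sym s t : tcong s t -> tcong t s
  | tcong_trans s t u : tcong s t -> tcong t u -> tcong s u
  | tcong_add s s' t t' : tcong s s' -> tcong t t' ->
      tcong (Tadd s t) (Tadd s' t')
  | tcong_opp s s' : tcong s s' -> tcong (Topp s) (Topp s')
  | tcong_addA s t u : tcong (Tadd s (Tadd t u)) (Tadd (Tadd s t) u)
  | tcong_addC s t : tcong (Tadd s t) (Tadd t s)
  | tcong_add0 s : tcong (Tadd Tzero s) s
  | tcong_addN s : tcong (Tadd (Topp s) s) Tzero
  | tcong_Dl m m' n : tcong (Tpure (m + m') n) (Tadd (Tpure m n) (Tpure m' n))
  | tcong_Dr m n n' : tcong (Tpure m (n + n')) (Tadd (Tpure m n) (Tpure m n'))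
  | tcong_Z m (r : R) n : tcong (Tpure ((r : R^c) *: m) n) (Tpure m (r *: n)).

HB.instance Definition _ := gen_eqMixin texp.
HB.instance Definition _ := gen_choiceMixin texp.

Definition tcongb : rel texp := fun s t => `[< tcong s t >].

Let tcongb_refl : reflexive tcongb.
Proof. by move=> s; apply/asboolP; exact: tcong_refl. Qed.
Let tcongb_sym : symmetric tcongb.
Proof. by move=> s t; apply/asboolP/asboolP; exact: tcong_sym. Qed.
Let tcongb_trans : transitive tcongb.
Proof.
by move=> t s u /asboolP st /asboolP tu; apply/asboolP; exact: tcong_trans st tu.
Qed.

Canonical tcong_equiv := EquivRel tcongb tcongb_refl tcongb_sym tcongb_trans.

Definition tensor := {eq_quot tcong_equiv}.
HB.instance Definition _ := Choice.on tensor.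

Definition tclass (s : texp) : tensor := \pi_({eq_quot tcong_equiv}) s.
Definition trepr (x : tensor) : texp := repr (x : {eq_quot tcong_equiv}).

Lemma treprK x : tclass (trepr x) = x.
Proof. exact: reprK. Qed.

Lemma tclassP s t : tclass s = tclass t <-> tcong s t.
Proof. by split=> [/eqmodP/asboolP // | st]; apply/eqmodP/asboolP. Qed.

Lemma trepr_class s : tcong (trepr (tclass s)) s.
Proof. by apply/tclassP; rewrite treprK. Qed.

Definition tzero : tensor := tclass Tzero.
Definition tadd (x y : tensor) : tensor := tclass (Tadd (trepr x) (trepr y)).
Definition topp (x : tensor) : tensor := tclass (Topp (trepr x)).

Lemma taddE s t : tadd (tclass s) (tclass t) = tclass (Tadd s t).
Proof. by apply/tclassP; apply: tcong_add; exact: trepr_class. Qed.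
Lemma toppE s : topp (tclass s) = tclass (Topp s).
Proof. by apply/tclassP; apply: tcong_opp; exact: trepr_class. Qed.

Let taddA : associative tadd.
Proof.
move=> x y z; rewrite -(treprK x) -(treprK y) -(treprK z) !taddE.
by apply/tclassP; exact: tcong_addA.
Qed.
Let taddC : commutative tadd.
Proof. by move=> x y; apply/tclassP; exact: tcong_addC. Qed.
Let tadd0 : left_id tzero tadd.
Proof.
by move=> x; rewrite -(treprK x) taddE; apply/tclassP; exact: tcong_add0.
Qed.
Let taddN : left_inverse tzero topp tadd.
Proof.
move=> x; rewrite -(treprK x) toppE taddE.
by apply/tclassP; exact: tcong_addN.
Qed.

HB.instance Definition _ := GRing.isZmodule.Build tensor taddA taddC tadd0 taddN.

Definition tpure (m : M) (n : N) : tensor := tclass (Tpure m n).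

Lemma tpureDl m m' n : tpure (m + m') n = tpure m n + tpure m' n.
Proof. by rewrite [RHS]taddE; apply/tclassP; exact: tcong_Dl. Qed.
Lemma tpureDr m n n' : tpure m (n + n') = tpure m n + tpure m n'.
Proof. by rewrite [RHS]taddE; apply/tclassP; exact: tcong_Dr. Qed.
Lemma tpureZ m (r : R) n : tpure ((r : R^c) *: m) n = tpure m (r *: n).
Proof. by apply/tclassP; exact: tcong_Z. Qed.

Definition balanced (A : zmodType) (f : M -> N -> A) : Prop :=
  [/\ forall m m' n, f (m + m') n = f m n + f m' n,
      forall m n n', f m (n + n') = f m n + f m n' &
      forall m (r : R) n, f ((r : R^c) *: m) n = f m (r *: n)].

Lemma tpure_balanced : balanced tpure.
Proof. by split; [exact: tpureDl | exact: tpureDr | exact: tpureZ]. Qed.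

Fixpoint teval (A : zmodType) (f : M -> N -> A) (s : texp) : A :=
  match s with
  | Tzero => 0
  | Tadd s t => teval f s + teval f t
  | Topp s => - teval f s
  | Tpure m n => f m n
  end.

Lemma teval_cong (A : zmodType) (f : M -> N -> A) s t :
  balanced f -> tcong s t -> teval f s = teval f t.
Proof.
case=> fDl fDr fZ; elim=> //= {s t}.
- by move=> s t u _ -> _ ->.
- by move=> s s' t t' _ -> _ ->.
- by move=> s s' _ ->.
- by move=> s t u; rewrite addrA.
- by move=> s t; rewrite addrC.
- by move=> s; rewrite add0r.
- by move=> s; rewrite addNr.
Qed.

Definition tlift_fun (A : zmodType) (f : M -> N -> A) (x : tensor) : A :=
  teval f (trepr x).

Lemma tlift_zmod (A : zmodType) (f : M -> N -> A) :
  balanced f -> zmod_morphism (tlift_fun f).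
Proof.
move=> fb x y; rewrite /tlift_fun.
rewrite (teval_cong (t := Tadd (trepr x) (Topp (trepr y))) fb) //.
apply/tclassP; rewrite treprK -taddE -toppE !treprK //.
Qed.

Definition tlift (A : zmodType) (f : M -> N -> A) (fb : balanced f) :
    {additive tensor -> A} :=
  HB.pack (tlift_fun f)
    (GRing.isZmodMorphism.Build _ _ (tlift_fun f) (tlift_zmod fb)).

Lemma tlift_pure (A : zmodType) (f : M -> N -> A) (fb : balanced f) m n :
  tlift fb (tpure m n) = f m n.
Proof. by rewrite /= /tlift_fun (teval_cong fb (trepr_class _)). Qed.

Lemma tensor_ext (A : zmodType) (f g : {additive tensor -> A}) :
  (forall m n, f (tpure m n) = g (tpure m n)) -> f = g.
Proof.
move=> fg; apply: additive_ext => x; rewrite -(treprK x).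
elim: (trepr x) => [|s IHs t IHt|s IHs|m n]; last exact: fg.
- by rewrite (_ : tclass Tzero = 0) // !raddf0.
- by rewrite (_ : tclass _ = tclass s + tclass t) ?raddfD ?IHs ?IHt // -taddE.
- by rewrite (_ : tclass _ = - tclass s) ?raddfN ?IHs // -toppE.
Qed.

End Tensor.

Section TensorFunctors.
Variable R : pzRingType.

Lemma tmap_balanced (M M' : lmodType R^c) (N N' : lmodType R)
    (f : {linear M -> M'}) (g : {linear N -> N'}) :
  balanced (fun m n => tpure (f m) (g n)).
Proof.
split=> *; rewrite ?raddfD ?linearZ /= ?tpureDl ?tpureDr //.
exact: tpureZ.
Qed.

Definition tmap (M M' : lmodType R^c) (N N' : lmodType R)
    (f : {linear M -> M'}) (g : {linear N -> N'}) :
    {additive tensor M N -> tensor M' N'} :=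
  tlift (tmap_balanced f g).

Lemma tmap_pure (M M' : lmodType R^c) (N N' : lmodType R)
    (f : {linear M -> M'}) (g : {linear N -> N'}) m n :
  tmap f g (tpure m n) = tpure (f m) (g n).
Proof. exact: tlift_pure. Qed.

Definition tensorl (M : modr R) : functor (Mod R) Ab.
Proof.
refine (@Functor (Mod R) Ab (fun N => tensor (sval M) N)
  (fun N N' g => tmap idfun g) _ _ _).
- by move=> N; apply: tensor_ext => m n; rewrite tmap_pure.
- move=> N N' N'' g f; apply: tensor_ext => m n.
  transitivity (tpure m (g (f n))); first exact: tmap_pure.
  by rewrite -(tmap_pure idfun g m (f n)) -(tmap_pure idfun f m n).
- move=> N N' f g; apply: tensor_ext => m n.
  transitivity (tpure m (f n + g n)); first exact: tmap_pure.
  by rewrite tpureDr -(tmap_pure idfun f m n) -(tmap_pure idfun g m n).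
Defined.

Definition tensorl_map (M M' : modr R) (h : hom M M') :
  nat_trans (tensorl M) (tensorl M').
Proof.
apply: (@NatTrans _ _ (tensorl M) (tensorl M')
  (fun N => tmap (h : {linear _ -> _}) idfun)).
move=> N N' f; apply: tensor_ext => m n.
transitivity (tpure (h m) (f n)).
- by rewrite -(tmap_pure h idfun m (f n)) -(tmap_pure idfun f m n).
- by rewrite -(tmap_pure idfun f (h m) n) -(tmap_pure h idfun m n).
Defined.

Definition tensorr (N : Mod R) : functor (modr R) Ab.
Proof.
refine (@Functor (modr R) Ab (fun M => tensor (sval M) N)
  (fun M M' f => tmap (f : {linear _ -> _}) idfun) _ _ _).
- by move=> M; apply: tensor_ext => m n; rewrite tmap_pure.
- move=> M M' M'' g f; apply: tensor_ext => m n.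
  transitivity (tpure (g (f m)) n); first exact: tmap_pure.
  by rewrite -(tmap_pure g idfun (f m) n) -(tmap_pure f idfun m n).
- move=> M M' f g; apply: tensor_ext => m n.
  transitivity (tpure (f m + g m) n); first exact: tmap_pure.
  by rewrite tpureDl -(tmap_pure f idfun m n) -(tmap_pure g idfun m n).
Defined.

Definition tensorr_map (N N' : Mod R) (h : hom N N') :
  nat_trans (tensorr N) (tensorr N').
Proof.
apply: (@NatTrans _ _ (tensorr N) (tensorr N') (fun M => tmap idfun h)).
move=> M M' f; apply: tensor_ext => m n.
transitivity (tpure (f m) (h n)).
- by rewrite -(tmap_pure idfun h (f m) n) -(tmap_pure f idfun m n).
- by rewrite -(tmap_pure f idfun m (h n)) -(tmap_pure idfun h m n).
Defined.

End TensorFunctors.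

Section Evaluation.
Variable R : pzRingType.

(* The regular module over R^c is the right module R_R. *)
Definition regr : lmodType R^c := (R^c)^o.

Lemma regr_fp : fp_module regr.
Proof.
pose g (v : 'rV[R^c]_1) : regr := v ord0 ord0.
have gL : linear g by move=> a u v; rewrite /g !mxE.
pose gA := GRing.isLinear.Build _ _ _ _ g gL.
exists 0%N, 1%N, \0, (HB.pack g gA : {linear _ -> _}); split.
- by move=> y; exists (const_mx y); rewrite /= /g mxE.
- move=> x; split=> [x0 | [z <-]]; last by rewrite raddf0.
  by exists 0; apply/rowP => j; rewrite !mxE ord1; exact: esym x0.
Qed.

Definition RR : modr R := exist _ regr regr_fp.

Definition lmul (r : R) : regr -> regr := fun s => (r * (s : R) : R).

Lemma lmul_linear (r : R) : linear (lmul r).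
Proof.
move=> a u v; rewrite /lmul mulrDr; congr (_ + _).
exact: (mulrA r (u : R) (a : R)).
Qed.

HB.instance Definition _ (r : R) :=
  GRing.isLinear.Build R^c regr regr *:%R (lmul r) (lmul_linear r).

Definition lmul_hom (r : R) : hom RR RR := (lmul r : {linear regr -> regr}).

Lemma lmul_hom1 : lmul_hom 1 = idm RR.
Proof. by apply: linear_ext => s; exact: (@mul1r R s). Qed.
Lemma lmul_homM r s : lmul_hom (r * s) = lmul_hom r \oc lmul_hom s.
Proof. by apply: linear_ext => t; exact: esym (@mulrA R r s t). Qed.
Lemma lmul_homD r s : lmul_hom (r + s) = hadd (lmul_hom r) (lmul_hom s).
Proof. by apply: linear_ext => t; exact: (@mulrDl R r s t). Qed.

(* F(R_R) is a left R-module: r acts by F applied to the endomorphism [lmul r]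
   of R_R. *)
Definition evmod (F : modrAb R) : Type := fob F RR.

Section EvModule.
Variable F : modrAb R.

HB.instance Definition _ := GRing.Zmodule.copy (evmod F) (fob F RR).

Definition evscale (r : R) (x : evmod F) : evmod F :=
  (fmap F (lmul_hom r) : {additive _ -> _}) x.

Let evscaleA a b v : evscale a (evscale b v) = evscale (a * b) v.
Proof. by rewrite /evscale lmul_homM fmapM. Qed.
Let evscale1 : left_id 1 evscale.
Proof. by move=> v; rewrite /evscale lmul_hom1 fmap1. Qed.
Let evscaleDr : right_distributive evscale +%R.
Proof. by move=> r u v; exact: raddfD. Qed.
Let evscaleDl v : {morph evscale^~ v : a b / a + b}.
Proof. by move=> a b; rewrite /evscale lmul_homD fmapD. Qed.

HB.instance Definition _ :=
  GRing.Zmodule_isLmodule.Build R (evmod F)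
    evscaleA evscale1 evscaleDr evscaleDl.
End EvModule.

Definition evmap (F G : modrAb R) (t : hom F G) : evmod F -> evmod G :=
  (component t RR : {additive _ -> _}).

Lemma evmap_linear (F G : modrAb R) (t : hom F G) : linear (evmap t).
Proof.
move=> a u v.
transitivity (evmap t (a *: u) + evmap t v).
  exact: (raddfD (component t RR : {additive _ -> _})).
congr (_ + _).
exact: (congr1 (fun f : {additive _ -> _} => f u) (naturality t (lmul_hom a))).
Qed.

HB.instance Definition _ (F G : modrAb R) (t : hom F G) :=
  GRing.isLinear.Build R (evmod F) (evmod G) *:%R (evmap t) (evmap_linear t).

Definition ev : functor (modrAb R) (Mod R).
Proof.
refine (@Functor (modrAb R) (Mod R) (fun F => evmod F)
  (fun F G t => (evmap t : {linear evmod F -> evmod G})) _ _ _).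
- by move=> F; apply: linear_ext.
- by move=> F G H t s; apply: linear_ext.
- by move=> F G s t; apply: linear_ext.
Defined.

End Evaluation.

Section Dualities.
Variable R : pzRingType.

(* (DA F) M = (F, M (x) -).  The natural transformations between functors on all
   R-modules form a type too large to be a [zmodType]; hence (DA F) M is a small
   copy of that group, the identification phi being additive and natural in both
   F and M.  This determines DA up to natural isomorphism.  The same applies to
   (DR G) M = (G, - (x) M) below. *)
Definition is_DA (DA : functor (fp R) (op (modrAb R))) : Prop :=
  exists phi : forall (F : fp R) (M : modr R),
      nat_trans (sval F) (tensorl M) -> (fob (DA F) M : zmodType),
  [/\ forall F M, bijective (phi F M),
      forall F M s t, phi F M (nat_add s t) = phi F M s + phi F M t,
      forall (F : fp R) (M M' : modr R) (h : hom M M') s,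
        phi F M' (nat_comp (tensorl_map h) s) =
        (fmap (DA F : modrAb R) h : {additive _ -> _}) (phi F M s) &
      forall (F F' : fp R) (f : hom F F') (M : modr R)
          (s : nat_trans (sval F') (tensorl M)),
        phi F M (nat_comp s f) =
        (component (fmap DA f) M : {additive _ -> _}) (phi F' M s)].

Definition is_DR (DR : functor (op (modrAb R)) (fp R)) : Prop :=
  exists phi : forall (G : modrAb R) (M : Mod R),
      nat_trans G (tensorr M) -> (fob (sval (DR G)) M : zmodType),
  [/\ forall G M, bijective (phi G M),
      forall G M s t, phi G M (nat_add s t) = phi G M s + phi G M t,
      forall (G : modrAb R) (M M' : Mod R) (h : hom M M') s,
        phi G M' (nat_comp (tensorr_map h) s) =
        (fmap (sval (DR G)) h : {additive _ -> _}) (phi G M s) &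
      forall (G G' : modrAb R) (f : @hom (modrAb R) G G') (M : Mod R)
          (s : nat_trans G' (tensorr M)),
        phi G M (nat_comp s f) =
        (component (@fmap _ _ DR G' G f) M : {additive _ -> _}) (phi G' M s)].

(* A projective object of [op (modrAb R)] is an injective object of [modrAb R]. *)
Definition is_DL (DL : functor (op (modrAb R)) (fp R)) : Prop :=
  is_L0 (functor_comp (yoneda R) (functor_op (ev R))) DL.

End Dualities.

(* Main.v *)
From HB Require Import structures.
From mathcomp Require Import all_boot all_algebra.
From mathcomp Require Import boolp classical_sets.
Require Import Defs.

Set Implicit Arguments.
Unset Strict Implicit.
Unset Printing Implicit Defensive.

Import Num.Theory GRing.Theory.
Local Open Scope ring_scope.
Local Open Scope cat_scope.

(** Write A for the category of finitely presented functors on left modules and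
    A'' for the opposite of the category of functors on finitely presented right
    modules.

    The adjunction between D_A and D_R is formal.  A map F -> D_R G and a map
    G -> D_A F are two ways of writing a family of pairings G M x F N -> M (x) N
    natural in M and N ([DA_DR_adjoint]).

    For D_L the point is that an injective functor I on finitely presented right
    modules is right exact: map exact sequences 0 -> (M,-) -> (B,-) -> (A,-) into it.
    Therefore I is - (x) I(R) ([counit_injective_iso]), and D_L sends it to
    (I(R),-), which D_A sends back to I.  A map from (I(R),-) to a representable (X,-)
        is a map from
    X to I(R), that is a map from - (x) X = D_A (X,-) to I; presenting F by
    representables, and using that I is injective and (I(R),-) projective, maps
    (I(R),-) -> F are maps D_A F -> I.  There are enough injectives, and D_L G is
    the cokernel of the map (J(R),-) -> (I(R),-) attached to an injective
    copresentation 0 -> G -> I -> J.  As D_A preserves cokernels, both facts pass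
    from injectives to all G: there is an isomorphism eta between G and
    D_A D_L G, universal among the maps, in A'', from G to values of D_A
    ([L0_unit], [DL_unit]).

    The rest holds for any adjoint triple L, F, R between abelian categories
    whose unit 1 -> F L is invertible ([triple_recollement]): L is fully
    faithful, hence so is R, and the cokernel of L F x -> x and the kernel of
    x -> R F x are the left and the right adjoint of the inclusion of Ker F.

    What has to be constructed is the setting.  A is abelian because kernels of
    maps between representable functors are covered by representable ones, and
    it has products because modules have coproducts ([fp_functor_kernel],
    [fp_functor_prod]); D_R G is the kernel of a map between products of functors
    M (x) -, which are finitely presented by right exactness of the tensor
    product ([fp_functor_DR]).  The values of D_A and D_R, which are groups of
    transformations between functors on large categories, are replaced by
    isomorphic subgroups of small groups ([small_hom]).  Injective functors come
    from the divisible group Q/Z through the functors Hom((-,K), Q/Z)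
    ([enough_injectives]). *)

(** * Preadditive categories *)

Lemma bijective_of_surj_inj (A B : Type) (f : A -> B) :
  (forall y, exists x, f x = y) -> injective f -> bijective f.
Proof.
move=> fs fi; have [g gP] := choice fs.
by exists g => // x; apply: fi; rewrite gP.
Qed.

Lemma bij_surj (A B : Type) (f : A -> B) : bijective f -> forall y, exists x, f x = y.
Proof. by case=> g _ gK y; exists (g y). Qed.

Section Preadditive.
Variable C : cat.
Implicit Types a b c x : C.

Lemma haddm0 a b (f : hom a b) : hadd f (hzero a b) = f.
Proof. by rewrite haddC hadd0. Qed.

Lemma haddmN a b (f : hom a b) : hadd f (hopp f) = hzero a b.
Proof. by rewrite haddC haddN. Qed.

Lemma hsub_eq0 a b (f g : hom a b) : hadd f (hopp g) = hzero a b -> f = g.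
Proof. by move=> fg; rewrite -(haddm0 f) -(haddN g) haddA fg hadd0. Qed.

Lemma hsubK a b (f g : hom a b) : hadd (hadd f (hopp g)) g = f.
Proof. by rewrite -haddA haddN haddm0. Qed.

Lemma hadd_eq0 a b (f g : hom a b) : hadd f g = hzero a b -> f = hopp g.
Proof. by move=> fg; rewrite -(haddm0 f) -(haddmN g) haddA fg hadd0. Qed.

Lemma hadd_idem0 a b (f : hom a b) : hadd f f = f -> f = hzero a b.
Proof. by move=> ff; rewrite -(haddN f) -{3}ff haddA haddN hadd0. Qed.

Lemma cmpBl a b c (g g' : hom b c) (f : hom a b) :
  hadd g (hopp g') \oc f = hadd (g \oc f) (hopp (g' \oc f)).
Proof. by rewrite cmpDl cmpNm. Qed.

Lemma cmpBr a b c (g : hom b c) (f f' : hom a b) :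
  g \oc hadd f (hopp f') = hadd (g \oc f) (hopp (g \oc f')).
Proof. by rewrite cmpDr cmpmN. Qed.

Lemma mono0P a b (f : hom a b) :
  (forall x (g : hom x a), f \oc g = hzero x b -> g = hzero x a) -> mono f.
Proof.
move=> f0 x g h fgh; apply: hsub_eq0; apply: f0.
by rewrite cmpBr fgh haddmN.
Qed.

Lemma epi0P a b (f : hom a b) :
  (forall x (g : hom b x), g \oc f = hzero a x -> g = hzero b x) -> epi f.
Proof.
move=> f0 x g h fgh; apply: hsub_eq0; apply: f0.
by rewrite cmpBl fgh haddmN.
Qed.

Lemma mono0 a b (f : hom a b) x (g : hom x a) :
  mono f -> f \oc g = hzero x b -> g = hzero x a.
Proof. by move=> fm fg; apply: fm; rewrite fg cmpm0. Qed.

Lemma epi0 a b (f : hom a b) x (g : hom b x) :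
  epi f -> g \oc f = hzero a x -> g = hzero b x.
Proof. by move=> fm fg; apply: fm; rewrite fg cmp0m. Qed.

Lemma is_kernel_mono k a b (i : hom k a) (f : hom a b) : is_kernel i f -> mono i.
Proof.
case=> fi iU x g h igh; have [|u [_ uU]] := iU x (i \oc h).
  by rewrite cmpA fi cmp0m.
by rewrite -(uU g) // -(uU h).
Qed.

Lemma is_cokernel_epi a b q (f : hom a b) (p : hom b q) : is_cokernel f p -> epi p.
Proof.
case=> pf pU x g h gph; have [|u [_ uU]] := pU x (h \oc p).
  by rewrite -cmpA pf cmpm0.
by rewrite -(uU g) // -(uU h).
Qed.

Lemma kernel_lift k a b (i : hom k a) (f : hom a b) x (g : hom x a) :
  is_kernel i f -> f \oc g = hzero x b -> exists h, i \oc h = g.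
Proof. by case=> _ iU fg; have [h [hP _]] := iU x g fg; exists h. Qed.

Lemma cokernel_desc a b q (f : hom a b) (p : hom b q) x (g : hom b x) :
  is_cokernel f p -> g \oc f = hzero a x -> exists h, h \oc p = g.
Proof. by case=> _ pU fg; have [h [hP _]] := pU x g fg; exists h. Qed.

Lemma is_kernelI k a b (i : hom k a) (f : hom a b) :
  f \oc i = hzero k b -> mono i ->
  (forall x (g : hom x a), f \oc g = hzero x b -> exists h, i \oc h = g) ->
  is_kernel i f.
Proof.
move=> fi im iU; split=> // x g fg; have [h hP] := iU x g fg.
by exists h; split=> // h' h'P; apply: im; rewrite hP.
Qed.

Lemma is_cokernelI a b q (f : hom a b) (p : hom b q) :
  p \oc f = hzero a q -> epi p ->
  (forall x (g : hom b x), g \oc f = hzero a x -> exists h, h \oc p = g) ->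
  is_cokernel f p.
Proof.
move=> fi im iU; split=> // x g fg; have [h hP] := iU x g fg.
by exists h; split=> // h' h'P; apply: im; rewrite hP.
Qed.

Lemma is_zeroP (z : C) : idm z = hzero z z -> is_zero z.
Proof.
move=> z0; split=> x f; first by rewrite -(cmp1m f) z0 cmp0m.
by rewrite -(cmpm1 f) z0 cmpm0.
Qed.

Lemma zero_mono a z (f : hom a z) : is_zero z -> mono f -> is_zero a.
Proof.
move=> [z0 _] fm; apply: is_zeroP; apply: (mono0 fm).
by rewrite cmpm1; exact: z0.
Qed.

Lemma zero_epi z b (f : hom z b) : is_zero z -> epi f -> is_zero b.
Proof.
move=> [_ z0] fm; apply: is_zeroP; apply: (epi0 fm).
by rewrite cmp1m; exact: z0.
Qed.

Lemma zero_iso z b (f : hom z b) : is_zero z -> is_iso f -> is_zero b.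
Proof.
move=> z0 [g [_ fg]]; apply: (zero_epi (f := f) z0) => x h k hk.
by rewrite -(cmpm1 h) -(cmpm1 k) -fg !cmpA hk.
Qed.

(** The inverse is the map sent to the identity. *)
Lemma iso_post a b (f : hom a b) :
  (forall x, bijective (fun g : hom x a => f \oc g)) -> is_iso f.
Proof.
move=> fb; have [g fg] := bij_surj (fb b) (idm b).
exists g; split=> //; apply: (bij_inj (fb a)).
by rewrite cmpA fg cmp1m cmpm1.
Qed.

Lemma iso_post_bij a b (f : hom a b) x :
  is_iso f -> bijective (fun g : hom x a => f \oc g).
Proof.
move=> [f' [f'f ff']]; exists (fun g => f' \oc g) => g.
  by rewrite cmpA f'f cmp1m.
by rewrite cmpA ff' cmp1m.
Qed.

Lemma iso_pre_bij a b (f : hom a b) x :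
  is_iso f -> bijective (fun g : hom b x => g \oc f).
Proof.
move=> [f' [f'f ff']]; exists (fun g => g \oc f') => g.
  by rewrite -cmpA ff' cmpm1.
by rewrite -cmpA f'f cmpm1.
Qed.

(** The injections are the maps with components (1, 0) and (0, 1). *)
Lemma product_biproduct a b s (p1 : hom s a) (p2 : hom s b) :
  (forall x (f : hom x a) (g : hom x b),
     exists h, p1 \oc h = f /\ p2 \oc h = g) ->
  (forall x (h k : hom x s),
     p1 \oc h = p1 \oc k -> p2 \oc h = p2 \oc k -> h = k) ->
  exists (i1 : hom a s) (i2 : hom b s), is_biproduct i1 i2 p1 p2.
Proof.
move=> ex un.
have [i1 [p1i1 p2i1]] := ex a (idm a) (hzero a b).
have [i2 [p1i2 p2i2]] := ex b (hzero b a) (idm b).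
exists i1, i2; split=> //; apply: un; rewrite cmpDr !cmpA cmpm1.
  by rewrite p1i1 p1i2 cmp1m cmp0m haddm0.
by rewrite p2i1 p2i2 cmp1m cmp0m hadd0.
Qed.

(** A map that f is the kernel of factors through the cokernel of f. *)
Lemma kernel_of_cokernel k a b q (f : hom k a) (g : hom a b) (p : hom a q) :
  is_kernel f g -> is_cokernel f p -> is_kernel f p.
Proof.
move=> fg fp; have fm := is_kernel_mono fg.
apply: is_kernelI => //; first by case: fp.
move=> x h ph; apply: (kernel_lift fg).
have [g' <-] := cokernel_desc fp (proj1 fg).
by rewrite -cmpA ph cmpm0.
Qed.

Lemma cokernel_of_kernel a b c k (f : hom a b) (g : hom c a) (i : hom k a) :
  is_cokernel g f -> is_kernel i f -> is_cokernel i f.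
Proof.
move=> fg fp; have fm := is_cokernel_epi fg.
apply: is_cokernelI => //; first by case: fp.
move=> x h ph; apply: (cokernel_desc fg).
have [g' <-] := kernel_lift fp (proj1 fg).
by rewrite cmpA ph cmp0m.
Qed.

End Preadditive.

Section Functors.
Variables (C D : cat) (F : functor C D).

Lemma fmap0 a b : fmap F (hzero a b) = hzero (F a) (F b).
Proof. by apply: hadd_idem0; rewrite -fmapD hadd0. Qed.

Lemma fmapB a b (f g : hom a b) :
  fmap F (hadd f (hopp g)) = hadd (fmap F f) (hopp (fmap F g)).
Proof.
rewrite fmapD; congr (hadd _ _).
by apply: hadd_eq0; rewrite -fmapD haddN fmap0.
Qed.

Lemma fmap_zero z : is_zero z -> is_zero (F z).
Proof. by case=> z0 _; apply: is_zeroP; rewrite -fmap1 (z0 _ (idm z)) fmap0. Qed.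

Lemma fmap_iso a b (f : hom a b) : is_iso f -> is_iso (fmap F f).
Proof.
by case=> g [gf fg]; exists (fmap F g); rewrite -!fmapM gf fg !fmap1.
Qed.

Lemma fmap_biproduct a b s (i1 : hom a s) (i2 : hom b s) p1 p2 :
  is_biproduct i1 i2 p1 p2 ->
  is_biproduct (fmap F i1) (fmap F i2) (fmap F p1) (fmap F p2).
Proof.
case=> p1i1 p2i2 p1i2 p2i1 s1.
by split; rewrite -!fmapM -?fmapD ?(p1i1, p2i2, p1i2, p2i1, s1) ?fmap1 ?fmap0.
Qed.

Lemma biproduct_zero (a b s : C) (i1 : hom a s) (i2 : hom b s) p1 p2 :
  is_zero a -> is_zero b -> is_biproduct i1 i2 p1 p2 -> is_zero s.
Proof.
move=> [_ a0] [_ b0] [_ _ _ _ s1]; apply: is_zeroP.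
by rewrite -s1 (a0 _ i1) (b0 _ i2) !cmp0m hadd0.
Qed.

End Functors.

(** * Abelian categories *)

Section Abelian.
Variable C : cat.

Lemma abelian_op : abelian C -> abelian (op C).
Proof.
case=> [[z [z1 z2]] bi ker coker mo ep]; split=> //.
- by exists z; split.
- move=> a b; have [s [i1 [i2 [p1 [p2 [h1 h2 h3 h4 h5]]]]]] := bi a b.
  by exists s, p1, p2, i1, i2; split.
- by move=> a b f; exact: coker.
- by move=> a b f; exact: ker.
- by move=> a b f fm; exact: (ep b a f fm).
- by move=> a b f fm; exact: (mo b a f fm).
Qed.

(** The map a factors as an epimorphism followed by the kernel of c, and f lifts
    along both.  The first factor is an epimorphism because a map g killing it
    vanishes on a subobject of the kernel containing the image of a; as this
    subobject is itself a kernel, of a map that must factor through c, it is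
    everything. *)
Lemma projective_exact (P x y z : C) (a : hom y x) (c : hom x z) (f : hom P x) :
  abelian C -> projective P -> is_cokernel a c -> c \oc f = hzero P z ->
  exists g, a \oc g = f.
Proof.
move=> Cab Pp ac cf.
have [k [i ic]] := abelian_kernel Cab c.
have im := is_kernel_mono ic.
have [e ie] := kernel_lift ic (proj1 ac).
have [f' if'] := kernel_lift ic cf.
suff: epi e by move=> /Pp-/(_ f')[g eg]; exists g; rewrite -ie -cmpA eg.
apply: epi0P => w g ge.
have [j [l lg]] := abelian_kernel Cab g.
have lm := is_kernel_mono lg.
have [e' le'] := kernel_lift lg ge.
have ilm : mono (i \oc l).
  by move=> v h h' /esym; rewrite -!cmpA => /im/lm.
have [v [u [ui uU]]] := abelian_mono Cab ilm.
have ua : u \oc a = hzero y v by rewrite -ie -le' (cmpA i) cmpA ui cmp0m.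
have [u' u'c] := cokernel_desc ac ua.
have [s ils] : exists s, (i \oc l) \oc s = i.
  apply: (kernel_lift (f := u)); first by split.
  by rewrite -u'c -cmpA (proj1 ic) cmpm0.
have ls : l \oc s = idm k by apply: im; rewrite cmpA ils cmpm1.
by rewrite -(cmpm1 g) -ls cmpA (proj1 lg) cmp0m.
Qed.

Variable P : C -> Prop.

(** The monomorphisms and epimorphisms of the subcategory are those of the big
    category, because it has the same kernels and cokernels. *)
Lemma abelian_full_sub :
  abelian C ->
  (exists z, P z /\ is_zero z) ->
  (forall a b, P a -> P b -> exists s, P s /\
     exists (i1 : hom a s) (i2 : hom b s) p1 p2, is_biproduct i1 i2 p1 p2) ->
  (forall a b (f : hom a b), P a -> P b ->
     exists k, P k /\ exists i : hom k a, is_kernel i f) ->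
  (forall a b (f : hom a b), P a -> P b ->
     exists q, P q /\ exists p : hom b q, is_cokernel f p) ->
  abelian (full_sub P).
Proof.
move=> Cab [z [Pz [z1 z2]]] bi ker coker; split.
- by exists (exist _ z Pz); split=> x f; [exact: z1 | exact: z2].
- move=> [a Pa] [b Pb]; have [s [Ps [i1 [i2 [p1 [p2 [*]]]]]]] := bi a b Pa Pb.
  by exists (exist _ s Ps), i1, i2, p1, p2; split.
- move=> [a Pa] [b Pb] f; have [k [Pk [i [fi iU]]]] := ker a b f Pa Pb.
  by exists (exist _ k Pk), i; split=> // x; exact: iU.
- move=> [a Pa] [b Pb] f; have [q [Pq [p [fi pU]]]] := coker a b f Pa Pb.
  by exists (exist _ q Pq), p; split=> // x; exact: pU.
- move=> [a Pa] [b Pb] f fm.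
  have [k [Pk [i fi]]] := ker a b f Pa Pb.
  have i0 := fm (exist _ k Pk) i (hzero k a).
  have fm' : @mono C a b f.
    apply: mono0P => x g /(kernel_lift fi)[h <-].
    by rewrite i0 ?cmp0m //= (proj1 fi) cmpm0.
  have [c [g fg]] := abelian_mono Cab fm'.
  have [q [Pq [p fp]]] := coker a b f Pa Pb.
  have [pf fU] := kernel_of_cokernel fg fp.
  by exists (exist _ q Pq), p; split=> // x; exact: fU.
- move=> [a Pa] [b Pb] f fm.
  have [k [Pk [i fi]]] := coker a b f Pa Pb.
  have i0 := fm (exist _ k Pk) i (hzero b k).
  have fm' : @epi C a b f.
    apply: epi0P => x g /(cokernel_desc fi)[h <-].
    by rewrite i0 ?cmpm0 //= (proj1 fi) cmp0m.
  have [c [g fg]] := abelian_epi Cab fm'.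
  have [q [Pq [p fp]]] := ker a b f Pa Pb.
  have [pf fU] := cokernel_of_kernel fg fp.
  by exists (exist _ q Pq), p; split=> // x; exact: fU.
Qed.

End Abelian.

(** * Adjoint functors *)

Section Adjoint.
Variables (C D : cat).

Lemma unit_adjoint (L : functor C D) (R : functor D C)
    (eta : forall a, hom a (R (L a))) :
  (forall a a' (h : hom a' a), fmap R (fmap L h) \oc eta a' = eta a \oc h) ->
  (forall a b, bijective (fun f : hom (L a) b => fmap R f \oc eta a)) ->
  adjoint L R.
Proof.
move=> nat bij; exists (fun a b f => fmap R f \oc eta a); split=> //.
- by move=> a b b' g f; rewrite fmapM cmpA.
- by move=> a a' b h f; rewrite fmapM -!cmpA nat.
Qed.

Lemma adjoint_counit (L : functor C D) (R : functor D C) :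
  adjoint L R -> exists eps : forall b, hom (L (R b)) b,
  (forall b b' (h : hom b b'), eps b' \oc fmap L (fmap R h) = h \oc eps b) /\
  (forall a b, bijective (fun f : hom a (R b) => eps b \oc fmap L f)).
Proof.
case=> phi [bij natb nata].
pose eps b := projT1 (cid (bij_surj (bij _ _) (idm (R b)))).
have epsE b : phi _ _ (eps b) = idm (R b).
  by rewrite /eps; case: (cid _) => /=.
have psi a b (f : hom a (R b)) : phi _ _ (eps b \oc fmap L f) = f.
  by rewrite nata epsE cmp1m.
exists eps; split.
- move=> b b' h; apply: (bij_inj (bij _ _)).
  by rewrite psi natb epsE cmpm1.
- move=> a b; exists (phi a b) => f //.
  by apply: (bij_inj (bij a b)); rewrite psi.
Qed.

Lemma universal_left_adjoint (R : functor D C) :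
  (forall a, exists (x : D) (eta : hom a (R x)),
     forall b, bijective (fun f : hom x b => fmap R f \oc eta)) ->
  exists L : functor C D, adjoint L R.
Proof.
move=> H; have [L0 HL] := choice H.
pose eta a : hom a (R (L0 a)) := projT1 (cid (HL a)).
have bij a b : bijective (fun f : hom (L0 a) b => fmap R f \oc eta a).
  by rewrite /eta; case: (cid _) => /=.
pose L1 a a' (h : hom a a') := projT1 (cid (bij_surj (bij a _) (eta a' \oc h))).
have L1E a a' (h : hom a a') : fmap R (L1 _ _ h) \oc eta a = eta a' \oc h.
  by rewrite /L1; case: (cid _).
have Lid a : L1 _ _ (idm a) = idm _.
  by apply: (bij_inj (bij _ _)); rewrite L1E fmap1 cmpm1 cmp1m.
have Lcmp a b c (g : hom b c) (f : hom a b) :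
    L1 _ _ (g \oc f) = L1 _ _ g \oc L1 _ _ f.
  by apply: (bij_inj (bij _ _)); rewrite L1E fmapM -cmpA L1E !cmpA L1E.
have Ladd a b (f g : hom a b) : L1 _ _ (hadd f g) = hadd (L1 _ _ f) (L1 _ _ g).
  by apply: (bij_inj (bij _ _)); rewrite L1E fmapD cmpDl !L1E cmpDr.
exists (Functor Lid Lcmp Ladd).
by apply: (unit_adjoint (L := Functor Lid Lcmp Ladd) (eta := eta)).
Qed.

Lemma universal_right_adjoint (L : functor C D) :
  (forall b, exists (x : C) (eps : hom (L x) b),
     forall a, bijective (fun f : hom a x => eps \oc fmap L f)) ->
  exists R : functor D C, adjoint L R.
Proof.
move=> H; have [R0 HR] := choice H.
pose eps b : hom (L (R0 b)) b := projT1 (cid (HR b)).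
have bij a b : bijective (fun f : hom a (R0 b) => eps b \oc fmap L f).
  by rewrite /eps; case: (cid _) => /=.
pose R1 b b' (h : hom b b') := projT1 (cid (bij_surj (bij _ b') (h \oc eps b))).
have R1E b b' (h : hom b b') : eps b' \oc fmap L (R1 _ _ h) = h \oc eps b.
  by rewrite /R1; case: (cid _).
have Rid a : R1 _ _ (idm a) = idm _.
  by apply: (bij_inj (bij _ _)); rewrite R1E fmap1 cmpm1 cmp1m.
have Rcmp a b c (g : hom b c) (f : hom a b) :
    R1 _ _ (g \oc f) = R1 _ _ g \oc R1 _ _ f.
  by apply: (bij_inj (bij _ _)); rewrite R1E fmapM cmpA R1E -!cmpA R1E.
have Radd a b (f g : hom a b) : R1 _ _ (hadd f g) = hadd (R1 _ _ f) (R1 _ _ g).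
  by apply: (bij_inj (bij _ _)); rewrite R1E fmapD cmpDr !R1E cmpDl.
exists (Functor Rid Rcmp Radd).
pose R := Functor Rid Rcmp Radd.
have psi a b (f : hom (L a) b) := cid (bij_surj (bij a b) f).
exists (fun a b f => projT1 (psi a b f)).
have psiE a b f : eps b \oc fmap L (projT1 (psi a b f)) = f.
  by case: (psi a b f).
split=> /=.
- move=> a b; exists (fun g => eps b \oc fmap L g) => f; first exact: psiE.
  by apply: (bij_inj (bij a b)); rewrite psiE.
- move=> a b b' g f; apply: (bij_inj (bij _ _)).
  by rewrite psiE fmapM cmpA R1E -cmpA psiE.
- move=> a a' b h f; apply: (bij_inj (bij _ _)).
  by rewrite psiE fmapM cmpA psiE.
Qed.

Lemma left_adjoint_cokernel (L : functor C D) (R : functor D C) :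
  adjoint L R -> forall (a b q : C) (f : hom a b) (p : hom b q),
  is_cokernel f p -> is_cokernel (fmap L f) (fmap L p).
Proof.
case=> phi [bij natb nata] a b q f p fp.
apply: is_cokernelI; first by rewrite -fmapM (proj1 fp) fmap0.
- move=> x g h; move/(congr1 (phi _ _)); rewrite !nata.
  by move/(is_cokernel_epi fp)/(bij_inj (bij _ _)).
- move=> x g gf; have phi0 : phi b x g \oc f = hzero a (R x).
    rewrite -nata gf -(cmp0m x (hzero (L a) x)) natb.
    by rewrite fmap0 cmp0m.
  have [h hp] := cokernel_desc fp phi0.
  have [k kh] := bij_surj (bij _ _) h.
  by exists k; apply: (bij_inj (bij _ _)); rewrite nata kh.
Qed.

Lemma right_adjoint_kernel (L : functor C D) (R : functor D C) :
  adjoint L R -> forall (k a b : D) (i : hom k a) (f : hom a b),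
  is_kernel i f -> is_kernel (fmap R i) (fmap R f).
Proof.
case=> phi [bij natb nata] k a b i f fi.
apply: is_kernelI; first by rewrite -fmapM (proj1 fi) fmap0.
- move=> x g h.
  have [g' <-] := bij_surj (bij _ _) g; have [h' <-] := bij_surj (bij _ _) h.
  by rewrite -!natb => /(bij_inj (bij _ _))/(is_kernel_mono fi) ->.
- move=> x g; have [g' <-] := bij_surj (bij _ _) g; rewrite -natb => fg.
  have [|h hP] := kernel_lift (g := g') fi.
    apply: (bij_inj (bij _ _)); rewrite fg.
    by rewrite -(cmp0m b (hzero (L x) b)) natb fmap0 cmp0m.
  by exists (phi _ _ h); rewrite -natb hP.
Qed.

End Adjoint.
(** * The recollement attached to an adjoint triple *)

Section Triple.
Variables (A A'' : cat) (F : functor A A'') (L R : functor A'' A).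
Variable eta : forall c, hom c (F (L c)).
Hypothesis eta_nat : forall c c' (h : hom c' c),
  fmap F (fmap L h) \oc eta c' = eta c \oc h.
Hypothesis eta_univ : forall c a,
  bijective (fun f : hom (L c) a => fmap F f \oc eta c).
Hypothesis eta_iso : forall c, is_iso (eta c).
Hypothesis FR : adjoint F R.

Let LF : adjoint L F. Proof. exact: unit_adjoint eta_nat eta_univ. Qed.

(** The transpose of L f is eta composed with f, by naturality. *)
Lemma left_ff_of_unit_iso : fully_faithful L.
Proof.
move=> a b.
have [g gK Kg] := eta_univ a (L b).
have [h hK Kh] := iso_post_bij a (eta_iso b).
exists (fun f => h (fmap F f \oc eta a)).
  by move=> f; rewrite eta_nat hK.
move=> f; apply: (can_inj gK).
by rewrite eta_nat; exact: Kh.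
Qed.

(** In an adjoint triple the two outer functors are fully faithful together:
    mapping c into the counit F R a -> a amounts, through the unit
    c -> F L c, to transposing twice. *)
Lemma counit_iso (eps : forall b, hom (F (R b)) b) :
  (forall a b, bijective (fun f : hom a (R b) => eps b \oc fmap F f)) ->
  forall b, is_iso (eps b).
Proof.
move=> eps_univ b; apply: iso_post => c.
have bij1 := eta_univ c (R b).
have bij2 := eps_univ (L c) b.
have bij3 := iso_pre_bij b (eta_iso c).
have [g gK Kg] := bij1.
have [h hK Kh] := bij_comp bij3 bij2.
exists (fun k => fmap F (h k) \oc eta c).
- move=> k; rewrite -[in RHS](Kg k); congr (fmap F _ \oc _).
  by rewrite -[in RHS](hK (g k)) /= -cmpA Kg.
- by move=> k; rewrite cmpA; exact: Kh.
Qed.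

Lemma right_ff_of_unit_iso : fully_faithful R.
Proof.
have [eps [eps_nat eps_univ]] := adjoint_counit FR.
move=> a b.
have [g gK Kg] := eps_univ (R a) b.
have [h hK Kh] := iso_pre_bij b (counit_iso eps_univ a).
exists (fun f => h (eps b \oc fmap F f)).
  by move=> f; rewrite eps_nat hK.
move=> f; apply: (can_inj gK).
by rewrite eps_nat; exact: Kh.
Qed.

Hypotheses (Aab : abelian A) (A''ab : abelian A'').

Lemma abelian_Ker : abelian (Ker F).
Proof.
apply: abelian_full_sub => //.
- have [z z0] := abelian_zero Aab.
  by exists z; split=> //; exact: fmap_zero.
- move=> a b a0 b0; have [s [i1 [i2 [p1 [p2 sP]]]]] := abelian_biproduct Aab a b.
  exists s; split; last by exists i1, i2, p1, p2.
  exact: biproduct_zero (fmap_biproduct F sP).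
- move=> a b f a0 b0; have [k [i ik]] := abelian_kernel Aab f.
  exists k; split; last by exists i.
  exact: zero_mono a0 (is_kernel_mono (right_adjoint_kernel LF ik)).
- move=> a b f a0 b0; have [k [i ik]] := abelian_cokernel Aab f.
  exists k; split; last by exists i.
  exact: zero_epi b0 (is_cokernel_epi (left_adjoint_cokernel FR ik)).
Qed.

(** The reflection of x into Ker F is the cokernel of the counit L F x -> x:
    there is no nonzero map from L F x to an object killed by F. *)
Lemma Ker_incl_left : exists i_upper, adjoint i_upper (Ker_incl F).
Proof.
apply: universal_left_adjoint => x.
have [e eE] := bij_surj (eta_univ (F x) x) (idm (F x)).
have [q [p pe]] := abelian_cokernel Aab e.
have Fpe := left_adjoint_cokernel FR pe.
have Fe : epi (fmap F e).
  move=> z g h gh; rewrite -(cmpm1 g) -(cmpm1 h) -eE !cmpA.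
  by rewrite gh.
have Fp0 : fmap F p = hzero _ _.
  by apply: (epi0 Fe); rewrite (proj1 Fpe).
have q0 : is_zero (F q).
  apply: is_zeroP; apply: (epi0 (is_cokernel_epi Fpe)).
  by rewrite Fp0 cmpm0.
exists (exist _ q q0), p => -[b b0] /=.
apply: bijective_of_surj_inj => [f|f g].
  apply: (cokernel_desc pe); apply: (bij_inj (eta_univ _ _)).
  by rewrite !(proj1 b0 _ (fmap F _ \oc _)).
exact: (is_cokernel_epi pe).
Qed.

Lemma Ker_incl_right : exists i_shriek, adjoint (Ker_incl F) i_shriek.
Proof.
apply: universal_right_adjoint => x.
have [eps [_ eps_univ]] := adjoint_counit FR.
have [e eE] := bij_surj (eps_univ x (F x)) (idm (F x)).
have [k [i ie]] := abelian_kernel Aab e.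
have Fie := right_adjoint_kernel LF ie.
have Fe : mono (fmap F e).
  move=> z g h gh; rewrite -(cmp1m g) -(cmp1m h) -eE -!cmpA.
  by rewrite gh.
have Fi0 : fmap F i = hzero _ _.
  by apply: (mono0 Fe); rewrite (proj1 Fie).
have k0 : is_zero (F k).
  apply: is_zeroP; apply: (mono0 (is_kernel_mono Fie)).
  by rewrite Fi0 cmp0m.
exists (exist _ k k0), i => -[b b0] /=.
apply: bijective_of_surj_inj => [f|f g].
  apply: (kernel_lift ie); apply: (bij_inj (eps_univ _ _)).
  by rewrite !(proj2 b0 _ (_ \oc fmap F _)).
exact: (is_kernel_mono ie).
Qed.

Lemma triple_recollement : exists i_upper i_shriek : functor A (Ker F),
  recollement (Ker_incl F) i_upper i_shriek F L R.
Proof.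
have [i_upper iU] := Ker_incl_left.
have [i_shriek iS] := Ker_incl_right.
exists i_upper, i_shriek; split=> //.
- exact: abelian_Ker.
- move=> x; split=> [[[x' x'0] [f fi]] | x0].
    by apply: zero_iso x'0 (fmap_iso F fi).
  exists (exist _ x x0), (idm x), (idm x).
  by rewrite cmp1m.
- by move=> a b; exists id.
- exact: left_ff_of_unit_iso.
- exact: right_ff_of_unit_iso.
Qed.

End Triple.

(** * The zeroth left derived functor *)

Section L0.
Variables (C B : cat) (T : functor C B).
Hypothesis Cab : abelian C.
Hypothesis enough : forall G : C, exists P (p : hom P G), projective P /\ epi p.

Lemma proj_presentation_ex (G : C) :
  exists P1 P0 (d : hom P1 P0) (p : hom P0 G), proj_presentation d p.
Proof.
have [P0 [p [P0p pe]]] := enough G.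
have [c [g gp]] := abelian_epi Cab pe.
have [P1 [e [P1p ee]]] := enough c.
exists P1, P0, (g \oc e), p; split=> //; apply: is_cokernelI => //.
  by rewrite cmpA (proj1 gp) cmp0m.
move=> x h; rewrite cmpA => /(epi0 ee); exact: cokernel_desc.
Qed.

Lemma lift_presentation (P1 P0 G : C) (d : hom P1 P0) (p : hom P0 G)
    (P1' P0' G' : C) (d' : hom P1' P0') (p' : hom P0' G') (f : hom G G') :
  proj_presentation d p -> proj_presentation d' p' ->
  exists f0 f1, f \oc p = p' \oc f0 /\ f0 \oc d = d' \oc f1.
Proof.
move=> [P1p P0p dp] [P1'p P0'p dp'].
have [f0 f0P] := P0p _ _ p' (f \oc p) (is_cokernel_epi dp').
exists f0; have [|f1 f1P] := projective_exact (f := f0 \oc d) Cab P1p dp'.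
  by rewrite cmpA f0P -cmpA (proj1 dp) cmpm0.
by exists f1.
Qed.

(** The difference of u and v factors through d', which T and then q kill. *)
Lemma lift_unique (P P1' P0' G' : C) (d' : hom P1' P0') (p' : hom P0' G')
    (u v : hom P P0') x (q : hom (T P0') x) :
  projective P -> is_cokernel d' p' -> q \oc fmap T d' = hzero _ _ ->
  p' \oc u = p' \oc v -> q \oc fmap T u = q \oc fmap T v.
Proof.
move=> Pp dp' qd uv.
have [|w wP] := projective_exact (f := hadd u (hopp v)) Cab Pp dp'.
  by rewrite cmpBr uv haddmN.
by rewrite -(hsubK u v) fmapD cmpDr -wP fmapM cmpA qd cmp0m hadd0.
Qed.

Hypothesis Bcoker : forall (a b : B) (f : hom a b),
  exists q (p : hom b q), is_cokernel f p.

(** The value at G is the cokernel of T d for a chosen presentation d of G; by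
    uniqueness of lifts up to d', any other presentation has the same cokernel. *)
Lemma L0_exists : exists D, is_L0 T D.
Proof.
have H G : exists z : {P1 : C & {P0 : C & (hom P1 P0 * hom P0 G)%type}},
    proj_presentation (projT2 (projT2 z)).1 (projT2 (projT2 z)).2.
  have [P1 [P0 [d [p dp]]]] := proj_presentation_ex G.
  by exists (existT _ P1 (existT _ P0 (d, p))).
pose P1 G := projT1 (projT1 (cid (H G))).
pose P0 G := projT1 (projT2 (projT1 (cid (H G)))).
pose d G : hom (P1 G) (P0 G) := (projT2 (projT2 (projT1 (cid (H G))))).1.
pose p G : hom (P0 G) G := (projT2 (projT2 (projT1 (cid (H G))))).2.
have dp G : proj_presentation (d G) (p G) := projT2 (cid (H G)).
move: P1 P0 d p dp => P1 P0 d p dp {H}.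
pose D0 G := projT1 (cid (Bcoker (fmap T (d G)))).
pose q0 G : hom (T (P0 G)) (D0 G) := projT1 (cid (projT2 (cid (Bcoker (fmap T (d G)))))).
have q0P G : is_cokernel (fmap T (d G)) (q0 G) :=
  projT2 (cid (projT2 (cid (Bcoker (fmap T (d G)))))).
move: D0 q0 q0P => D0 q0 q0P.
have q0e G := is_cokernel_epi (q0P G).
pose l P1' P0' G' (d' : hom P1' P0') (p' : hom P0' G')
  (dp' : proj_presentation d' p') G (f : hom G' G) :=
  cid (lift_presentation f dp' (dp G)).
have l0 P1' P0' G' d' p' dp' G f :
    q0 G \oc fmap T (projT1 (@l P1' P0' G' d' p' dp' G f)) \oc fmap T d' = hzero _ _.
  case: (l _ _ _ _ _ _ _ _) => f0 [f1 [_ f0d]] /=.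
  by rewrite -cmpA -fmapM f0d fmapM cmpA (proj1 (q0P _)) cmp0m.
have DE G' G (f : hom G' G) := cid (cokernel_desc (q0P G') (l0 _ _ _ _ _ (dp G') G f)).
pose D1 G' G (f : hom G' G) := projT1 (DE _ _ f).
(* The value of D f is pinned down by any lift of f, chosen or not. *)
have D1P G' G (f : hom G' G) (f0 : hom (P0 G') (P0 G)) :
    f \oc p G' = p G \oc f0 -> D1 _ _ f \oc q0 G' = q0 G \oc fmap T f0.
  rewrite /D1; case: (DE _ _ f) => h /= -> fp.
  case: (l _ _ _ _ _ _ _ _) => f0' [f1 [f0'p _]] /=.
  apply: lift_unique (proj1 (q0P _)) _; try by case: (dp G') (dp G).
    by case: (dp G) => _ _; exact.
  by rewrite -f0'p.
have Did G : D1 _ _ (idm G) = idm (D0 G).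
  apply: q0e; rewrite (D1P _ _ _ (idm _)) ?cmp1m ?cmpm1 ?fmap1 ?cmpm1 //.
have Dcmp a b c (g : hom b c) (f : hom a b) :
    D1 _ _ (g \oc f) = D1 _ _ g \oc D1 _ _ f.
  have [f0 [f1 [fp _]]] := lift_presentation f (dp a) (dp b).
  have [g0 [g1 [gp _]]] := lift_presentation g (dp b) (dp c).
  apply: q0e; rewrite (D1P _ _ _ (g0 \oc f0)) -?cmpA ?(D1P _ _ _ f0) //.
    by rewrite cmpA (D1P _ _ _ g0) // fmapM cmpA.
  by rewrite fp !cmpA gp.
have Dadd a b (f g : hom a b) : D1 _ _ (hadd f g) = hadd (D1 _ _ f) (D1 _ _ g).
  have [f0 [f1 [fp _]]] := lift_presentation f (dp a) (dp b).
  have [g0 [g1 [gp _]]] := lift_presentation g (dp a) (dp b).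
  apply: q0e; rewrite (D1P _ _ _ (hadd f0 g0)).
    by rewrite cmpDl (D1P _ _ _ _ fp) (D1P _ _ _ _ gp) fmapD cmpDr.
  by rewrite cmpDl cmpDr fp gp.
exists (Functor Did Dcmp Dadd).
exists (fun P1' P0' G' d' p' dp' =>
  q0 G' \oc fmap T (projT1 (l P1' P0' G' d' p' dp' G' (idm G')))); split.
- move=> P1' P0' G d' p' dp'.
  have qd := l0 _ _ _ _ _ dp' G (idm G); move: qd.
  case: (l _ _ _ _ _ _ _ _) => u [u1 [up ud]] /= qd.
  have [v [v1 [vp vd]]] := lift_presentation (idm G) (dp G) dp'.
  rewrite cmp1m in up; rewrite cmp1m in vp.
  apply: is_cokernelI => // [x g h|x g gd].
    move/(congr1 (fun z => z \oc fmap T v)); rewrite -!cmpA -fmapM.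
    rewrite (lift_unique (p' := p G) (v := idm _) _ _ (proj1 (q0P G))) ?fmap1 ?cmpm1.
    + exact: q0e.
    + by case: (dp G).
    + by case: (dp G).
    + by rewrite cmpA -up -vp.
  have gvd : g \oc fmap T v \oc fmap T (d G) = hzero _ _.
    by rewrite -cmpA -fmapM vd fmapM cmpA gd cmp0m.
  have [h hq] := cokernel_desc (q0P G) gvd.
  exists h; rewrite cmpA hq -cmpA -fmapM.
  rewrite (lift_unique (p' := p') (v := idm _) _ _ gd) ?fmap1 ?cmpm1 //.
  + by case: dp'.
  + by case: dp'.
  + by rewrite cmpA -vp -up.
- move=> Q1 Q0 G e r Q1' Q0' G' e' r' H H' f1 f0 f f0d fp /=.
  case: (l _ _ _ _ _ _ _ _) => u [u1 [up ud]] /=.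
  case: (l _ _ _ _ _ _ _ _) => u' [u1' [up' ud']] /=.
  rewrite cmp1m in up; rewrite cmp1m in up'.
  have [g0 [g1 [gp _]]] := lift_presentation f (dp G) (dp G').
  rewrite cmpA (D1P _ _ _ _ gp) -!cmpA -!fmapM.
  apply: (lift_unique (p' := p G') _ _ (proj1 (q0P G'))).
  + by case: H.
  + by case: (dp G').
  + by rewrite !cmpA -gp -up' -cmpA -up fp.
Qed.

(** A projective presentation P1 -> P0 -> G -> 0 presents F D G as the cokernel of
    F T P1 -> F T P0, that is, through eta, of P1 -> P0; so eta extends to G, and
    the extension is invertible.  A map from D G to b is a map from T P0 to b
    killing T P1, that is a map from P0 to F b killing P1, that is a map from G
    to F b. *)
Lemma L0_unit (F : functor B C) (D : functor C B)
    (eta : forall P, hom P (F (T P))) :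
  is_L0 T D ->
  (forall (a b q : B) (f : hom a b) (p : hom b q),
     is_cokernel f p -> is_cokernel (fmap F f) (fmap F p)) ->
  (forall c c' (h : hom c' c), fmap F (fmap T h) \oc eta c' = eta c \oc h) ->
  (forall P, projective P -> is_iso (eta P)) ->
  (forall P b, projective P ->
     bijective (fun f : hom (T P) b => fmap F f \oc eta P)) ->
  exists eta' : forall G, hom G (F (D G)),
  [/\ forall c c' (h : hom c' c), fmap F (fmap D h) \oc eta' c' = eta' c \oc h,
      forall G b, bijective (fun f : hom (D G) b => fmap F f \oc eta' G) &
      forall G, is_iso (eta' G)].
Proof.
move=> [q [qP qnat]] Fcok eta_nat eta_iso eta_bij.
have H G : exists e : hom G (F (D G)),
    forall P1 P0 (d : hom P1 P0) (p : hom P0 G) (H : proj_presentation d p),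
    e \oc p = fmap F (q _ _ _ _ _ H) \oc eta P0.
  have [P1 [P0 [d [p dp]]]] := proj_presentation_ex G.
  have [P1p P0p dpc] := dp.
  have Fq := Fcok _ _ _ _ _ (qP _ _ _ _ _ dp).
  have [|e eP] := cokernel_desc (g := fmap F (q _ _ _ _ _ dp) \oc eta P0) dpc.
    by rewrite -cmpA -eta_nat cmpA (proj1 Fq) cmp0m.
  exists e => P1' P0' d' p' dp'.
  have [u [u1 [up ud]]] := lift_presentation (idm G) dp' dp.
  have qu := qnat _ _ _ _ _ _ _ _ _ _ dp' dp _ _ _ ud up.
  rewrite fmap1 cmp1m in qu; rewrite cmp1m in up.
  by rewrite qu fmapM -cmpA eta_nat cmpA -eP up cmpA.
pose eta' G := projT1 (cid (H G)).
have eta'P G P1 P0 (d : hom P1 P0) (p : hom P0 G) (Hp : proj_presentation d p) :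
  eta' G \oc p = fmap F (q _ _ _ _ _ Hp) \oc eta P0.
  by rewrite /eta'; case: (cid _).
exists eta'; split.
- move=> c c' h.
  have [P1 [P0 [d [p dp]]]] := proj_presentation_ex c'.
  have [P1' [P0' [d' [p' dp']]]] := proj_presentation_ex c.
  have [f0 [f1 [f0p f0d]]] := lift_presentation h dp dp'.
  have [_ _ /is_cokernel_epi pe] := dp; apply: pe.
  rewrite -!cmpA (eta'P _ _ _ _ _ dp) f0p !cmpA (eta'P _ _ _ _ _ dp').
  rewrite -fmapM (qnat _ _ _ _ _ _ _ _ _ _ dp dp' _ _ _ f0d f0p).
  by rewrite fmapM -!cmpA eta_nat.
- move=> G b.
  have [P1 [P0 [d [p dp]]]] := proj_presentation_ex G.
  have [P1p P0p dpc] := dp; have qc := qP _ _ _ _ _ dp.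
  apply: bijective_of_surj_inj => [f|f g].
    have [g gP] := bij_surj (eta_bij P0 b P0p) (f \oc p).
    have [|h hq] := cokernel_desc (g := g) qc.
      apply: (bij_inj (eta_bij P1 b P1p)).
      rewrite fmapM -cmpA eta_nat cmpA gP -cmpA (proj1 dpc).
      by rewrite fmap0 cmpm0 cmp0m.
    exists h; apply: (is_cokernel_epi dpc).
    by rewrite -cmpA (eta'P _ _ _ _ _ dp) cmpA -fmapM hq gP.
  move/(congr1 (fun z => z \oc p)); rewrite -!cmpA (eta'P _ _ _ _ _ dp) !cmpA -!fmapM.
  by move/(bij_inj (eta_bij P0 b P0p))/(is_cokernel_epi qc).
- move=> G.
  have [P1 [P0 [d [p dp]]]] := proj_presentation_ex G.
  have [P1p P0p dpc] := dp; have Fq := Fcok _ _ _ _ _ (qP _ _ _ _ _ dp).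
  have [t1 [t1e et1]] := eta_iso P1 P1p; have [t0 [t0e et0]] := eta_iso P0 P0p.
  have [|g gP] := cokernel_desc (g := p \oc t0) Fq.
    rewrite -(cmpm1 (fmap F _)) -et1 (cmpA (fmap F _)) eta_nat -!cmpA.
    by rewrite (cmpA t0) t0e cmp1m cmpA (proj1 dpc) cmp0m.
  exists g; split.
    apply: (is_cokernel_epi dpc).
    by rewrite -cmpA (eta'P _ _ _ _ _ dp) cmpA gP -cmpA t0e cmpm1 cmp1m.
  apply: (is_cokernel_epi Fq); rewrite -cmpA gP cmpA (eta'P _ _ _ _ _ dp).
  by rewrite -cmpA et0 cmpm1 cmp1m.
Qed.

End L0.
(** * Abelian groups *)

(** Morphisms of abelian groups are bundled maps only up to conversion; the
    function applying them gives rewriting a head symbol to recognize. *)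
Definition app (A B : Ab) (f : hom A B) (x : (A : zmodType)) : (B : zmodType) :=
  (f : {additive _ -> _}) x.

Section App.
Variables A B C : Ab.
Implicit Types (f : hom A B) (x : (A : zmodType)).

Lemma app_ext f f' : (forall x, app f x = app f' x) -> f = f'.
Proof. exact: additive_ext. Qed.

Lemma app_cmp (g : hom B C) f x : app (g \oc f) x = app g (app f x).
Proof. by []. Qed.

Lemma app_hadd f f' x : app (hadd f f') x = app f x + app f' x.
Proof. by []. Qed.

Lemma appD f x y : app f (x + y) = app f x + app f y.
Proof. exact: (raddfD (f : {additive _ -> _})). Qed.

Lemma app0 f : app f 0 = 0.
Proof. exact: (raddf0 (f : {additive _ -> _})). Qed.

Lemma appN f x : app f (- x) = - app f x.
Proof. exact: (raddfN (f : {additive _ -> _})). Qed.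

Lemma appB f x y : app f (x - y) = app f x - app f y.
Proof. exact: (raddfB (f : {additive _ -> _})). Qed.

Lemma app_sum f I r (P : pred I) (E : I -> (A : zmodType)) :
  app f (\sum_(i <- r | P i) E i) = \sum_(i <- r | P i) app f (E i).
Proof. exact: (raddf_sum (f : {additive _ -> _})). Qed.

Lemma app_inj0 f : (forall x, app f x = 0 -> x = 0) -> injective (app f).
Proof.
move=> f0 x y fxy; apply/eqP; rewrite -subr_eq0; apply/eqP; apply: f0.
by rewrite appB fxy subrr.
Qed.
End App.

Section MkAb.
Variables (A B : zmodType) (f : A -> B).
Hypothesis fD : forall x y, f (x + y) = f x + f y.

Lemma mkab_zmod : zmod_morphism f.
Proof.
move=> x y; apply: (addIr (f y)); rewrite -fD !subrK.
by [].
Qed.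

Definition mkab : @hom Ab A B :=
  HB.pack f (GRing.isZmodMorphism.Build _ _ f mkab_zmod).

Lemma app_mkab x : app mkab x = f x. Proof. by []. Qed.
End MkAb.

Record subgroup (A : zmodType) := Subgroup {
  sg_mem :> A -> Prop;
  sg0 : sg_mem 0;
  sgB : forall x y, sg_mem x -> sg_mem y -> sg_mem (x - y)
}.

Section Subgroup.
Variables (A : zmodType) (S : subgroup A).

Lemma sgN x : S x -> S (- x).
Proof. by move=> Sx; rewrite -sub0r; apply: sgB => //; exact: sg0. Qed.

Lemma sgD x y : S x -> S y -> S (x + y).
Proof. by move=> Sx Sy; rewrite -(opprK y); apply: sgB => //; exact: sgN. Qed.

Definition subg := {x : A | S x}.

HB.instance Definition _ := gen_eqMixin subg.
HB.instance Definition _ := gen_choiceMixin subg.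

Lemma subg_inj (x y : subg) : sval x = sval y -> x = y.
Proof. by case: x y => [x Sx] [y Sy] /= xy; apply: eq_exist. Qed.

Let add (x y : subg) : subg := exist _ _ (sgD (svalP x) (svalP y)).
Let opp (x : subg) : subg := exist _ _ (sgN (svalP x)).
Let zero : subg := exist _ _ (sg0 S).

Let addA : associative add.
Proof. by move=> x y z; apply: subg_inj; rewrite /= addrA. Qed.
Let addC : commutative add.
Proof. by move=> x y; apply: subg_inj; rewrite /= addrC. Qed.
Let add0 : left_id zero add.
Proof. by move=> x; apply: subg_inj; rewrite /= add0r. Qed.
Let addN : left_inverse zero opp add.
Proof. by move=> x; apply: subg_inj; rewrite /= addNr. Qed.

HB.instance Definition _ := GRing.isZmodule.Build subg addA addC add0 addN.

(** The quotient is the set of cosets, as predicates on the group. *)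
Definition quotg :=
  {U : A -> Prop | exists a, U = fun x => S (x - a)}.

HB.instance Definition _ := gen_eqMixin quotg.
HB.instance Definition _ := gen_choiceMixin quotg.

Definition qcls (a : A) : quotg :=
  exist (fun U => exists a, U = fun x => S (x - a)) (fun x => S (x - a)) (ex_intro _ a
      erefl).

Lemma qcls_eq a b : qcls a = qcls b <-> S (a - b).
Proof.
split=> [/(congr1 sval)/= /(congr1 (fun U => U a)) <- | Sab].
  by rewrite subrr; exact: sg0.
apply: eq_exist; apply/funext => x; apply: propext; split=> Sx.
  by rewrite -(subrK a x) -addrA; exact: sgD.
by rewrite -(subrK b x) -addrA; apply: sgD => //; rewrite -opprB; exact: sgN.
Qed.

Lemma qcls_surj (u : quotg) : exists a, qcls a = u.
Proof. by case: u => U [a Ua]; exists a; apply: eq_exist; rewrite Ua. Qed.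

Definition qrep (u : quotg) : A := projT1 (cid (qcls_surj u)).

Lemma qrepK u : qcls (qrep u) = u.
Proof. by rewrite /qrep; case: (cid _). Qed.

Let qadd u v := qcls (qrep u + qrep v).
Let qopp u := qcls (- qrep u).

Let qrep_cls a : S (qrep (qcls a) - a).
Proof. by apply/qcls_eq; rewrite qrepK. Qed.

Let qaddE a b : qadd (qcls a) (qcls b) = qcls (a + b).
Proof. by apply/qcls_eq; rewrite opprD addrACA; apply: sgD; exact: qrep_cls. Qed.
Let qoppE a : qopp (qcls a) = qcls (- a).
Proof. by apply/qcls_eq; rewrite -opprD; apply: sgN; exact: qrep_cls. Qed.

Let qaddA : associative qadd.
Proof.
move=> x y z; rewrite -(qrepK x) -(qrepK y) -(qrepK z) !qaddE.
by rewrite addrA.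
Qed.
Let qaddC : commutative qadd.
Proof. by move=> x y; rewrite /qadd addrC. Qed.
Let qadd0 : left_id (qcls 0) qadd.
Proof. by move=> x; rewrite -(qrepK x) qaddE add0r. Qed.
Let qaddN : left_inverse (qcls 0) qopp qadd.
Proof. by move=> x; rewrite -(qrepK x) qoppE qaddE addNr. Qed.

HB.instance Definition _ := GRing.isZmodule.Build quotg qaddA qaddC qadd0 qaddN.

Lemma qclsD a b : qcls (a + b) = qcls a + qcls b.
Proof. exact: esym (qaddE a b). Qed.

Definition quotg_proj : @hom Ab A quotg := mkab qclsD.

Lemma quotg_proj0 a : app quotg_proj a = 0 <-> S a.
Proof. by rewrite -{2}(subr0 a); exact: (qcls_eq a 0). Qed.

Lemma quotg_proj_surj u : exists a, app quotg_proj a = u.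
Proof. exact: qcls_surj. Qed.

End Subgroup.

Section Products.
Variables (I : Type) (A : I -> zmodType).

Definition prodg := forall i, A i.

HB.instance Definition _ := gen_eqMixin prodg.
HB.instance Definition _ := gen_choiceMixin prodg.

Let add (x y : prodg) : prodg := fun i => x i + y i.
Let opp (x : prodg) : prodg := fun i => - x i.
Let zero : prodg := fun i => 0.

Let addA : associative add.
Proof. by move=> x y z; apply: functional_extensionality_dep => i; exact: addrA. Qed.
Let addC : commutative add.
Proof. by move=> x y; apply: functional_extensionality_dep => i; exact: addrC. Qed.
Let add0 : left_id zero add.
Proof. by move=> x; apply: functional_extensionality_dep => i; exact: add0r. Qed.
Let addN : left_inverse zero opp add.
Proof. by move=> x; apply: functional_extensionality_dep => i; exact: addNr. Qed.

HB.instance Definition _ := GRing.isZmodule.Build prodg addA addC add0 addN.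

Lemma prodg_ext (x y : prodg) : (forall i, x i = y i) -> x = y.
Proof. exact: functional_extensionality_dep. Qed.

Lemma prodgD (x y : prodg) i : (x + y) i = x i + y i. Proof. by []. Qed.
Lemma prodgB (x y : prodg) i : (x - y) i = x i - y i. Proof. by []. Qed.
Lemma prodg0 i : (0 : prodg) i = 0. Proof. by []. Qed.

Definition prodg_proj i : @hom Ab prodg (A i) := mkab (fun x y => prodgD x y i).

End Products.

Section ProdMap.
Variables (I : Type) (A B : I -> zmodType) (f : forall i, @hom Ab (A i) (B i)).

Definition prodg_mapf (x : prodg A) : prodg B := fun i => app (f i) (x i).

Lemma prodg_mapD (x y : prodg A) :
  prodg_mapf (x + y) = prodg_mapf x + prodg_mapf y.
Proof. by apply: prodg_ext => i; exact: appD. Qed.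

Definition prodg_map : @hom Ab (prodg A) (prodg B) := mkab prodg_mapD.
End ProdMap.

(** * Categories of functors to abelian groups *)

Section FunctorsToAb.
Variable C : cat.
Implicit Types F G H : functor C Ab.

Lemma nat_app F G (t : nat_trans F G) a b (f : hom a b) x :
  app (t b) (app (fmap F f) x) = app (fmap G f) (app (t a) x).
Proof. by rewrite -!app_cmp naturality. Qed.

Lemma app_fmapM F a b c (g : hom b c) (f : hom a b) x :
  app (fmap F (g \oc f)) x = app (fmap F g) (app (fmap F f) x).
Proof. by rewrite fmapM. Qed.

Lemma app_fmap1 F a x : app (fmap F (idm a)) x = x.
Proof. by rewrite fmap1. Qed.

Lemma nat_app_ext F G (s t : nat_trans F G) :
  (forall c x, app (s c) x = app (t c) x) -> s = t.
Proof. by move=> st; apply: nat_ext => c; apply: app_ext => x. Qed.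

Section Make.
Variables (F0 : C -> zmodType) (F1 : forall a b, hom a b -> F0 a -> F0 b).
Hypothesis F1D : forall a b (f : hom a b) x y, F1 f (x + y) = F1 f x + F1 f y.
Hypothesis F11 : forall a x, F1 (idm a) x = x.
Hypothesis F1M : forall a b c (g : hom b c) (f : hom a b) x,
  F1 (g \oc f) x = F1 g (F1 f x).
Hypothesis F1A : forall a b (f g : hom a b) x, F1 (hadd f g) x = F1 f x + F1 g x.

Definition mkfun : functor C Ab.
Proof.
refine (@Functor C Ab F0 (fun a b f => mkab (F1D f)) _ _ _).
- by move=> a; apply: app_ext => x; exact: F11.
- by move=> a b c g f; apply: app_ext => x; exact: F1M.
- by move=> a b f g; apply: app_ext => x; exact: F1A.
Defined.

Lemma mkfunE a b (f : hom a b) x : app (fmap mkfun f) x = F1 f x.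
Proof. by []. Qed.
End Make.

Section MakeNat.
Variables (F G : functor C Ab).
Variable t : forall c, (F c : zmodType) -> (G c : zmodType).
Hypothesis tD : forall c x y, @t c (x + y) = t x + t y.
Hypothesis tN : forall a b (f : hom a b) x,
  t (app (fmap F f) x) = app (fmap G f) (@t a x).

Definition mknat : nat_trans F G.
Proof.
apply: (@NatTrans _ _ F G (fun c => mkab (@tD c))).
by move=> a b f; apply: app_ext => x; exact: tN.
Defined.

Lemma mknatE c x : app (mknat c) x = @t c x. Proof. by []. Qed.
End MakeNat.

Section Subfunctor.
Variables (F : functor C Ab) (S : forall c, subgroup (F c)).
Hypothesis Sstab : forall a b (f : hom a b) x, S a x -> S b (app (fmap F f) x).

Let sub1 a b (f : hom a b) (x : subg (S a)) : subg (S b) :=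
  exist _ _ (Sstab f (svalP x)).

Let sub1D a b (f : hom a b) x y : sub1 f (x + y) = sub1 f x + sub1 f y.
Proof. by apply: subg_inj; rewrite /= appD. Qed.
Let sub11 a x : sub1 (idm a) x = x.
Proof. by apply: subg_inj; rewrite /= app_fmap1. Qed.
Let sub1M a b c (g : hom b c) (f : hom a b) x :
  sub1 (g \oc f) x = sub1 g (sub1 f x).
Proof. by apply: subg_inj; rewrite /= app_fmapM. Qed.
Let sub1A a b (f g : hom a b) x : sub1 (hadd f g) x = sub1 f x + sub1 g x.
Proof. by apply: subg_inj; rewrite /= fmapD app_hadd. Qed.

Definition subfun : functor C Ab := mkfun sub1D sub11 sub1M sub1A.

Definition subfun_incl : nat_trans subfun F.
Proof. by apply: (@mknat subfun F (fun c => sval)). Defined.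

Lemma subfun_incl_inj c : injective (app (subfun_incl c)).
Proof. exact: subg_inj. Qed.

Lemma subfun_inclP c x : S c x <-> exists y, app (subfun_incl c) y = x.
Proof.
by split=> [Sx | [[y Sy] <-] //]; exists (exist _ x Sx).
Qed.

Let quo1 a b (f : hom a b) (u : quotg (S a)) : quotg (S b) :=
  qcls _ (app (fmap F f) (qrep u)).

Let quo1E a b (f : hom a b) x : quo1 f (qcls _ x) = qcls _ (app (fmap F f) x).
Proof.
apply/qcls_eq; rewrite -appB; apply: Sstab.
by apply/qcls_eq; rewrite qrepK.
Qed.

Let quo1D a b (f : hom a b) x y : quo1 f (x + y) = quo1 f x + quo1 f y.
Proof. by rewrite -(qrepK x) -(qrepK y) -qclsD !quo1E appD qclsD. Qed.
Let quo11 a x : quo1 (idm a) x = x.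
Proof. by rewrite -(qrepK x) quo1E app_fmap1. Qed.
Let quo1M a b c (g : hom b c) (f : hom a b) x :
  quo1 (g \oc f) x = quo1 g (quo1 f x).
Proof. by rewrite -(qrepK x) !quo1E app_fmapM. Qed.
Let quo1A a b (f g : hom a b) x : quo1 (hadd f g) x = quo1 f x + quo1 g x.
Proof. by rewrite -(qrepK x) !quo1E fmapD app_hadd qclsD. Qed.

Definition quofun : functor C Ab := mkfun quo1D quo11 quo1M quo1A.

Definition quofun_proj : nat_trans F quofun.
Proof.
apply: (@mknat F quofun (fun c x => qcls _ x)) => [c x y | a b f x].
  exact: qclsD.
by rewrite mkfunE quo1E.
Defined.

Lemma quofun_proj0 c x : app (quofun_proj c) x = 0 <-> S c x.
Proof. exact: quotg_proj0. Qed.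

Lemma quofun_proj_surj c u : exists x, app (quofun_proj c) x = u.
Proof. exact: qcls_surj. Qed.

End Subfunctor.

Section Kernels.
Variables (F G : functor C Ab) (t : nat_trans F G).

Definition ker_sg c : subgroup (F c).
Proof.
apply: (@Subgroup _ (fun x => app (t c) x = 0)); first exact: app0.
by move=> x y tx ty; rewrite appB tx ty subrr.
Defined.

Lemma ker_stab a b (f : hom a b) x : ker_sg a x -> ker_sg b (app (fmap F f) x).
Proof. by move=> tx; rewrite /= nat_app tx app0. Qed.

Definition im_sg c : subgroup (G c).
Proof.
apply: (@Subgroup _ (fun y => exists x, app (t c) x = y)).
  by exists 0; exact: app0.
by move=> _ _ [x <-] [y <-]; exists (x - y); rewrite appB.
Defined.

Lemma im_stab a b (f : hom a b) x : im_sg a x -> im_sg b (app (fmap G f) x).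
Proof. by case=> y <-; exists (app (fmap F f) y); rewrite nat_app. Qed.

Definition kerfun := subfun ker_stab.
Definition ker_incl : nat_trans kerfun F := subfun_incl ker_stab.
Definition cokerfun := quofun im_stab.
Definition coker_proj : nat_trans G cokerfun := quofun_proj im_stab.

End Kernels.

Definition nat_inj F G (t : nat_trans F G) := forall c, injective (app (t c)).
Definition nat_surj F G (t : nat_trans F G) :=
  forall c y, exists x, app (t c) x = y.
Definition nat_exact F G H (s : nat_trans F G) (t : nat_trans G H) :=
  forall c x, app (t c) x = 0 <-> exists y, app (s c) y = x.

Lemma nat_inj_mono F G (t : nat_trans F G) :
  nat_inj t -> @mono (functor_cat C Ab) F G t.
Proof.
move=> ti H g h; move/(congr1 (fun s : nat_trans H G => component s)) => tgh.
apply: nat_app_ext => c x; apply: (ti c).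
by move/(congr1 (fun s => app (s c) x)): tgh.
Qed.

Lemma nat_surj_epi F G (t : nat_trans F G) :
  nat_surj t -> @epi (functor_cat C Ab) F G t.
Proof.
move=> ti H g h; move/(congr1 (fun s : nat_trans F H => component s)) => tgh.
apply: nat_app_ext => c x; have [y <-] := ti c x.
by move/(congr1 (fun s => app (s c) y)): tgh.
Qed.

(** The objectwise factorizations are unique, hence additive and natural. *)
Lemma factor_inj F G H (i : nat_trans F G) (t : nat_trans H G) :
  nat_inj i -> (forall c x, exists y, app (i c) y = app (t c) x) ->
  exists s : nat_trans H F, nat_comp i s = t.
Proof.
move=> ii it.
pose s0 c x := projT1 (cid (it c x)).
have s0P c x : app (i c) (s0 c x) = app (t c) x by rewrite /s0; case: (cid _).
have s0D c x y : s0 c (x + y) = s0 c x + s0 c y.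
  by apply: (ii c); rewrite appD !s0P appD.
have s0N a b (f : hom a b) x : s0 b (app (fmap H f) x) = app (fmap F f) (s0 a x).
  by apply: (ii b); rewrite nat_app !s0P nat_app.
exists (mknat s0D s0N); apply: nat_app_ext => c x; exact: s0P.
Qed.

Lemma nat_bij_iso F G (t : nat_trans F G) :
  nat_inj t -> nat_surj t -> @is_iso (functor_cat C Ab) F G t.
Proof.
move=> ti ts; have [s sP] := factor_inj (t := nat_id G) ti ts.
exists s; split=> //; apply: (nat_inj_mono ti).
rewrite (@cmpA (functor_cat C Ab)).
have -> : @cmp (functor_cat C Ab) _ _ _ t s = idm (G : functor_cat C Ab) := sP.
by rewrite cmp1m cmpm1.
Qed.

Lemma factor_surj F G H (p : nat_trans F G) (t : nat_trans F H) :
  nat_surj p -> (forall c x, app (p c) x = 0 -> app (t c) x = 0) ->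
  exists s : nat_trans G H, nat_comp s p = t.
Proof.
move=> ps pt.
pose r c y := projT1 (cid (ps c y)).
have rP c y : app (p c) (r c y) = y by rewrite /r; case: (cid _).
have tr c x y : app (p c) x = app (p c) y -> app (t c) x = app (t c) y.
  move=> pxy; apply/eqP; rewrite -subr_eq0 -appB; apply/eqP; apply: pt.
  by rewrite appB pxy subrr.
have sD c x y : app (t c) (r c (x + y)) = app (t c) (r c x) + app (t c) (r c y).
  by rewrite -appD; apply: tr; rewrite appD !rP.
have sN a b (f : hom a b) x :
    app (t b) (r b (app (fmap G f) x)) = app (fmap H f) (app (t a) (r a x)).
  by rewrite -nat_app; apply: tr; rewrite nat_app !rP.
exists (@mknat G H (fun c y => app (t c) (r c y)) sD sN).
by apply: nat_app_ext => c x; apply: tr; rewrite rP.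
Qed.

Lemma nat_exact_kernel F G H (i : nat_trans F G) (t : nat_trans G H) :
  nat_inj i -> nat_exact i t -> @is_kernel (functor_cat C Ab) F G H i t.
Proof.
move=> ii it; apply: is_kernelI.
- by apply: nat_app_ext => c x; apply/it; exists x.
- exact: nat_inj_mono.
- move=> K g tg; apply: factor_inj => // c x; apply/it.
  by move/(congr1 (fun s : nat_trans K H => app (s c) x)): tg.
Qed.

Lemma nat_exact_cokernel F G H (t : nat_trans F G) (p : nat_trans G H) :
  nat_surj p -> nat_exact t p -> @is_cokernel (functor_cat C Ab) F G H t p.
Proof.
move=> ps tp; apply: is_cokernelI.
- by apply: nat_app_ext => c x; apply/tp; exists x.
- exact: nat_surj_epi.
- move=> K g tg; apply: factor_surj => // c x /tp[y <-].
  by move/(congr1 (fun s : nat_trans F K => app (s c) y)): tg.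
Qed.

Lemma ker_incl_inj F G (t : nat_trans F G) : nat_inj (ker_incl t).
Proof. exact: subfun_incl_inj. Qed.

Lemma ker_incl_exact F G (t : nat_trans F G) : nat_exact (ker_incl t) t.
Proof. by move=> c x; exact: (subfun_inclP (@ker_stab _ _ t)). Qed.

Lemma coker_proj_surj F G (t : nat_trans F G) : nat_surj (coker_proj t).
Proof. exact: quofun_proj_surj. Qed.

Lemma coker_proj_exact F G (t : nat_trans F G) : nat_exact t (coker_proj t).
Proof. by move=> c x; exact: (quofun_proj0 (@im_stab _ _ t)). Qed.

Lemma ker_inclP F G (t : nat_trans F G) :
  @is_kernel (functor_cat C Ab) _ F G (ker_incl t) t.
Proof. exact: nat_exact_kernel (@ker_incl_inj _ _ t) (@ker_incl_exact _ _ t). Qed.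

Lemma coker_projP F G (t : nat_trans F G) :
  @is_cokernel (functor_cat C Ab) F G _ t (coker_proj t).
Proof.
exact: nat_exact_cokernel (@coker_proj_surj _ _ t) (@coker_proj_exact _ _ t).
Qed.

(** A monomorphism kills the inclusion of its objectwise kernel, so this kernel
    is zero. *)
Lemma mono_nat_inj F G (t : nat_trans F G) :
  @mono (functor_cat C Ab) F G t -> nat_inj t.
Proof.
move=> tm c; apply: app_inj0 => x /(@ker_incl_exact _ _ t)[y <-].
have : @cmp (functor_cat C Ab) _ _ _ t (ker_incl t) = hzero _ _.
  exact: (proj1 (ker_inclP t)).
move/(mono0 tm)/(congr1 (fun s : nat_trans (kerfun t) F => app (s c) y)).
by [].
Qed.

Lemma epi_nat_surj F G (t : nat_trans F G) :
  @epi (functor_cat C Ab) F G t -> nat_surj t.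
Proof.
move=> tm c y; apply/(@coker_proj_exact _ _ t).
have : @cmp (functor_cat C Ab) _ _ _ (coker_proj t) t = hzero _ _.
  exact: (proj1 (coker_projP t)).
move/(epi0 tm)/(congr1 (fun s : nat_trans G (cokerfun t) => app (s c) y)).
by [].
Qed.

Section ProductFunctor.
Variables (I : Type) (F : I -> functor C Ab).

Definition prodfun : functor C Ab.
Proof.
refine (@Functor C Ab (fun c => prodg (fun i => F i c))
  (fun a b f => prodg_map (fun i => fmap (F i) f)) _ _ _).
- by move=> a; apply: app_ext => x; apply: prodg_ext => i; exact: app_fmap1.
- by move=> a b c g f; apply: app_ext => x; apply: prodg_ext => i; exact: app_fmapM.
- move=> a b f g; apply: app_ext => x; apply: prodg_ext => i.
  by rewrite [LHS](_ : _ = app (fmap (F i) (hadd f g)) (x i)) // fmapD.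
Defined.

Definition prodfun_proj i : nat_trans prodfun (F i).
Proof.
apply: (@NatTrans _ _ prodfun (F i) (fun c => prodg_proj (fun i => F i c) i)).
by move=> a b f; apply: app_ext.
Defined.

Definition prodfun_pair G (t : forall i, nat_trans G (F i)) : nat_trans G prodfun.
Proof.
apply: (@mknat G prodfun (fun c x i => app (t i c) x)) => [c x y | a b f x].
  by apply: prodg_ext => i; exact: appD.
by apply: prodg_ext => i; exact: nat_app.
Defined.

End ProductFunctor.

Lemma functor_cat_zero (F : void -> functor C Ab) :
  @is_zero (functor_cat C Ab) (prodfun F).
Proof.
apply: is_zeroP; apply: nat_app_ext => c x.
by apply: (@prodg_ext _ (fun i => F i c)); case.
Qed.

Lemma functor_cat_biproduct (F : bool -> functor C Ab) :
  exists (i1 : nat_trans (F true) (prodfun F)) (i2 : nat_trans (F false) (prodfun F)),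
  @is_biproduct (functor_cat C Ab) (F true) (F false) (prodfun F) i1 i2
    (prodfun_proj F true) (prodfun_proj F false).
Proof.
apply: (@product_biproduct (functor_cat C Ab)) => [G f g|G h k].
  exists (prodfun_pair (fun b => if b return nat_trans G (F b) then f else g)).
  by split; apply: nat_app_ext.
move=> /(congr1 (fun s : nat_trans G (F true) => component s)) h1.
move=> /(congr1 (fun s : nat_trans G (F false) => component s)) h2.
apply: nat_app_ext => c x; apply: prodg_ext => -[].
  by move/(congr1 (fun s => app (s c) x)): h1.
by move/(congr1 (fun s => app (s c) x)): h2.
Qed.

Lemma abelian_functor_cat : abelian (functor_cat C Ab).
Proof.
split.
- exists (prodfun (fun i : void => match i with end)); exact: functor_cat_zero.
- move=> F G.
  have [i1 [i2 H]] := functor_cat_biproduct (fun b : bool => if b then F else G).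
  by exists (prodfun (fun b : bool => if b then F else G)), i1, i2; do 2!eexists; exact: H.
- move=> F G t; exists (kerfun t), (ker_incl t); exact: ker_inclP.
- move=> F G t; exists (cokerfun t), (coker_proj t); exact: coker_projP.
- move=> F G t /mono_nat_inj ti; exists (cokerfun t), (coker_proj t).
  exact: nat_exact_kernel (@coker_proj_exact _ _ t).
- move=> F G t /epi_nat_surj ti; exists (kerfun t), (ker_incl t).
  exact: nat_exact_cokernel (@ker_incl_exact _ _ t).
Qed.

End FunctorsToAb.
(** * Colimits of modules *)

(** The module generated by copies of the modules X i and universal among those
    whose structure maps satisfy Phi: formal linear combinations, two of which
    are identified when they agree in every module under the X i satisfying
    Phi.  The module axioms hold in the quotient because they hold in each of
    these modules. *)
Section UniversalModule.
Variables (R : pzRingType) (I : Type) (X : I -> lmodType R).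
Variable Phi : forall A : lmodType R, (forall i, {linear X i -> A}) -> Prop.

Inductive mexp : Type :=
  | Mzero
  | Madd of mexp & mexp
  | Mopp of mexp
  | Mscale of R & mexp
  | Min i of X i.

Fixpoint meval (A : lmodType R) (f : forall i, {linear X i -> A}) (s : mexp) : A :=
  match s with
  | Mzero => 0
  | Madd s t => meval f s + meval f t
  | Mopp s => - meval f s
  | Mscale r s => r *: meval f s
  | Min i x => f i x
  end.

Definition meq (s t : mexp) : Prop :=
  forall (A : lmodType R) (f : forall i, {linear X i -> A}), Phi f -> meval f s = meval f t.

Definition umod := {U : mexp -> Prop | exists s, U = meq s}.

HB.instance Definition _ := gen_eqMixin umod.
HB.instance Definition _ := gen_choiceMixin umod.

Definition mcls (s : mexp) : umod :=
  exist (fun U => exists s, U = meq s) (meq s) (ex_intro _ s erefl).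

Lemma mcls_eq s t : mcls s = mcls t <-> meq s t.
Proof.
split=> [/(congr1 sval)/= /(congr1 (fun U => U t)) -> //| st].
apply: eq_exist; apply/funext => x; apply: propext.
by split=> sx A f fP; rewrite -(sx A f fP) (st A f fP).
Qed.

Lemma mcls_surj (u : umod) : exists s, mcls s = u.
Proof. by case: u => U [s Us]; exists s; apply: eq_exist; rewrite Us. Qed.

Definition mrep (u : umod) : mexp := projT1 (cid (mcls_surj u)).

Lemma mrepK u : mcls (mrep u) = u.
Proof. by rewrite /mrep; case: (cid _). Qed.

Lemma mrep_cls s : meq (mrep (mcls s)) s.
Proof. by apply/mcls_eq; rewrite mrepK. Qed.

Let madd u v := mcls (Madd (mrep u) (mrep v)).
Let mopp u := mcls (Mopp (mrep u)).
Let mscale r u := mcls (Mscale r (mrep u)).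

Let maddE s t : madd (mcls s) (mcls t) = mcls (Madd s t).
Proof. by apply/mcls_eq => A f fP /=; rewrite !mrep_cls. Qed.
Let moppE s : mopp (mcls s) = mcls (Mopp s).
Proof. by apply/mcls_eq => A f fP /=; rewrite !mrep_cls. Qed.
Let mscaleE r s : mscale r (mcls s) = mcls (Mscale r s).
Proof. by apply/mcls_eq => A f fP /=; rewrite !mrep_cls. Qed.

Let maddA : associative madd.
Proof.
move=> x y z; rewrite -(mrepK x) -(mrepK y) -(mrepK z) !maddE.
by apply/mcls_eq => A f fP /=; rewrite addrA.
Qed.
Let maddC : commutative madd.
Proof. by move=> x y; apply/mcls_eq => A f fP /=; rewrite addrC. Qed.
Let madd0 : left_id (mcls Mzero) madd.
Proof.
by move=> x; rewrite -(mrepK x) maddE; apply/mcls_eq => A f fP /=; rewrite add0r.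
Qed.
Let maddN : left_inverse (mcls Mzero) mopp madd.
Proof.
move=> x; rewrite -(mrepK x) moppE maddE.
by apply/mcls_eq => A f fP /=; rewrite addNr.
Qed.

HB.instance Definition _ := GRing.isZmodule.Build umod maddA maddC madd0 maddN.

Lemma mclsD s t : mcls s + mcls t = mcls (Madd s t).
Proof. exact: maddE. Qed.

Let mscaleA a b v : mscale a (mscale b v) = mscale (a * b) v.
Proof.
by rewrite -(mrepK v) !mscaleE; apply/mcls_eq => A f fP /=; rewrite scalerA.
Qed.
Let mscale1 : left_id 1 mscale.
Proof.
by move=> v; rewrite -(mrepK v) !mscaleE; apply/mcls_eq => A f fP /=; rewrite scale1r.
Qed.
Let mscaleDr : right_distributive mscale +%R.
Proof.
move=> r u v; rewrite -(mrepK u) -(mrepK v).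
rewrite mclsD !mscaleE mclsD; apply/mcls_eq => A f fP /=.
by rewrite scalerDr.
Qed.
Let mscaleDl v : {morph mscale^~ v : a b / a + b}.
Proof.
move=> a b; rewrite -(mrepK v) !mscaleE mclsD.
by apply/mcls_eq => A f fP /=; rewrite scalerDl.
Qed.

HB.instance Definition _ :=
  GRing.Zmodule_isLmodule.Build R umod mscaleA mscale1 mscaleDr mscaleDl.

Lemma mclsZ r s : r *: mcls s = mcls (Mscale r s).
Proof. exact: mscaleE. Qed.

Definition uin i (x : X i) : umod := mcls (Min x).

Lemma uin_linear i : linear (@uin i).
Proof.
move=> a x y; rewrite mclsZ mclsD.
by apply/mcls_eq => A f fP /=; rewrite linearP.
Qed.

HB.instance Definition _ i :=
  GRing.isLinear.Build R (X i) umod *:%R (@uin i) (@uin_linear i).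

Lemma uin_eq i (x : X i) j (y : X j) :
  (forall (A : lmodType R) (f : forall i, {linear X i -> A}), Phi f -> f i x = f j y) ->
  uin x = uin y.
Proof. by move=> xy; apply/mcls_eq => A f /xy. Qed.

Section Descend.
Variables (A : lmodType R) (f : forall i, {linear X i -> A}) (fP : Phi f).

Definition udesc (u : umod) : A := meval f (mrep u).

Lemma udesc_linear : linear udesc.
Proof.
move=> a u v; rewrite /udesc -(mrepK u) -(mrepK v) mclsZ mclsD.
by rewrite !mrep_cls.
Qed.

Definition udesc_lin : {linear umod -> A} :=
  HB.pack udesc (GRing.isLinear.Build R umod A *:%R udesc udesc_linear).

Lemma udesc_in i (x : X i) : udesc_lin (uin x) = f i x.
Proof. by rewrite /= /udesc mrep_cls. Qed.
End Descend.

Lemma umod_ext (A : lmodType R) (g h : {linear umod -> A}) :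
  (forall i (x : X i), g (uin x) = h (uin x)) -> g = h.
Proof.
move=> gh; apply: linear_ext => u; rewrite -(mrepK u).
elim: (mrep u) => [|s IHs t IHt|s IHs|r s IHs|i x]; last exact: gh.
- by rewrite (_ : mcls Mzero = 0) // !linear0.
- by rewrite -mclsD !linearD IHs IHt.
- by rewrite (_ : mcls _ = - mcls s) ?linearN ?IHs // [RHS]moppE.
- by rewrite -mclsZ !linearZ IHs.
Qed.

End UniversalModule.

Section Colimits.
Variable R : pzRingType.

Lemma coproduct_ex (I : Type) (X : I -> Mod R) :
  exists (U : Mod R) (inn : forall i, hom (X i) U),
  (forall A (f : forall i, hom (X i) A), exists g, forall i, g \oc inn i = f i) /\
  (forall A (g h : hom U A), (forall i, g \oc inn i = h \oc inn i) -> g = h).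
Proof.
pose Phi (A : lmodType R) (f : forall i, {linear X i -> A}) := True.
exists (umod Phi : lmodType R), (fun i => (@uin R I X Phi i : {linear _ -> _})); split.
- move=> A f; exists (@udesc_lin R I X Phi A f Logic.I) => i.
  by apply: linear_ext => x; exact: udesc_in.
- move=> A g h gh; apply: umod_ext => i x.
  by have /(congr1 (fun k : {linear _ -> _} => k x)) := gh i.
Qed.

(** The module generated by X and Y subject to the relations k x = h x. *)
Lemma weak_pushout_ex (X' X Y : Mod R) (k : hom X' X) (h : hom X' Y) :
  exists (Z : Mod R) (i : hom X Z) (j : hom Y Z), i \oc k = j \oc h /\
  (forall A (f : hom X A) (g : hom Y A), f \oc k = g \oc h ->
     exists e, e \oc i = f /\ e \oc j = g).
Proof.
pose XY (b : bool) : lmodType R := if b then X else Y.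
pose Phi (A : lmodType R) (f : forall b, {linear XY b -> A}) :=
  forall x : (X' : lmodType R),
    f true ((k : {linear _ -> _}) x) = f false ((h : {linear _ -> _}) x).
exists (umod Phi : lmodType R), (@uin R bool XY Phi true : {linear _ -> _}).
exists (@uin R bool XY Phi false : {linear _ -> _}); split.
  by apply: linear_ext => x; apply: uin_eq => A f /(_ x).
move=> A f g fg.
pose fg' b : {linear XY b -> A} :=
  match b return {linear XY b -> A} with true => f | false => g end.
have fgP : Phi A fg'.
  by move=> x; move: fg => /(congr1 (fun k : {linear _ -> _} => k x)).
exists (udesc_lin fgP); split; apply: linear_ext => x.
  exact: (@udesc_in R bool XY Phi A fg' fgP true x).
exact: (@udesc_in R bool XY Phi A fg' fgP false x).
Qed.

(** * Finitely presented functors *)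

Section Yoneda.
Variables (X : Mod R) (F : functor (Mod R) Ab).

Definition yel (t : nat_trans (rep X) F) : (F X : zmodType) :=
  app (t X) (idm X : lhom X X).

Lemma yelE (t : nat_trans (rep X) F) M (f : hom X M) :
  app (t M) (f : lhom X M) = app (fmap F f) (yel t).
Proof.
rewrite /yel -nat_app; congr (app _ _); exact: esym (@cmpm1 (Mod R) X M f).
Qed.

Lemma yel_inj : injective yel.
Proof. by move=> s t st; apply: nat_app_ext => M f; rewrite !yelE st. Qed.

Definition ymap (x : (F X : zmodType)) : nat_trans (rep X) F.
Proof.
apply: (@mknat _ (rep X) F (fun M (f : lhom X M) => app (fmap F (f : hom X M)) x)).
- move=> M f g.
  by rewrite -[LHS]/(app (fmap F (hadd (f : hom X M) g)) x) fmapD.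
- by move=> M N g f; exact: app_fmapM.
Defined.

Lemma ymapE x M (f : hom X M) : app (ymap x M) (f : lhom X M) = app (fmap F f) x.
Proof. by []. Qed.

Lemma yel_ymap x : yel (ymap x) = x.
Proof. exact: app_fmap1. Qed.

End Yoneda.

Lemma rep_projective (F G : functor (Mod R) Ab) (p : nat_trans F G) X
    (u : nat_trans (rep X) G) :
  nat_surj p -> exists v : nat_trans (rep X) F, nat_comp p v = u.
Proof.
move=> ps; have [y yu] := ps X (yel u); exists (ymap y).
apply: yel_inj; rewrite -yu; exact: (congr1 (app (p X)) (yel_ymap y)).
Qed.

Lemma fp_functorP (F : functor (Mod R) Ab) : fp_functor F <->
  exists X Y (a : nat_trans (rep Y) (rep X)) (b : nat_trans (rep X) F),
    nat_surj b /\ nat_exact a b.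
Proof.
split=> -[X [Y [a [b H]]]]; exists X, Y, a, b.
  by split=> M; have [] := H M.
by move=> M; split; [exact: (proj1 H M) | exact: (proj2 H M)].
Qed.

Definition lhom_cmp (X Y Z : Mod R) (g : lhom Y Z) (f : lhom X Y) : lhom X Z :=
  @cmp (Mod R) X Y Z g f.

(** Let F be the cokernel of (Y',-) -> (X',-).  A map from (X,-) to F comes from a
    map k : X' -> X, and its kernel is the image of (Z,-) for a weak pushout Z of
    k and X' -> Y': an arrow X -> M dies in F when its composite with k extends
    along X' -> Y'. *)
Lemma fp_functor_coherent (F : functor (Mod R) Ab) X (u : nat_trans (rep X) F) :
  fp_functor F -> exists Z (v : nat_trans (rep Z) (rep X)), nat_exact v u.
Proof.
move=> /fp_functorP[X' [Y' [a [b [bs ab]]]]].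
have [k kP] := rep_projective u bs.
have [Z [i [j [ij ijU]]]] := weak_pushout_ex (yel k : hom X' X) (yel a : hom X' Y').
have uE M (f : hom X M) : app (u M) (f : lhom X M) = app (b M) (f \oc (yel k : hom X'
    X) : lhom X' M).
  by rewrite -kP [LHS](_ : _ = app (b M) (app (k M) f)) // (yelE k).
exists Z, (ymap (F := rep X) (i : lhom X Z)) => M x; split=> [|[e <-]].
  rewrite uE => /ab[y]; rewrite (yelE a) => /esym xy.
  by have [e [ei ej]] := ijU M x y xy; exists e.
rewrite (ymapE (F := rep X)) uE; apply/ab; exists (lhom_cmp e j).
by rewrite (yelE a) -[LHS](@cmpA (Mod R)) -[RHS](@cmpA (Mod R)) ij.
Qed.

(** The relations of G are those of F, restricted to the generator Z of G. *)
Lemma fp_functor_sub (F G : functor (Mod R) Ab) (i : nat_trans G F) Z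
    (s : nat_trans (rep Z) G) :
  fp_functor F -> nat_inj i -> nat_surj s -> fp_functor G.
Proof.
move=> Ffp ii ss; apply/fp_functorP.
have [W [v vP]] := fp_functor_coherent (nat_comp i s) Ffp.
exists Z, W, v, s; split=> // M x; rewrite -vP.
rewrite -[app (nat_comp i s M) x]/(app (i M) (app (s M) x)).
by split=> [->|sx]; [exact: app0 | apply: (ii M); rewrite sx app0].
Qed.

(** A generator of the kernel of the composite rep X -> F -> G also generates the
    kernel of F -> G. *)
Lemma fp_functor_kernel (K F G : functor (Mod R) Ab) (i : nat_trans K F)
    (t : nat_trans F G) :
  fp_functor F -> fp_functor G -> nat_inj i -> nat_exact i t -> fp_functor K.
Proof.
move=> Ffp Gfp ii it; have /fp_functorP[X [Y [a [b [bs ab]]]]] := Ffp.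
have [Z [v vP]] := fp_functor_coherent (nat_comp t b) Gfp.
have [M z|s sP] := factor_inj (i := i) (t := nat_comp b v) ii.
  apply/it; rewrite -[LHS]/(app (nat_comp t b M) (app (v M) z)).
  by apply/vP; exists z.
apply: (fp_functor_sub (s := s) Ffp ii) => M y.
have [x xy] := bs M (app (i M) y).
have /vP[z zx] : app (nat_comp t b M) x = 0.
  rewrite -[LHS]/(app (t M) (app (b M) x)) xy.
  by apply/it; exists y.
exists z; apply: (ii M); rewrite -xy -zx.
by rewrite -[RHS]/(app (nat_comp b v M) z) -sP.
Qed.

Lemma fp_functor_iso (F G : functor (Mod R) Ab) (i : nat_trans F G) :
  nat_inj i -> nat_surj i -> fp_functor G -> fp_functor F.
Proof.
move=> ii si Gfp; apply: (fp_functor_kernel (t := nat_zero G G) Gfp Gfp ii).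
by move=> M x; split=> // _; exact: si.
Qed.

(** The generator is that of G; the relations are those of G and the images of
    the generators of F, represented together by a coproduct. *)
Lemma fp_functor_cokernel (F G K : functor (Mod R) Ab) (t : nat_trans F G)
    (p : nat_trans G K) :
  fp_functor F -> fp_functor G -> nat_surj p -> nat_exact t p -> fp_functor K.
Proof.
move=> /fp_functorP[X [Y [a [b [bs ab]]]]] /fp_functorP[X' [Y' [a' [b' [bs' ab']]]]] ps tp.
have [k kP] := rep_projective (nat_comp t b) bs'.
have [U [inn [innE _]]] := coproduct_ex (fun i : bool => if i then Y' else X).
pose i1 : hom Y' U := inn true; pose i2 : hom X U := inn false.
pose w := hadd (i1 \oc (yel a' : hom X' Y')) (i2 \oc (yel k : hom X' X)).
have kE M (y : hom X M) : app (b' M) (y \oc (yel k : hom X' X) : lhom X' M) =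
    app (t M) (app (b M) (y : lhom X M)).
  rewrite -[RHS]/(app (nat_comp t b M) (y : lhom X M)) -kP.
  by rewrite -[RHS]/(app (b' M) (app (k M) (y : lhom X M))) (yelE k).
apply/fp_functorP; exists X', U, (ymap (F := rep X') (w : lhom X' U)).
exists (nat_comp p b'); split=> M x.
  by have [y <-] := ps M x; have [z <-] := bs' M y; exists z.
split=> [/(tp)[y tyx]|[f <-]].
  have [z zy] := bs M y.
  have /ab'[z' z'P] : app (b' M) (x - ((z : hom X M) \oc (yel k : hom X' X) : lhom X'
      M)) = 0.
    by rewrite appB kE zy tyx subrr.
  have [f fP] := innE M (fun i => match i return hom (if i then Y' else X) M with
                          true => z' | false => z end).
  have f1 : f \oc i1 = z' := fP true; have f2 : f \oc i2 = z := fP false.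
  exists f; rewrite (ymapE (F := rep X')) -[LHS]/(f \oc w) cmpDr !cmpA f1 f2.
  rewrite (yelE a') in z'P; rewrite -[RHS](subrK ((z : hom X M) \oc (yel k : hom X' X)
      : lhom X' M)).
  by rewrite -z'P.
pose f' : hom U M := f.
rewrite (ymapE (F := rep X')) -[app (fmap _ _) _]/(f' \oc w) cmpDr !cmpA.
rewrite -[LHS]/(app (p M) (app (b' M) ((f' \oc i1 \oc (yel a' : hom X' Y') : lhom X' M)
    + (f' \oc i2 \oc (yel k : hom X' X) : lhom X' M)))).
rewrite appD kE; set z := app (b' M) _.
have -> : z = 0.
  by apply/ab'; exists (f' \oc i1 : lhom Y' M); rewrite (yelE a').
by rewrite add0r; apply/(tp); eexists.
Qed.

(** A product of representables is represented by the coproduct, and products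
    of abelian groups are exact. *)
Lemma fp_functor_prod (I : Type) (F : I -> functor (Mod R) Ab) :
  (forall i, fp_functor (F i)) -> fp_functor (prodfun F).
Proof.
move=> Ffp; have /choice[X /choice[Y HXY]] := fun i => (proj1 (fp_functorP _) (Ffp i)).
pose a i := projT1 (cid (HXY i)).
pose b i := projT1 (cid (projT2 (cid (HXY i)))).
have bs i : nat_surj (b i) := proj1 (projT2 (cid (projT2 (cid (HXY i))))).
have ab i : nat_exact (a i) (b i) := proj2 (projT2 (cid (projT2 (cid (HXY i))))).
move: a b bs ab => a b bs ab {HXY}.
have [U [inn [innE innU]]] := coproduct_ex X.
have [V [jnn [jnnE jnnU]]] := coproduct_ex Y.
have [w wE] := innE V (fun i => jnn i \oc (yel (a i) : hom (X i) (Y i))).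
pose bb := prodfun_pair (fun i => nat_comp (b i) (rep_map (inn i))).
have bbE M (f : hom U M) i :
  app (bb M) (f : lhom U M) i = app (b i M) (f \oc inn i : lhom (X i) M) by [].
apply/fp_functorP; exists U, V, (ymap (F := rep U) (w : lhom U V)), bb; split.
  move=> M y.
  pose x i := projT1 (cid (bs i M (y i))).
  have xP i : app (b i M) (x i) = y i by rewrite /x; case: (cid _).
  have [g gP] := innE M x; exists g.
  by apply: (@prodg_ext _ (fun i => F i M)) => i; rewrite bbE gP xP.
move=> M f; split=> [bf|[e <-]].
  have bfi i : exists z, app (a i M) z = (f : hom U M) \oc inn i.
    by apply/ab; rewrite -bbE bf.
  pose z i := projT1 (cid (bfi i)).
  have zP i : app (a i M) (z i) = (f : hom U M) \oc inn i by rewrite /z; case: (cid _).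
  have [g gP] := jnnE M z; exists g; apply: innU => i.
  by rewrite (ymapE (F := rep U)) -[LHS]cmpA wE cmpA gP -zP (yelE (a i)).
apply: (@prodg_ext _ (fun i => F i M)) => i.
rewrite (ymapE (F := rep U)) bbE -[_ \oc inn i]cmpA wE cmpA.
by apply/ab; exists ((e : hom V M) \oc jnn i); rewrite (yelE (a i)).
Qed.

Lemma abelian_fp : abelian (fp R).
Proof.
apply: abelian_full_sub (abelian_functor_cat (Mod R)) _ _ _ _.
- exists (prodfun (fun i : void => match i with end)); split.
    by apply: fp_functor_prod; case.
  exact: functor_cat_zero.
- move=> F G Ffp Gfp; pose FG (b : bool) := if b then F else G.
  have [i1 [i2 H]] := functor_cat_biproduct FG.
  exists (prodfun FG); split; first by apply: fp_functor_prod; case.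
  by exists i1, i2; do 2!eexists; exact: H.
- move=> F G t Ffp Gfp; exists (kerfun t); split.
    exact: fp_functor_kernel (@ker_incl_inj _ _ _ t) (@ker_incl_exact _ _ _ t).
  by exists (ker_incl t); exact: ker_inclP.
- move=> F G t Ffp Gfp; exists (cokerfun t); split.
    exact: fp_functor_cokernel (@coker_proj_surj _ _ _ t) (@coker_proj_exact _ _ _ t).
  by exists (coker_proj t); exact: coker_projP.
Qed.

End Colimits.
(** * Tensor products *)

(** Evaluation of linear maps, as morphisms of [Mod R] and of [modr R]. *)
Definition mapp (R : pzRingType) (X Y : Mod R) (f : hom X Y)
  (x : (X : lmodType R)) : (Y : lmodType R) := (f : {linear _ -> _}) x.

Section Mapp.
Variable R : pzRingType.
Implicit Types X Y Z : Mod R.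

Lemma mapp_ext X Y (f g : hom X Y) : (forall x, mapp f x = mapp g x) -> f = g.
Proof. exact: linear_ext. Qed.

Lemma mapp_cmp X Y Z (g : hom Y Z) (f : hom X Y) x :
  mapp (g \oc f) x = mapp g (mapp f x).
Proof. by []. Qed.

Lemma mappD X Y (f : hom X Y) x y : mapp f (x + y) = mapp f x + mapp f y.
Proof. exact: (linearD (f : {linear _ -> _})). Qed.

Lemma mappB X Y (f : hom X Y) x y : mapp f (x - y) = mapp f x - mapp f y.
Proof. exact: (linearB (f : {linear _ -> _})). Qed.

Lemma mapp0 X Y (f : hom X Y) : mapp f 0 = 0.
Proof. exact: (linear0 (f : {linear _ -> _})). Qed.

Lemma mappZ X Y (f : hom X Y) r x : mapp f (r *: x) = r *: mapp f x.
Proof. exact: (linearZ_LR (f : {linear _ -> _})). Qed.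

Section MkMod.
Variables (X Y : lmodType R) (f : X -> Y).
Hypothesis fD : forall x y, f (x + y) = f x + f y.
Hypothesis fZ : forall r x, f (r *: x) = r *: f x.

Lemma mkmod_linear : linear f.
Proof. by move=> a x y; rewrite fD fZ. Qed.

Definition mkmod : @hom (Mod R) X Y :=
  HB.pack f (GRing.isLinear.Build R X Y *:%R f mkmod_linear).

Lemma mapp_mkmod x : mapp mkmod x = f x. Proof. by []. Qed.
End MkMod.

Lemma mod_factor_surj X Y Z (p : hom X Y) (t : hom X Z) :
  (forall y, exists x, mapp p x = y) ->
  (forall x, mapp p x = 0 -> mapp t x = 0) ->
  exists s : hom Y Z, s \oc p = t.
Proof.
move=> ps pt.
pose r y := projT1 (cid (ps y)).
have rP y : mapp p (r y) = y by rewrite /r; case: (cid _).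
have tr x y : mapp p x = mapp p y -> mapp t x = mapp t y.
  move=> pxy; apply/eqP; rewrite -subr_eq0 -mappB; apply/eqP; apply: pt.
  by rewrite mappB pxy subrr.
have sD x y : mapp t (r (x + y)) = mapp t (r x) + mapp t (r y).
  by rewrite -mappD; apply: tr; rewrite mappD !rP.
have sZ a x : mapp t (r (a *: x)) = a *: mapp t (r x).
  by rewrite -mappZ; apply: tr; rewrite mappZ !rP.
exists (@mkmod Y Z (fun y => mapp t (r y)) sD sZ).
by apply: mapp_ext => x; rewrite mapp_cmp mapp_mkmod; apply: tr; rewrite rP.
Qed.

End Mapp.

Section Rapp.
Variable R : pzRingType.
Implicit Types M : modr R.

Definition rapp M M' (h : hom M M') : (sval M : lmodType R^c) -> (sval M' : lmodType R^c) :=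
  @mapp R^c (sval M) (sval M') h.

Lemma rapp_ext M M' (f g : hom M M') : (forall x, rapp f x = rapp g x) -> f = g.
Proof. exact: (@mapp_ext R^c). Qed.

Lemma rapp_cmp M M' M'' (g : hom M' M'') (f : hom M M') x :
  rapp (g \oc f) x = rapp g (rapp f x).
Proof. by []. Qed.

Lemma rapp_idm M x : rapp (idm M) x = x. Proof. by []. Qed.

Lemma rappD M M' (h : hom M M') x y : rapp h (x + y) = rapp h x + rapp h y.
Proof. exact: mappD. Qed.

Lemma rappB M M' (h : hom M M') x y : rapp h (x - y) = rapp h x - rapp h y.
Proof. exact: mappB. Qed.

Lemma rappZ M M' (h : hom M M') r x : rapp h (r *: x) = r *: rapp h x.
Proof. exact: mappZ. Qed.

Lemma rmod_factor_surj M M' M'' (p : hom M M') (t : hom M M'') :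
  (forall y, exists x, rapp p x = y) ->
  (forall x, rapp p x = 0 -> rapp t x = 0) ->
  exists s : hom M' M'', s \oc p = t.
Proof. exact: (@mod_factor_surj R^c). Qed.
End Rapp.

Section TensorLemmas.
Variable R : pzRingType.

Lemma tensor_ind (M : lmodType R^c) (N : lmodType R) (P : tensor M N -> Prop) :
  P 0 -> (forall x y, P x -> P y -> P (x + y)) -> (forall m n, P (tpure m n)) ->
  forall x, P x.
Proof.
move=> P0 PD Pp x; rewrite -(treprK x).
have oppE (s : texp M N) : tclass (Topp s) = - tclass s by rewrite -toppE.
have addE (s t : texp M N) : tclass (Tadd s t) = tclass s + tclass t by rewrite -taddE.
suff H (s : texp M N) : P (tclass s) /\ P (- tclass s) by have [] := H (trepr x).
(* Opposites of pure tensors are pure, so closure under sums suffices. *)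
elim: s => [|s [s1 s2] t [t1 t2]|s [s1 s2]|m n].
- by rewrite (_ : tclass (@Tzero R M N) = 0) // oppr0.
- by rewrite addE opprD; split; apply: PD.
- by rewrite oppE opprK.
- split; first exact: Pp.
  suff -> : - tclass (Tpure m n) = tpure (- m) n by [].
  apply: (addIr (tpure m n)); rewrite -tpureDl !addNr.
  have H0 : tpure 0 n + tpure (M := M) 0 n = tpure 0 n by rewrite -tpureDl addr0.
  by apply: (addIr (tpure 0 n)); rewrite H0 add0r.
Qed.

Lemma tensorl_app (M : modr R) (N N' : Mod R) (f : hom N N') m n :
  app (fmap (tensorl M) f) (tpure m n) = tpure m (mapp f n).
Proof. exact: (tmap_pure idfun f m n). Qed.

Lemma tensorr_app (N : Mod R) (M M' : modr R) (h : hom M M') m n :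
  app (fmap (tensorr N) h) (tpure m n) = tpure (rapp h m) n.
Proof. exact: (tmap_pure h idfun m n). Qed.

Lemma tensorl_map_app (M M' : modr R) (h : hom M M') (N : Mod R) x :
  app (tensorl_map h N) x = app (fmap (tensorr N) h) x.
Proof. by []. Qed.

Lemma tensorr_map_app (N N' : Mod R) (f : hom N N') (M : modr R) x :
  app (tensorr_map f M) x = app (fmap (tensorl M) f) x.
Proof. by []. Qed.

Definition tensorl_functor : functor (modr R) (functor_cat (Mod R) Ab).
Proof.
refine (@Functor (modr R) (functor_cat (Mod R) Ab) (@tensorl R)
  (@tensorl_map R) _ _ _).
- by move=> M; apply: nat_app_ext => N x; exact: (app_fmap1 (F := tensorr N)).
- by move=> a b c g f; apply: nat_app_ext => N x; exact: (app_fmapM (F := tensorr N)).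
- move=> a b f g; apply: nat_app_ext => N x; rewrite tensorl_map_app.
  by rewrite fmapD.
Defined.

Definition tensorr_functor : functor (Mod R) (modrAb R).
Proof.
refine (@Functor (Mod R) (modrAb R) (@tensorr R)
  (@tensorr_map R) _ _ _).
- by move=> M; apply: nat_app_ext => N x; exact: (app_fmap1 (F := tensorl N)).
- by move=> a b c g f; apply: nat_app_ext => N x; exact: (app_fmapM (F := tensorl N)).
- move=> a b f g; apply: nat_app_ext => N x; rewrite tensorr_map_app.
  by rewrite fmapD.
Defined.

(** The class of b (x) n modulo the image of A (x) N depends only on g b.  This
    defines a map from M (x) N to the quotient of B (x) N by the image of A (x) N,
    which inverts the map induced by g. *)
Lemma tensor_right_exact (A B M : modr R) (f : hom A B) (g : hom B M) (N : Mod R) :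
  (forall y, exists x, rapp g x = y) ->
  (forall x, rapp g x = 0 <->
     exists z, rapp f z = x) ->
  (forall y, exists x, app (fmap (tensorr N) g) x = y) /\
  (forall x, app (fmap (tensorr N) g) x = 0 <->
     exists z, app (fmap (tensorr N) f) z = x).
Proof.
move=> gs fg; split.
  apply: tensor_ind => [|_ _ [x <-] [y <-]|m n].
  - by exists 0; exact: app0.
  - by exists (x + y); exact: appD.
  - by have [b <-] := gs m; exists (tpure b n); rewrite tensorr_app.
move=> x; split=> [|[z <-]]; last first.
  rewrite -app_fmapM (_ : g \oc f = hzero A M) ?fmap0 //.
  by apply: rapp_ext => a; apply/fg; exists a.
pose S := im_sg (tensorl_map f) N.
pose r m := projT1 (cid (gs m)).
have rP m : rapp g (r m) = m by rewrite /r; case: (cid _).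
pose beta (m : (sval M : lmodType R^c)) (n : (N : lmodType R)) : quotg S :=
  qcls S (tpure (r m) n).
have betaE b n : beta (rapp g b) n = qcls S (tpure b n).
  apply/qcls_eq; set b' := r _.
  have /fg[z zb] : rapp g (b' - b) = 0.
    by rewrite rappB rP subrr.
  exists (tpure z n); rewrite -[LHS]/(app (fmap (tensorr N) f) (tpure z n)).
  rewrite tensorr_app zb; apply: (addIr (tpure b n)).
  by rewrite -tpureDl !subrK.
have beta_bal : balanced beta.
  split=> [m m' n|m n n'|m a n].
  - by rewrite -(rP m) -(rP m') -rappD !betaE tpureDl qclsD.
  - by rewrite /beta tpureDr qclsD.
  - by rewrite -(rP m) -rappZ !betaE tpureZ.
pose l : @hom Ab (tensor (sval M) N) (quotg S) := tlift beta_bal.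
have lE y : app l (app (fmap (tensorr N) g) y) = qcls S y.
  elim/tensor_ind: y => [|y y' IH IH'|b n].
  - by rewrite !app0.
  - by rewrite !appD IH IH' qclsD.
  - rewrite tensorr_app -betaE; exact: tlift_pure.
move/(congr1 (app l)); rewrite lE app0 => xS.
by have /qcls_eq : qcls S x = qcls S 0 by []; rewrite subr0.
Qed.

(** * Free right modules of finite rank *)

Lemma rV_fp n : @fp_module R^c 'rV[R^c]_n.
Proof.
exists 0%N, n, \0, idfun; split=> [y|x]; first by exists y.
by split=> [x0|[z <-] //]; exists 0; rewrite -[RHS]/(idfun x) x0.
Qed.

Definition rVr n : modr R := exist _ ('rV[R^c]_n : lmodType R^c) (rV_fp n).

Definition rV_proj n (j : 'I_n) : @hom (modr R) (rVr n) (RR R).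
Proof.
apply: (@mkmod R^c 'rV[R^c]_n (regr R) (fun v => v ord0 j)) => [x y|r x].
  by rewrite mxE.
by rewrite mxE.
Defined.

Definition rV_inj n (j : 'I_n) : @hom (modr R) (RR R) (rVr n).
Proof.
apply: (@mkmod R^c (regr R) 'rV[R^c]_n (fun r => \row_k (if k == j then r : R^c else
    0))) => [x y|r x].
  by apply/rowP => k; rewrite !mxE; case: eqP => // _; rewrite addr0.
by apply/rowP => k; rewrite !mxE; case: eqP => // _; rewrite mulr0.
Defined.

Lemma rV_projE n (j : 'I_n) x : rapp (rV_proj j) x = x ord0 j.
Proof. by []. Qed.

Lemma rV_injE n (j : 'I_n) x k :
  (rapp (rV_inj j) x : 'rV_n) ord0 k = if k == j then x : R^c else 0.
Proof. by rewrite [LHS]mxE. Qed.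

Lemma rV_projK n (j k : 'I_n) :
  rV_proj k \oc rV_inj j = if k == j then idm (RR R) else hzero _ _.
Proof.
by apply: rapp_ext => x; rewrite rapp_cmp rV_projE rV_injE; case: eqP.
Qed.

Lemma hsum_app C (F : functor C Ab) a b (f : hom a b) I (r : seq I)
    (E : I -> hom a b) x :
  f = foldr (fun i => hadd (E i)) (hzero a b) r ->
  app (fmap F f) x = \sum_(i <- r) app (fmap F (E i)) x.
Proof.
move=> ->; elim: r => [|i r IH] /=; first by rewrite big_nil fmap0.
by rewrite big_cons fmapD app_hadd IH.
Qed.

Lemma rV_decomp n :
  idm (rVr n) =
  foldr (fun j => hadd (rV_inj j \oc rV_proj j)) (hzero _ _) (index_enum 'I_n).
Proof.
apply: rapp_ext => x.
have H (r : seq 'I_n) :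
    rapp (foldr (fun j => hadd (rV_inj j \oc rV_proj j)) (hzero _ _) r) x =
    \sum_(j <- r) rapp (rV_inj j) (rapp (rV_proj j) x) :> 'rV_n.
  by elim: r => [|j r IH] /=; rewrite ?big_nil // big_cons -IH.
rewrite [RHS]H rapp_idm; apply/rowP => k; rewrite summxE.
rewrite (bigD1 k) //= big1 ?addr0 ?rV_injE ?eqxx // => j jk.
by rewrite rV_injE eq_sym (negPf jk).
Qed.

(** The identity of the free module is the sum of the rV_inj j o rV_proj j. *)
Lemma rV_sum (F : functor (modr R) Ab) n (x : (F (rVr n) : zmodType)) :
  x = \sum_(j < n) app (fmap F (rV_inj j)) (app (fmap F (rV_proj j)) x).
Proof.
rewrite -[LHS](app_fmap1 (F := F)) (hsum_app _ (rV_decomp n)).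
by apply: eq_bigr => j _; rewrite app_fmapM.
Qed.

Lemma rV_sum_proj (F : functor (modr R) Ab) n (y : 'I_n -> (F (RR R) : zmodType)) k :
  app (fmap F (rV_proj k)) (\sum_(j < n) app (fmap F (rV_inj j)) (y j)) = y k.
Proof.
rewrite app_sum (bigD1 k) //= big1 ?addr0; last first.
  move=> j jk; rewrite -app_fmapM rV_projK eq_sym (negPf jk) fmap0.
  by [].
by rewrite -app_fmapM rV_projK eqxx app_fmap1.
Qed.

Lemma modr_presentation (M : modr R) :
  exists m n (f : hom (rVr m) (rVr n)) (g : hom (rVr n) M),
  (forall y, exists x, rapp g x = y) /\
  (forall x, rapp g x = 0 <->
     exists z, rapp f z = x).
Proof. by have [m [n [f [g [gs fg]]]]] := svalP M; exists m, n, f, g. Qed.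

(** * The unit isomorphism R (x) N = N *)

Definition regl : Mod R := R^o.

Definition regr1 : regr R := (1 : R).
Definition regl1 : (regl : lmodType R) := (1 : R).

Lemma one_tensor (N : Mod R) (x : tensor (regr R) N) :
  exists n, x = tpure regr1 n.
Proof.
elim/tensor_ind: x => [|_ _ [n ->] [n' ->]|r n].
- exists 0; apply: (addIr (tpure regr1 0)); rewrite -tpureDr.
  by rewrite addr0 add0r.
- by exists (n + n'); rewrite tpureDr.
- exists ((r : R) *: n); rewrite -tpureZ; congr (tpure _ _).
  exact: esym (@mul1r R r).
Qed.

Definition tunit_fun (N : Mod R) (r : regr R) (n : (N : lmodType R)) :
  (N : lmodType R) := (r : R) *: n.

Lemma tunit_balanced (N : Mod R) : balanced (@tunit_fun N).
Proof.
split=> [r r' n|r n n'|r a n].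
- exact: scalerDl.
- exact: scalerDr.
- by rewrite /tunit_fun scalerA.
Qed.

Lemma tunit_inj (N : Mod R) n n' :
  tpure regr1 n = tpure regr1 n' :> tensor (regr R) N -> n = n'.
Proof.
move/(congr1 (tlift (@tunit_balanced N))); rewrite !tlift_pure.
by rewrite /tunit_fun !scale1r.
Qed.

(** R (x) - is (R,-); the case of free modules of finite rank follows by products
    and the general case by right exactness. *)
Lemma fp_functor_tensorl (M : modr R) : fp_functor (tensorl M).
Proof.
have fpR : fp_functor (tensorl (RR R)).
  pose e : (tensorl (RR R) regl : zmodType) := tpure regr1 regl1.
  pose t := ymap (F := tensorl (RR R)) e.
  have tE N (f : hom regl N) : app (t N) (f : lhom regl N) = tpure regr1 (mapp f regl1).
    by rewrite ymapE tensorl_app.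
  apply/fp_functorP; exists regl, regl, (nat_zero _ _), t; split=> [N y|N f].
    have [n ->] := one_tensor y.
    pose f : hom regl N := @mkmod R regl N (fun r : R => r *: (n : (N : lmodType R)))
      (fun r r' : R => scalerDl _ r r') (fun r s : R => esym (scalerA r s _)).
    by exists f; rewrite tE mapp_mkmod scale1r.
  split=> [|[z <-]]; last by rewrite -[app (nat_zero _ _ _) _]/(0 : lhom regl N) app0.
  rewrite tE -[RHS](app0 (fmap (tensorl (RR R)) (f : hom regl N))).
  have -> : (0 : (tensorl (RR R) regl : zmodType)) = tpure regr1 0.
    by apply: (addIr (tpure regr1 0)); rewrite -tpureDr addr0 add0r.
  rewrite tensorl_app => /tunit_inj; rewrite mapp0 => f1.
  exists 0; apply: (@mapp_ext R) => r.
  have -> : r = (r : R) *: regl1 by exact: esym (@mulr1 R r).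
  by rewrite !mappZ f1 scaler0.
have fpV n : fp_functor (tensorl (rVr n)).
  have := fp_functor_prod (fun _ : 'I_n => fpR).
  apply: (fp_functor_iso (i := prodfun_pair (fun j => tensorl_map (rV_proj j)))).
    move=> N; apply: app_inj0 => x x0; rewrite (rV_sum (F := tensorr N) x).
    apply: big1 => j _; have xj : app (fmap (tensorr N) (rV_proj j)) x = 0 :=
      congr1 (fun y : prodg (fun _ : 'I_n => tensor (regr R) N) => y j) x0.
    exact: etrans (congr1 (app (fmap (tensorr N) (rV_inj j))) xj) (app0 _).
  move=> N y; exists (\sum_(j < n) app (fmap (tensorr N) (rV_inj j)) (y j)).
  by apply: (@prodg_ext _ (fun j => tensor (regr R) N)) => k; exact: (rV_sum_proj (F :=
      tensorr N)).
have [m [n [f [g [gs fg]]]]] := modr_presentation M.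
have H N := tensor_right_exact N gs fg.
exact: (fp_functor_cokernel (t := tensorl_map f) (p := tensorl_map g)
  (fpV m) (fpV n) (fun N => proj1 (H N)) (fun N => proj2 (H N))).
Qed.

(** A module is determined up to isomorphism by a map between free modules of
    finite rank presenting it, and such maps form a small type. *)
Lemma modr_skeleton : exists (S : Type) (K : S -> modr R),
  forall M, exists p, isomorphic (K p) M.
Proof.
pose S := {m : nat & {n : nat & {linear 'rV[R^c]_m -> 'rV[R^c]_n}}}.
pose pres (p : S) (M : modr R) :=
  exists g : hom (rVr (projT1 (projT2 p))) M,
  (forall y, exists x, rapp g x = y) /\
  (forall x, rapp g x = 0 <->
     exists z, projT2 (projT2 p) z = x).
have /choice[K KP] : forall p, exists M, forall M', pres p M' -> pres p M.
  move=> p; case: (pselect (exists M, pres p M)) => [[M pM]|nM].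
    by exists M.
  (* An arbitrary value where p presents no module. *)
  by exists (RR R) => M' pM'; case: nM; exists M'.
exists S, K => M; have [m [n [f [g [gs fg]]]]] := modr_presentation M.
pose p : S := existT _ m (existT _ n (f : {linear 'rV[R^c]_m -> 'rV[R^c]_n})).
have [|g' [gs' fg']] := KP p M; first by exists g.
exists p.
have [|e eP] := rmod_factor_surj (p := g') (t := g) gs'.
  by move=> x /fg' x0; apply/fg.
have [|e' eP'] := rmod_factor_surj (p := g) (t := g') gs.
  by move=> x /fg x0; apply/fg'.
exists e, e'; split; apply: rapp_ext => y.
  by have [x <-] := gs' y; rewrite -rapp_cmp -cmpA eP eP'.
by have [x <-] := gs y; rewrite -rapp_cmp -cmpA eP' eP.
Qed.

End TensorLemmas.
(** * The dualities *)

(** Transformations between functors on a large category form a large type; an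
    embedding into an abelian group provides a small copy, its image. *)
Lemma small_hom (E : cat) (a b : E) (A : zmodType) (iota : hom a b -> A) :
  injective iota -> (forall s t, iota (hadd s t) = iota s + iota t) ->
  exists (B : zmodType) (phi : hom a b -> B),
    bijective phi /\ forall s t, phi (hadd s t) = phi s + phi t.
Proof.
move=> ii iD.
have i0 : iota (hzero a b) = 0.
  by apply: (addIr (iota (hzero a b))); rewrite -iD hadd0 add0r.
have iN s : iota (hopp s) = - iota s.
  by apply: (addIr (iota s)); rewrite -iD haddN addNr.
have @S : subgroup A.
  apply: (@Subgroup _ (fun x => exists s, iota s = x)).
    by exists (hzero a b).
  by move=> _ _ [s <-] [t <-]; exists (hadd s (hopp t)); rewrite iD iN.
pose phi s : subg S := exist S (iota s) (ex_intro _ s erefl).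
exists (subg S), phi; split; last by move=> s t; apply: subg_inj; exact: iD.
apply: bijective_of_surj_inj => [[x [s sx]]|s t /(congr1 sval)/= /ii //].
by exists s; apply: subg_inj.
Qed.

Section HomFunctor.
Variables (A D E : cat) (P : functor A E) (K : functor D E).
Hypothesis small : forall a d, exists (B : zmodType) (phi : hom (P a) (K d) -> B),
  bijective phi /\ forall s t, phi (hadd s t) = phi s + phi t.

(** The functor structure of (P a, K d) is transported along the bijections with
    the small copies; D_A and D_R are two instances. *)
Lemma hom_functor : exists (H : functor A (op (functor_cat D Ab)))
  (phi : forall a d, hom (P a) (K d) -> (fob (H a) d : zmodType)),
  [/\ forall a d, bijective (phi a d),
      forall a d s t, phi a d (hadd s t) = phi a d s + phi a d t,
      forall a d d' (h : hom d d') s,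
        phi a d' (fmap K h \oc s) = app (fmap (H a : functor D Ab) h) (phi a d s) &
      forall a a' (f : hom a a') d s,
        phi a d (s \oc fmap P f) = app (component (fmap H f) d) (phi a' d s)].
Proof.
pose B a d := projT1 (cid (small a d)).
pose phi a d : hom (P a) (K d) -> B a d := projT1 (cid (projT2 (cid (small a d)))).
have phi_bij a d : bijective (@phi a d) := proj1 (projT2 (cid (projT2 (cid (small a d))))).
have phiD a d s t : @phi a d (hadd s t) = phi a d s + phi a d t :=
  proj2 (projT2 (cid (projT2 (cid (small a d))))) s t.
move: B phi phi_bij phiD => B phi phi_bij phiD.
pose psi a d u := projT1 (cid (bij_surj (phi_bij a d) u)).
have psiK a d u : phi a d (psi a d u) = u by rewrite /psi; case: (cid _).
have phiK a d s : psi a d (phi a d s) = s by apply: (bij_inj (phi_bij a d)).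
have psiD a d u v : psi a d (u + v) = hadd (psi a d u) (psi a d v).
  by apply: (bij_inj (phi_bij a d)); rewrite phiD !psiK.
have @H0 (a : A) : functor D Ab.
  apply: (@mkfun D (B a) (fun d d' h u => phi a d' (fmap K h \oc psi a d u))).
  - by move=> d d' h x y; rewrite psiD cmpDr phiD.
  - by move=> d x; rewrite fmap1 cmp1m psiK.
  - by move=> d d' d'' g f x; rewrite phiK fmapM cmpA.
  - by move=> d d' f g x; rewrite fmapD cmpDl phiD.
have @H1 (a a' : A) (f : hom a a') : nat_trans (H0 a') (H0 a).
  apply: (@mknat D (H0 a') (H0 a) (fun d u => phi a d (psi a' d u \oc fmap P f))).
  - by move=> d x y; rewrite psiD cmpDl phiD.
  - by move=> d d' h x; rewrite !mkfunE !phiK cmpA.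
have @H : functor A (op (functor_cat D Ab)).
  apply: (@Functor A (op (functor_cat D Ab)) H0 H1) => [a|a b c g f|a b f g].
  - by apply: nat_app_ext => d x; rewrite mknatE fmap1 cmpm1 psiK.
  - apply: nat_app_ext => d x; rewrite -[RHS]/(app (H1 _ _ f d) (app (H1 _ _ g d) x)).
    by rewrite !mknatE phiK fmapM cmpA.
  - apply: nat_app_ext => d x.
    rewrite -[RHS]/(app (H1 _ _ f d) x + app (H1 _ _ g d) x).
    by rewrite !mknatE fmapD cmpDr phiD.
exists H, phi; split=> //.
- by move=> a d d' h s; rewrite mkfunE phiK.
- by move=> a a' f d s; rewrite mknatE phiK.
Qed.

End HomFunctor.

Section Dualities.
Variable R : pzRingType.

(** By Yoneda a transformation F -> M (x) - is an element of M (x) X, when F is a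
    quotient of (X,-). *)
Lemma small_DA (F : fp R) (M : modr R) :
  exists (B : zmodType) (phi : @hom (functor_cat (Mod R) Ab) (sval F) (tensorl M) -> B),
  bijective phi /\ forall s t, phi (hadd s t) = phi s + phi t.
Proof.
have /fp_functorP[X [Y [a [b [bs ab]]]]] := svalP F.
pose iota (s : nat_trans (sval F) (tensorl M)) := yel (nat_comp s b).
apply: (@small_hom (functor_cat (Mod R) Ab) (sval F) (tensorl M) _ iota) => // s t /yel_inj.
exact: (nat_surj_epi bs).
Qed.

Lemma DA_exists : exists DA : functor (fp R) (op (modrAb R)), is_DA DA.
Proof.
have [H [phi [*]]] := @hom_functor _ _ _ (@incl (functor_cat (Mod R) Ab) (@fp_functor
    R)) (tensorl_functor R)
  (fun F M => small_DA F M).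
by exists H, phi; split.
Qed.

Section Skeleton.
Variables (S : Type) (C : S -> modr R).
Hypothesis CP : forall M, exists p, isomorphic (C p) M.

Lemma skeleton_nat_ext (G H : modrAb R) (s t : nat_trans G H) :
  (forall p x, app (s (C p)) x = app (t (C p)) x) -> s = t.
Proof.
move=> st; apply: nat_app_ext => M x.
have [p [e [e' [_ ee']]]] := CP M.
by rewrite -(app_fmap1 x) -ee' app_fmapM (nat_app s) (nat_app t) st.
Qed.

Let idx (G : modrAb R) := {p : S & (G (C p) : zmodType)}.

Lemma small_DR (G : modrAb R) (N : Mod R) :
  exists (B : zmodType) (phi : @hom (modrAb R) G (tensorr N) -> B),
  bijective phi /\ forall s t, phi (hadd s t) = phi s + phi t.
Proof.
pose iota (s : nat_trans G (tensorr N)) :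
    prodg (fun i : idx G => tensor (sval (C (projT1 i))) N) :=
  fun i => app (s (C (projT1 i))) (projT2 i).
apply: (@small_hom (modrAb R) G (tensorr N) _ iota) => [s t st|s t].
  apply: skeleton_nat_ext => p x.
  by move/(congr1 (fun f : prodg _ => f (existT _ p x))): st.
by apply: prodg_ext.
Qed.

(** A transformation G -> - (x) N is a family t of elements of the groups
    K (x) N, indexed by the elements x of the groups G K for K in the skeleton,
    that is additive in x and natural in K; the two conditions say that t is in
    the kernel of a map between products of functors K (x) -. *)
Lemma fp_functor_DR (G : modrAb R) (H : functor (Mod R) Ab)
    (phi : forall N, nat_trans G (tensorr N) -> (H N : zmodType)) :
  (forall N, bijective (@phi N)) ->
  (forall N s t, phi N (nat_add s t) = phi N s + phi N t) ->
  (forall N N' (h : hom N N') s,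
     phi N' (nat_comp (tensorr_map h) s) = app (fmap H h) (phi N s)) ->
  fp_functor H.
Proof.
move=> bij phiD phiN.
pose psi N u := projT1 (cid (bij_surj (bij N) u)).
have psiK N u : phi N (psi N u) = u by rewrite /psi; case: (cid _).
have phiK N s : psi N (phi N s) = s by apply: (bij_inj (bij N)).
pose T (i : idx G) := tensorl (C (projT1 i)).
pose i0 p (x : (G (C p) : zmodType)) : idx G := existT _ p x.
pose J1 := {p : S & ((G (C p) : zmodType) * (G (C p) : zmodType))%type}.
(* The maps range over linear maps, and not over the larger type of morphisms,
   so that this is the index type of a product of abelian groups. *)
pose J2 := {p : S & {q : S &
    ({linear sval (C p) -> sval (C q)} * (G (C p) : zmodType))%type}}.
pose T' (j : J1 + J2) := match j with
  | inl j => tensorl (C (projT1 j)) | inr j => tensorl (C (projT1 (projT2 j))) end.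
pose PT := prodfun T.
pose pr p x : nat_trans PT (tensorl (C p)) := prodfun_proj T (i0 p x).
pose d (j : J1 + J2) : nat_trans PT (T' j) := match j return nat_trans PT (T' j) with
  | inl (existT p (x, y)) =>
      nat_add (pr p (x + y)) (nat_opp (nat_add (pr p x) (pr p y)))
  | inr (existT p (existT q (h, x))) =>
      let h' : hom (C p) (C q) := h in
      nat_add (pr q (app (fmap G h') x))
              (nat_opp (nat_comp (tensorl_map h') (pr p x)))
  end.
pose delta := prodfun_pair d.
have iotaD (N : Mod R) (u v : (H N : zmodType)) (i : idx G) :
    app (psi N (u + v) (C (projT1 i))) (projT2 i) =
    app (psi N u (C (projT1 i))) (projT2 i) + app (psi N v (C (projT1 i))) (projT2 i).
  rewrite (_ : psi N (u + v) = nat_add (psi N u) (psi N v)) //.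
  by apply: (bij_inj (bij N)); rewrite phiD !psiK.
have @iota : nat_trans H PT.
  apply: (@mknat _ H PT (fun N u i => app (psi N u (C (projT1 i))) (projT2 i))).
    by move=> N u v; apply: (@prodg_ext _ (fun i => T i N)) => i; exact: iotaD.
  move=> N N' f u; apply: (@prodg_ext _ (fun i => T i N')) => i.
  rewrite (_ : psi N' _ = nat_comp (tensorr_map f) (psi N u)) //.
  by apply: (bij_inj (bij N')); rewrite phiN !psiK.
have iotaE N u p x : app (iota N) u (i0 p x) = app (psi N u (C p)) x by [].
have fpT : fp_functor PT by apply: fp_functor_prod => i; exact: fp_functor_tensorl.
have fpT' : fp_functor (prodfun T').
  by apply: fp_functor_prod => -[j|j]; exact: fp_functor_tensorl.
apply: (fp_functor_kernel (i := iota) (t := delta) fpT fpT').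
  move=> N u v uv; rewrite -[LHS]psiK -[RHS]psiK; congr (phi N _).
  apply: skeleton_nat_ext => p x; rewrite -!iotaE.
  by rewrite uv.
move=> N t; split=> [t0|[u <-]]; last first.
  apply: (@prodg_ext _ (fun j => T' j N)) => -[[p [x y]]|[p [q [h x]]]].
    rewrite -[LHS]/(app (psi N u (C p)) (x + y) - (app (psi N u (C p)) x + app (psi N u
        (C p)) y)).
    by rewrite appD subrr.
  rewrite -[LHS]/(app (psi N u (C q)) (app (fmap G h) x) - app (fmap (tensorr N) h)
      (app (psi N u (C p)) x)).
  by rewrite nat_app subrr.
have tD p x y : t (i0 p (x + y)) = t (i0 p x) + t (i0 p y).
  apply/eqP; rewrite -subr_eq0; apply/eqP.
  exact: (congr1 (fun f : prodg (fun j => T' j N) => f (inl (existT _ p (x, y)))) t0).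
have tN p q (h : hom (C p) (C q)) x :
    t (i0 q (app (fmap G h) x)) = app (fmap (tensorr N) h) (t (i0 p x)).
  apply/eqP; rewrite -subr_eq0; apply/eqP.
  exact: (congr1 (fun f : prodg (fun j => T' j N) =>
    f (inr (existT _ p (existT _ q (h : {linear _ -> _}, x))))) t0).
pose k M := projT1 (cid (CP M)).
pose e M : hom (C (k M)) M := projT1 (cid (projT2 (cid (CP M)))).
pose e' M : hom M (C (k M)) := projT1 (cid (projT2 (cid (projT2 (cid (CP M)))))).
have e'e M : e' M \oc e M = idm _ :=
  proj1 (projT2 (cid (projT2 (cid (projT2 (cid (CP M))))))).
have ee' M : e M \oc e' M = idm _ :=
  proj2 (projT2 (cid (projT2 (cid (projT2 (cid (CP M))))))).
move: k e e' e'e ee' => k e e' e'e ee'.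
pose s0 M x := app (fmap (tensorr N) (e M)) (t (i0 (k M) (app (fmap G (e' M)) x))).
have s0D M x y : s0 M (x + y) = s0 M x + s0 M y.
  by rewrite /s0 appD tD appD.
have s0N M M' (f : hom M M') x :
    s0 M' (app (fmap G f) x) = app (fmap (tensorr N) f) (s0 M x).
  rewrite /s0 -[app (fmap (tensorr N) f) _]app_fmapM.
  have -> : app (fmap G (e' M')) (app (fmap G f) x) =
      app (fmap G (e' M' \oc f \oc e M)) (app (fmap G (e' M)) x).
    by rewrite -!app_fmapM -!cmpA ee' cmpm1.
  by rewrite tN -app_fmapM !cmpA ee' cmp1m.
pose s : nat_trans G (tensorr N) := @mknat _ G (tensorr N) s0 s0D s0N.
exists (phi N s); apply: (@prodg_ext _ (fun i => T i N)) => -[p x].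
rewrite -[LHS]/(app (psi N (phi N s) (C p)) x) phiK mknatE /s0 -tN.
by rewrite -app_fmapM ee' app_fmap1.
Qed.

End Skeleton.

Lemma DR_exists : exists DR : functor (op (modrAb R)) (fp R), is_DR DR.
Proof.
have [S [C CP]] := modr_skeleton R.
have @idF : functor (modrAb R) (modrAb R).
  by apply: (@Functor (modrAb R) (modrAb R) id (fun _ _ f => f)).
have [H [phi [bij phiD phiN phiF]]] :=
  @hom_functor _ _ _ idF (tensorr_functor R) (small_DR CP).
have Hfp G : fp_functor (H G) := fp_functor_DR CP (bij G) (phiD G) (phiN G).
have @DR : functor (op (modrAb R)) (fp R).
  apply: (@Functor (op (modrAb R)) (fp R) (fun G => exist _ (H G) (Hfp G))
    (fun a b f => @fmap _ _ H b a f)) => [a|a b c g f|a b f g].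
  - exact: (@fmap1 _ _ H a).
  - exact: (@fmapM _ _ H _ _ _ f g).
  - exact: (@fmapD _ _ H b a f g).
by exists DR, phi; split.
Qed.

(** Both maps F -> DR G and maps G -> DA F are the families of pairings
    G M x F N -> M (x) N natural in M and N. *)
Lemma DA_DR_adjoint (DA : functor (fp R) (op (modrAb R)))
    (DR : functor (op (modrAb R)) (fp R)) :
  is_DA DA -> is_DR DR -> adjoint DA DR.
Proof.
move=> [phi [bij phiD phiN phiF]] [rho [rbij rhoD rhoN rhoF]].
pose psi F M u := projT1 (cid (bij_surj (bij F M) u)).
have psiK F M u : phi F M (psi F M u) = u by rewrite /psi; case: (cid _).
have phiK F M s : psi F M (phi F M s) = s by apply: (bij_inj (bij F M)).
pose sig G N u := projT1 (cid (bij_surj (rbij G N) u)).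
have sigK G N u : rho G N (sig G N u) = u by rewrite /sig; case: (cid _).
have rhoK G N s : sig G N (rho G N s) = s by apply: (bij_inj (rbij G N)).
have psiD F M u v : psi F M (u + v) = nat_add (psi F M u) (psi F M v).
  by apply: (bij_inj (bij F M)); rewrite phiD !psiK.
have sigD F M u v : sig F M (u + v) = nat_add (sig F M u) (sig F M v).
  by apply: (bij_inj (rbij F M)); rewrite rhoD !sigK.
have psiN F M M' (h : hom M M') u :
    psi F M' (app (fmap (DA F : modrAb R) h) u) = nat_comp (tensorl_map h) (psi F M u).
  by apply: (bij_inj (bij F M')); rewrite phiN !psiK.
have sigN G N N' (h : hom N N') u :
    sig G N' (app (fmap (sval (DR G)) h) u) = nat_comp (tensorr_map h) (sig G N u).
  by apply: (bij_inj (rbij G N')); rewrite rhoN !sigK.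
have psiF F F' (f : hom F F') M u :
    psi F M (app (component (fmap DA f) M) u) = nat_comp (psi F' M u) f.
  by apply: (bij_inj (bij F M)); rewrite phiF !psiK.
have sigF G G' (f : @hom (modrAb R) G G') N u :
    sig G N (app (component (@fmap _ _ DR G' G f) N) u) = nat_comp (sig G' N u) f.
  by apply: (bij_inj (rbij G N)); rewrite rhoF !sigK.
have {}phiN F M M' (h : hom M M') s : phi F M' (nat_comp (tensorl_map h) s) =
    app (fmap (DA F : modrAb R) h) (phi F M s) := phiN F M M' h s.
have {}rhoN G N N' (h : hom N N') s : rho G N' (nat_comp (tensorr_map h) s) =
    app (fmap (sval (DR G)) h) (rho G N s) := rhoN G N N' h s.
(* s and t are related when they come from the same pairing. *)
pose rel (F : fp R) (G : modrAb R) (s : nat_trans G (DA F : modrAb R))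
    (t : nat_trans (sval F) (sval (DR G))) :=
  forall M N x y,
    app (sig G N (app (t N) y) M) x = app (psi F M (app (s M) x) N) y.
have ex_t F G s : exists t, @rel F G s t.
  have tauN N y (M M' : modr R) (h : hom M M') x :
      app (psi F M' (app (s M') (app (fmap G h) x)) N) y =
      app (fmap (tensorr N) h) (app (psi F M (app (s M) x) N) y).
    by rewrite nat_app psiN.
  have tauD N y (M : modr R) x x' :
      app (psi F M (app (s M) (x + x')) N) y =
      app (psi F M (app (s M) x) N) y + app (psi F M (app (s M) x') N) y.
    by rewrite appD psiD.
  pose tau N y : nat_trans G (tensorr N) :=
    @mknat _ G (tensorr N) (fun M x => app (psi F M (app (s M) x) N) y)
      (tauD N y) (tauN N y).
  have tD N y y' : rho G N (tau N (y + y')) = rho G N (tau N y) + rho G N (tau N y').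
    by rewrite -rhoD; congr (rho _ _ _); apply: nat_app_ext => M x; exact: appD.
  have tN N N' (f : hom N N') y :
      rho G N' (tau N' (app (fmap (sval F) f) y)) = app (fmap (sval (DR G)) f) (rho G N
          (tau N y)).
    rewrite -rhoN; congr (rho _ _ _); apply: nat_app_ext => M x.
    exact: (nat_app (psi F M (app (s M) x)) f y).
  exists (@mknat _ (sval F) (sval (DR G)) (fun N y => rho G N (tau N y)) tD tN).
  by move=> M N x y; rewrite mknatE rhoK.
have ex_s F G t : exists s, @rel F G s t.
  have tauN M x (N N' : Mod R) (f : hom N N') y :
      app (sig G N' (app (t N') (app (fmap (sval F) f) y)) M) x =
      app (fmap (tensorl M) f) (app (sig G N (app (t N) y) M) x).
    by rewrite nat_app sigN.
  have tauD M x (N : Mod R) y y' :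
      app (sig G N (app (t N) (y + y')) M) x =
      app (sig G N (app (t N) y) M) x + app (sig G N (app (t N) y') M) x.
    by rewrite appD sigD.
  pose tau M x : nat_trans (sval F) (tensorl M) :=
    @mknat _ (sval F) (tensorl M) (fun N y => app (sig G N (app (t N) y) M) x)
      (tauD M x) (tauN M x).
  have sD M x x' : phi F M (tau M (x + x')) = phi F M (tau M x) + phi F M (tau M x').
    by rewrite -phiD; congr (phi _ _ _); apply: nat_app_ext => N y; exact: appD.
  have sN M M' (h : hom M M') x :
      phi F M' (tau M' (app (fmap G h) x)) = app (fmap (DA F : modrAb R) h) (phi F M
          (tau M x)).
    rewrite -phiN; congr (phi _ _ _); apply: nat_app_ext => N y.
    exact: (nat_app (sig G N (app (t N) y)) h x).
  exists (@mknat _ G (DA F : modrAb R) (fun M x => phi F M (tau M x)) sD sN).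
  by move=> M N x y; rewrite mknatE phiK.
have uniq_t F G s t t' : @rel F G s t -> @rel F G s t' -> t = t'.
  move=> st st'; apply: nat_app_ext => N y; apply: (can_inj (sigK G N)).
  by apply: nat_app_ext => M x; rewrite st st'.
have uniq_s F G s s' t : @rel F G s t -> @rel F G s' t -> s = s'.
  move=> st st'; apply: nat_app_ext => M x; apply: (can_inj (psiK F M)).
  by apply: nat_app_ext => N y; rewrite -st st'.
pose Phi F G s := projT1 (cid (ex_t F G s)).
have PhiP F G s : rel F G s (Phi F G s) by rewrite /Phi; case: (cid _).
exists Phi; split.
- move=> F G; apply: bijective_of_surj_inj => [t|s s' ss'].
    by have [s st] := ex_s F G t; exists s; exact: uniq_t (PhiP _ _ _) st.
  by apply: uniq_s (PhiP F G s) _; rewrite ss'; exact: PhiP.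
- move=> F G G' g s; apply: uniq_t (PhiP _ _ _) _ => M N x y.
  rewrite -[app (_ N) y]/(app (component (fmap DR g) N) (app (Phi F G s N) y)).
  by rewrite sigF [LHS]PhiP.
- move=> F F' G f s; apply: uniq_t (PhiP _ _ _) _ => M N x y.
  rewrite [LHS]PhiP.
  rewrite -[app (component (s \oc fmap DA f) M) x]/(app (component (fmap DA f) M) (app
      (component s M) x)).
  by rewrite psiF.
Qed.

End Dualities.
(** * Divisible groups *)

Lemma sg_mulrz (A : zmodType) (S : subgroup A) x (k : int) : S x -> S (x *~ k).
Proof.
move=> Sx; have SM n : S (x *+ n).
  by elim: n => [|n IH]; rewrite ?mulr0n ?mulrS; [exact: sg0 | exact: sgD].
by case: k => n; [exact: SM | exact: sgN (SM n.+1)].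
Qed.

Lemma int_subgroup (S : subgroup int) :
  exists n : nat, forall k, S k <-> (n%:Z %| k)%Z.
Proof.
case: (pselect (exists n : nat, `[< S n.+1%:Z >])) => [ex|nex]; last first.
  exists 0%N => k; rewrite dvd0z; split=> [Sk|/eqP ->]; last exact: sg0.
  apply: contrapT => k0; apply: nex.
  have Sa : S `|k|%N%:Z.
    by case: k Sk {k0} => m Sm //; move: (sgN Sm); rewrite NegzE opprK.
  exists `|k|%N.-1; apply/asboolP; rewrite prednK ?absz_gt0 //; exact/negP.
have [n /asboolP Sn nmin] := ex_minnP ex.
exists n.+1 => k; split=> [Sk|/dvdzP[q ->]]; last first.
  by rewrite mulrC -mulrzz; exact: sg_mulrz.
have Sr : S (k %% n.+1%:Z)%Z.
  rewrite /modz; apply: sgB => //.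
  by rewrite mulrC -mulrzz; exact: sg_mulrz.
have r0 : 0 <= (k %% n.+1%:Z)%Z by exact: modz_ge0.
have rn : (k %% n.+1%:Z)%Z < n.+1%:Z by exact: ltz_pmod.
apply/eqP/eqP; apply/dvdz_mod0P; move: Sr r0 rn.
case: (k %% n.+1%:Z)%Z => // -[//|r] Sr _; rewrite ltz_nat ltnS => rn.
by have := nmin r; rewrite leqNgt rn => /(_ (asboolT Sr)).
Qed.

Section Divisible.
Variable D : zmodType.
Hypothesis div : forall (n : nat) (d : D), exists e, (0 < n)%N -> e *+ n = d.

Section Extension.
Variable B : zmodType.

Definition graph_partial (G : (B * D)%type -> Prop) :=
  [/\ G (0, 0), forall x y, G x -> G y -> G (x - y) & forall d, G (0, d) -> d = 0].

(** The multiples of b in the domain of the homomorphism with graph G are those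
    of some n b, and the value at b may be any n-th part of the value at n b. *)
Lemma graph_extend1 (G : (B * D)%type -> Prop) b : graph_partial G ->
  exists G', [/\ graph_partial G', (forall x, G x -> G' x) & exists d, G' (b, d)].
Proof.
case=> G0 GB Gf; pose S := Subgroup G0 GB.
have I0 : exists d, G (b *~ 0, d) by exists 0; rewrite mulr0z.
have IB (k l : int) : (exists d, G (b *~ k, d)) -> (exists d, G (b *~ l, d)) ->
    exists d, G (b *~ (k - l), d).
  by move=> [d dk] [e el]; exists (d - e); rewrite mulrzBr; exact: GB dk el.
have [n nP] := int_subgroup (Subgroup I0 IB).
have [y0 Gy0] : exists d, G (b *~ n%:Z, d) by apply/nP; exact: dvdzz.
have [e en] : exists e, e *~ n%:Z = y0.
  case: n Gy0 {nP} => [|n] Gy0.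
    by exists 0; rewrite mulr0z (Gf y0) // -(mulr0z b).
  by have [e eP] := div n.+1 y0; exists e; exact: eP.
exists (fun z => exists x k, S x /\ z = (x.1 + b *~ k, x.2 + e *~ k)); split.
- split.
  + by exists (0, 0), 0; split=> //; rewrite !mulr0z !addr0.
  + move=> _ _ [x [k [Sx ->]]] [x' [k' [Sx' ->]]].
    exists (x - x'), (k - k'); split; first exact: (@sgB _ S _ _ Sx Sx').
    by rewrite !mulrzBr; congr (_, _); rewrite /= opprD addrACA.
  + move=> d [[x y] [k [Sx [/= x0 ->]]]].
    have xE : x = b *~ (- k).
      by apply: (addIr (b *~ k)); rewrite -x0 mulrNz addNr.
    have /nP/dvdzP[q kq] : exists d, G (b *~ (- k), d) by exists y; rewrite -xE.
    have : S ((x, y) - (b *~ n%:Z, y0) *~ q) by apply: sgB => //; exact: sg_mulrz.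
    have pmz (p : (B * D)%type) (j : int) : p *~ j = (p.1 *~ j, p.2 *~ j).
      have pmn (m : nat) : p *+ m = (p.1 *+ m, p.2 *+ m).
        by elim: m => [|m IH]; rewrite ?mulr0n // !mulrS IH.
      by case: j => m; rewrite /intmul pmn.
    rewrite pmz /= -en -!mulrzA xE kq (mulrC q) => S0.
    have /Gf/eqP : G (0, y - e *~ (n%:Z * q)).
      have -> // : (0, y - e *~ (n%:Z * q)) =
        (b *~ (n%:Z * q), y) - (b *~ (n%:Z * q), e *~ (n%:Z * q)) :> (B * D)%type.
      by congr (_, _); rewrite /= subrr.
    rewrite subr_eq0 => /eqP ->.
    by rewrite mulrC -kq mulrNz addNr.
- by move=> [x y] Sx; exists (x, y), 0; rewrite !mulr0z !addr0.
- by exists e, (0, 0), 1; split=> //; rewrite /= !mulr1z !add0r.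
Qed.

(** By Zorn's lemma there is a maximal partial homomorphism extending G0; by the
    one-step extension it is defined everywhere. *)
Lemma divisible_extend (G0 : (B * D)%type -> Prop) : graph_partial G0 ->
  exists h : @hom Ab B D, forall b d, G0 (b, d) -> app h b = d.
Proof.
move=> G0P.
(* Adding G0 to each member makes the union of the empty chain admissible. *)
pose P (A : set (B * D)%type) := graph_partial (fun x => A x \/ G0 x).
have [F FP Ftot|A [PA Amax]] := @Zorn_bigcup _ P.
  have G0F x : G0 x -> (\bigcup_(X in F) X)%classic x \/ G0 x by right.
  have pick x : (\bigcup_(X in F) X)%classic x \/ G0 x ->
      G0 x \/ exists2 X, F X & X x.
    by case=> [[X FX Xx]|]; [right; exists X | left].
  have in1 X x : F X -> X x \/ G0 x -> (\bigcup_(X in F) X)%classic x \/ G0 x.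
    by move=> FX [Xx|]; [left; exists X | right].
  have [g1 g2 g3] := G0P.
  split; first by right.
  - move=> x y /pick[Gx|[X FX Xx]] /pick[Gy|[Y FY Yy]].
    + by right; exact: g2.
    + have [_ h _] := FP _ FY; apply: (in1 Y) => //.
      by apply: h; [right | left].
    + have [_ h _] := FP _ FX; apply: (in1 X) => //.
      by apply: h; [left | right].
    + have [XY|YX] := Ftot _ _ FX FY.
        have [_ h _] := FP _ FY; apply: (in1 Y) => //.
        by apply: h; left => //; exact: XY.
      have [_ h _] := FP _ FX; apply: (in1 X) => //.
      by apply: h; left => //; exact: YX.
  - move=> d /pick[/g3 //|[X FX Xx]].
    by have [_ _ h] := FP _ FX; apply: h; left.
pose G x := A x \/ G0 x.
have Gtot b : exists d, G (b, d).
  have [G' [G'P GG' [d G'bd]]] := graph_extend1 b PA.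
  exists d; apply: contrapT => nG; apply: (Amax G').
    split=> [|G'A]; first by move=> x Ax; apply: GG'; left.
    by apply: nG; left; apply: G'A.
  rewrite /P (_ : (fun x => G' x \/ G0 x) = G') //.
  apply/funext => x; apply: propext; split=> [[//|G0x]|]; last by left.
  by apply: GG'; right.
have [G00 GB Gf] := PA.
pose h b := projT1 (cid (Gtot b)).
have hP b : G (b, h b) by rewrite /h; case: (cid _).
have Gh b d : G (b, d) -> h b = d.
  move=> Gbd; apply/eqP; rewrite -subr_eq0; apply/eqP; apply: Gf.
  have -> : (0, h b - d) = (b, h b) - (b, d) :> (B * D)%type.
    by congr (_, _); rewrite /= subrr.
  exact: (GB _ _ (hP b) Gbd).
have hD x y : h (x + y) = h x + h y.
  apply: Gh; pose S := @Subgroup _ G G00 GB.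
  exact: (@sgD _ S (x, h x) (y, h y) (hP x) (hP y)).
exists (mkab hD) => b d G0bd; rewrite app_mkab; apply: Gh.
by right.
Qed.

End Extension.

(** Extend the partial homomorphism sending i a to f a. *)
Lemma divisible_injective (A B : Ab) (i : hom A B) (f : @hom Ab A D) :
  injective (app i) -> exists g : @hom Ab B D, g \oc i = f.
Proof.
move=> ii.
have [|h hP] := @divisible_extend B (fun z => exists a, z = (app i a, app f a)).
  split; first by exists 0; rewrite !app0.
  - by move=> _ _ [x ->] [y ->]; exists (x - y); rewrite !appB.
  - by move=> d [a [/esym ia ->]]; rewrite (ii a 0) ?app0.
exists h; apply: app_ext => a; rewrite app_cmp; apply: hP.
by exists a.
Qed.

End Divisible.

Definition int_sg : subgroup rat.
Proof.
apply: (@Subgroup _ (fun q => exists k : int, q = k%:~R)); first by exists 0.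
by move=> _ _ [k ->] [l ->]; exists (k - l); rewrite rmorphB.
Defined.

Definition QZ : zmodType := quotg int_sg.

Lemma QZ_divisible (n : nat) (d : QZ) : exists e, (0 < n)%N -> e *+ n = d.
Proof.
have [q <-] := quotg_proj_surj d; exists (app (quotg_proj int_sg) (q / n%:R)) => n0.
have appMn (x : rat) m : app (quotg_proj int_sg) x *+ m = app (quotg_proj int_sg) (x *+ m).
  by elim: m => [|m IH]; rewrite ?mulr0n ?app0 // !mulrS appD IH.
rewrite appMn -[X in app _ X]mulr_natr divfK //.
by rewrite pnatr_eq0 -lt0n.
Qed.

Lemma QZ_injective (A B : Ab) (i : hom A B) (f : @hom Ab A QZ) :
  injective (app i) -> exists g : @hom Ab B QZ, g \oc i = f.
Proof. exact: divisible_injective QZ_divisible _ _ _ _. Qed.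

(** An element of order n > 1 can be sent to the class of 1/n, and one of infinite
    order to any class. *)
Lemma QZ_cogenerator (B : zmodType) (b : B) :
  (forall h : @hom Ab B QZ, app h b = 0) -> b = 0.
Proof.
move=> hb.
have I0 : b *~ 0 = 0 by rewrite mulr0z.
have IB (k l : int) : b *~ k = 0 -> b *~ l = 0 -> b *~ (k - l) = 0.
  by move=> bk bl; rewrite mulrzBr bk bl subrr.
have [n nP] := int_subgroup (Subgroup I0 IB).
(* b goes to the class of 1/c; for n = 0, when b has infinite order, any c > 1
   would do. *)
pose c : nat := if n == 0%N then 2 else n.
pose pr := app (quotg_proj int_sg).
have c0 : (c%:R : rat) != 0 by rewrite pnatr_eq0 /c; case: (n).
have prM (k : int) : pr ((k%:~R : rat) / c%:R) = pr (1 / c%:R) *~ k.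
  have prN m : pr ((m%:R : rat) / c%:R) = pr (1 / c%:R) *+ m.
    by elim: m => [|m IH]; rewrite ?mulr0n ?mul0r ?app0 // !mulrS -IH -appD -mulrDl.
  case: k => m; first exact: prN.
  rewrite NegzE [LHS](_ : _ = pr (- (m.+1%:R / c%:R))); last first.
    by rewrite rmorphN mulNr.
  rewrite [LHS]appN -/(pr _) prN mulrNz.
  by [].
have [|h hP] := divisible_extend (D := QZ) (B := B) QZ_divisible
    (G0 := fun z => exists k : int, z = (b *~ k, pr (k%:~R / c%:R))).
  split; first by exists 0; rewrite !mulr0z mul0r /pr app0.
  - move=> _ _ [k ->] [l ->]; exists (k - l).
    by rewrite mulrzBr rmorphB mulrBl /pr appB.
  - move=> d [k [/esym bk ->]]; apply/quotg_proj0.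
    have /dvdzP[q ->] : (n%:Z %| k)%Z by apply/nP.
    rewrite /c; case: eqP => [->|/eqP n0].
      by exists 0; rewrite mulr0 mul0r.
    by exists q; rewrite rmorphM /= mulfK // intr_eq0 eqz_nat.
have : pr (1 / c%:R) = 0.
  by rewrite -(hb h); apply/esym; apply: hP; exists 1; rewrite mulr1z.
move/quotg_proj0 => -[k ck].
have cdvd : k * c%:Z = 1.
  apply/eqP; rewrite -(eqr_int rat) rmorphM /= -ck; apply/eqP.
  by rewrite -[(c%:Z)%:~R]/(c%:R) divfK.
have n1 : n = 1%N.
  have : (c%:Z %| 1)%Z by apply/dvdzP; exists k.
  by rewrite dvdz1 absz_nat /c; case: (n) => [|m] //= /eqP.
have : b *~ 1 = 0 by apply/nP; rewrite n1.
by rewrite mulr1z.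
Qed.

(** * Injective functors *)

Section Injectives.
Variable R : pzRingType.

Section Coinduced.
Variable K : modr R.

Definition coind_sg (M : modr R) : subgroup (prodg (fun _ : lhom (sval M) (sval K) => QZ)).
Proof.
refine (@Subgroup (prodg (fun _ : lhom (sval M) (sval K) => QZ))
  (fun u => forall f g : lhom (sval M) (sval K), u (f + g) = u f + u g) _ _).
  by move=> f g; rewrite !prodg0 addr0.
by move=> u v uD vD f g; rewrite !prodgB uD vD opprD addrACA.
Defined.

Definition coind1 (M M' : modr R) (h : hom M M') (u : subg (coind_sg M)) :
  subg (coind_sg M').
Proof.
exists (fun f => sval u (lpre (h : {linear _ -> _}) f)) => f g.
rewrite -(svalP u); congr (sval u _); exact: raddfD.
Defined.

(** The functor Hom((-,K), Q/Z). *)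
Definition coind : modrAb R.
Proof.
apply: (@mkfun (modr R) (fun M => subg (coind_sg M)) coind1).
- by move=> M M' h u v; apply: subg_inj.
- move=> M u; apply: subg_inj; apply: prodg_ext => f; congr (sval u _).
  exact: (@cmpm1 (Mod R^c) (sval M) (sval K) f).
- move=> M M' M'' g f u; apply: subg_inj; apply: prodg_ext => k; congr (sval u _).
  exact: (@cmpA (Mod R^c) (sval M) (sval M') (sval M'') (sval K) k g f).
- move=> M M' f g u; apply: subg_inj; apply: prodg_ext => k.
  rewrite -[RHS](svalP u); congr (sval u _).
  exact: (@cmpDr (Mod R^c) (sval M) (sval M') (sval K) k f g).
Defined.

Lemma coindE M M' (h : hom M M') (u : (coind M : zmodType)) (f : hom M' K) :
  sval (app (fmap coind h) u) (f : lhom (sval M') (sval K)) = sval u (f \oc h : lhom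
      (sval M) (sval K)).
Proof. by []. Qed.

Lemma coind_mapD (F : modrAb R) (phi : @hom Ab (F K) QZ) (M : modr R) x :
  coind_sg M (fun f : lhom (sval M) (sval K) =>
    app phi (app (fmap F (f : @hom (modr R) M K)) x)).
Proof. by move=> f g; rewrite -appD -app_hadd -fmapD. Qed.

(** Every map from F to this functor has this form, by Yoneda. *)
Definition coind_map (F : modrAb R) (phi : @hom Ab (F K) QZ) : nat_trans F coind.
Proof.
apply: (@mknat _ F coind (fun M x => exist (coind_sg M) _ (coind_mapD phi x))).
- by move=> M x y; apply: subg_inj; apply: prodg_ext => f; rewrite /= !appD.
- move=> M M' h x; apply: subg_inj; apply: prodg_ext => f.
  by rewrite coindE /= -app_fmapM.
Defined.

Lemma coind_mapE (F : modrAb R) (phi : @hom Ab (F K) QZ) (M : modr R) x (f : hom M K) :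
  sval (app (coind_map phi M) x) (f : lhom (sval M) (sval K)) = app phi (app (fmap F f) x).
Proof. by []. Qed.

(** Maps F -> coind K are homomorphisms F K -> Q/Z, and Q/Z is injective. *)
Lemma coind_injective : @projective (op (modrAb R)) coind.
Proof.
move=> H F i t /mono_nat_inj ii.
pose t0f x := sval (app (component t K) x) (idm K : lhom (sval K) (sval K)).
have t0D x y : t0f (x + y) = t0f x + t0f y by rewrite /t0f appD.
have [g gP] := QZ_injective (mkab t0D) (ii K).
exists (coind_map g); apply: nat_app_ext => M x.
apply: subg_inj; apply: prodg_ext => f.
rewrite -[LHS]/(app g (app (fmap H (f : @hom (modr R) M K)) (app (component i M) x))).
rewrite -nat_app -app_cmp gP app_mkab /t0f nat_app coindE.
by congr (sval _ _); exact: (@cmp1m (modr R)).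
Qed.

End Coinduced.

Lemma prodfun_injective (I : Type) (F : I -> modrAb R) :
  (forall i, @projective (op (modrAb R)) (F i)) ->
  @projective (op (modrAb R)) (prodfun F).
Proof.
move=> Fi H G i t im.
have ex j : exists s : nat_trans H (F j),
    nat_comp s i = nat_comp (prodfun_proj F j) t.
  exact: (Fi j H G i (nat_comp (prodfun_proj F j) t) im).
pose s j := projT1 (cid (ex j)).
have sP j : nat_comp (s j) i = nat_comp (prodfun_proj F j) t.
  by rewrite /s; case: (cid _).
exists (prodfun_pair s); apply: nat_app_ext => M x.
apply: (@prodg_ext _ (fun j => F j M)) => j.
by rewrite -[LHS]/(app (nat_comp (s j) i M) x) sP.
Qed.

(** G embeds in the product of the functors Hom((-,K), Q/Z) over K in a skeleton
    and homomorphisms G K -> Q/Z, because these separate the elements of G K. *)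
Lemma enough_injectives (G : op (modrAb R)) :
  exists (P : op (modrAb R)) (p : hom P G), projective P /\ epi p.
Proof.
have [S [C CP]] := modr_skeleton R.
pose J := {p : S & {additive (G (C p) : zmodType) -> QZ}}.
pose F (j : J) := coind (C (projT1 j)).
pose t := prodfun_pair (fun j : J => @coind_map (C (projT1 j)) G (projT2 j)).
exists (prodfun F), t; split.
  by apply: prodfun_injective => j; exact: coind_injective.
apply: (@nat_inj_mono _ _ _ t) => M; apply: app_inj0 => x tx.
have [p [e [e' [_ ee']]]] := CP M.
suff x0 : app (fmap G e') x = 0 by rewrite -(app_fmap1 x) -ee' app_fmapM x0 app0.
apply: QZ_cogenerator => h.
have tj : app (@coind_map (C p) G h M) x = 0 :=
  congr1 (fun u : prodg (fun j => F j M) => u (existT _ p (h : {additive _ -> _}))) tx.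
by rewrite -(coind_mapE h x e') tj.
Qed.

End Injectives.
(** * Injective functors are tensor functors *)

Section Counit.
Variable R : pzRingType.

Section Act.
Variable M : modr R.

(** The map R -> M sending 1 to m. *)
Definition act (m : (sval M : lmodType R^c)) : hom (RR R) M.
Proof.
apply: (@mkmod R^c (regr R) (sval M) (fun r => (r : R^c) *: m)) => [x y|r x].
  exact: scalerDl.
by rewrite scalerA.
Defined.

Lemma actE m x : rapp (act m) x = (x : R^c) *: m. Proof. by []. Qed.

Lemma act1 m : rapp (act m) (regr1 R) = m.
Proof. by rewrite actE; exact: scale1r. Qed.

Lemma actD m m' : act (m + m') = hadd (act m) (act m').
Proof. by apply: rapp_ext => x; rewrite actE scalerDr. Qed.

Lemma actZ m (a : R) : act ((a : R^c) *: m) = act m \oc lmul_hom a.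
Proof. by apply: rapp_ext => x; rewrite rapp_cmp !actE scalerA. Qed.

End Act.

Lemma act_map (M M' : modr R) (h : hom M M') m : act (rapp h m) = h \oc act m.
Proof. by apply: rapp_ext => x; rewrite rapp_cmp !actE -rappZ. Qed.

Lemma act_id : act (regr1 R : sval (RR R)) = idm (RR R).
Proof. by apply: rapp_ext => x; rewrite actE rapp_idm; exact: (@mul1r R). Qed.

Section CounitMap.
Variable G : modrAb R.

Definition counit_fun (M : modr R) (m : (sval M : lmodType R^c)) (x : evmod G) :
  (G M : zmodType) := app (fmap G (act m)) x.

Lemma counit_balanced (M : modr R) : balanced (@counit_fun M).
Proof.
split=> [m m' x|m x y|m r x]; rewrite /counit_fun.
- by rewrite actD fmapD app_hadd.
- exact: appD.
- by rewrite actZ app_fmapM.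
Qed.

Definition counit_at (M : modr R) : @hom Ab (tensor (sval M) (evmod G)) (G M) :=
  tlift (counit_balanced M).

Lemma counit_atE (M : modr R) m x : app (counit_at M) (tpure m x) = app (fmap G (act m)) x.
Proof. exact: tlift_pure. Qed.

Lemma counit_nat (M M' : modr R) (h : hom M M') :
  counit_at M' \oc fmap (tensorr (evmod G : Mod R)) h = fmap G h \oc counit_at M.
Proof.
apply: tensor_ext => m x.
rewrite -[LHS]/(app (counit_at M') (app (fmap (tensorr (evmod G : Mod R)) h) (tpure m x))).
rewrite tensorr_app counit_atE.
rewrite -[RHS]/(app (fmap G h) (app (counit_at M) (tpure m x))).
by rewrite counit_atE -app_fmapM -act_map.
Qed.

(** The counit of the adjunction between N |-> - (x) N and evaluation at R. *)
Definition counit : nat_trans (tensorr (evmod G : Mod R)) G :=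
  NatTrans counit_nat.

Lemma counitE (M : modr R) m (x : evmod G) :
  app (counit M) (tpure m x) = app (fmap G (act m)) x.
Proof. exact: counit_atE. Qed.

Lemma counit1 (x : evmod G) : app (counit (RR R)) (tpure (regr1 R) x) = x.
Proof. by rewrite counitE act_id app_fmap1. Qed.

End CounitMap.

Lemma counit_natural (G G' : modrAb R) (t : hom G G') :
  nat_comp t (counit G) = nat_comp (counit G') (tensorr_map (fmap (ev R) t)).
Proof.
apply: nat_ext => M; apply: tensor_ext => m x.
rewrite -[LHS]/(app (component t M) (app (counit G M) (tpure m x))).
rewrite -[RHS]/(app (counit G' M) (app (fmap (tensorl M) (fmap (ev R) t)) (tpure m x))).
by rewrite tensorl_app !counitE nat_app.
Qed.

(** The pure tensor m (x) n is the image of 1 (x) n under [act m]. *)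
Lemma tensorr_hom_ext (N : Mod R) (G : modrAb R) (s t : nat_trans (tensorr N) G) :
  (forall n, app (s (RR R)) (tpure (regr1 R) n) = app (t (RR R)) (tpure (regr1 R) n)) ->
  s = t.
Proof.
move=> st; apply: nat_ext => M; apply: tensor_ext => m n.
have -> : tpure m n = app (fmap (tensorr N) (act m)) (tpure (regr1 R) n).
  by rewrite tensorr_app act1.
by rewrite -[LHS]/(app (s M) _) -[RHS]/(app (t M) _) !nat_app st.
Qed.

(** The linear map attached to t sends n to t (1 (x) n). *)
Lemma tensorr_ev_adjoint (N : Mod R) (G : modrAb R) :
  bijective (fun k : @hom (Mod R) N (evmod G) => nat_comp (counit G) (tensorr_map k)).
Proof.
have E k n : app (nat_comp (counit G) (tensorr_map k) (RR R)) (tpure (regr1 R) n) =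
    mapp (k : @hom (Mod R) N (evmod G)) n.
  rewrite -[LHS]/(app (counit G (RR R)) (app (fmap (tensorl (RR R)) k) (tpure _ n))).
  by rewrite tensorl_app counit1.
apply: bijective_of_surj_inj => [t|k k' kk']; last first.
  by apply: mapp_ext => n; rewrite -!E kk'.
pose k0 (n : (N : lmodType R)) : evmod G := app (t (RR R)) (tpure (regr1 R) n).
have k0D n n' : k0 (n + n') = k0 n + k0 n' by rewrite /k0 tpureDr appD.
have k0Z (r : R) n : k0 (r *: n) = r *: k0 n.
  rewrite -[RHS]/(app (fmap G (lmul_hom r)) (k0 n)) -nat_app tensorr_app.
  rewrite /k0 -tpureZ; congr (app _ (tpure _ _)).
  by rewrite -[LHS]/(1 * r) mul1r -[RHS]/(r * 1) mulr1.
exists (@mkmod R N (evmod G) k0 k0D k0Z); apply: tensorr_hom_ext => n.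
by rewrite E.
Qed.

Section InjectiveFunctor.
Variable I : modrAb R.
Hypothesis Iinj : @projective (op (modrAb R)) I.

(** The functor (M,-) on finitely presented right modules. *)
Definition hrep (M : modr R) : modrAb R :=
  functor_comp (rep (sval M : Mod R^c)) (@incl (Mod R^c) (@fp_module R^c)).

Definition hrep_map (M M' : modr R) (h : hom M M') : nat_trans (hrep M') (hrep M).
Proof.
apply: (@mknat (modr R) (hrep M') (hrep M)
  (fun K (f : lhom (sval M') (sval K)) => lpre (h : {linear _ -> _}) f)).
- by move=> K f g; exact: raddfD.
- by move=> K L f g; exact: esym (@cmpA (modr R) M M' K L f g h).
Defined.

Lemma hrep_mapE (M M' K : modr R) (h : hom M M') (f : hom M' K) :
  app (hrep_map h K) (f : lhom (sval M') (sval K)) = f \oc h.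
Proof. by []. Qed.

Definition hrep_hom (M : modr R) (y : (I M : zmodType)) : nat_trans (hrep M) I.
Proof.
apply: (@mknat (modr R) (hrep M) I
  (fun K (f : lhom (sval M) (sval K)) => app (fmap I (f : @hom (modr R) M K)) y)).
- by move=> K f g; rewrite -app_hadd -fmapD.
- by move=> K L h f; rewrite -app_fmapM.
Defined.

Lemma hrep_homE (M K : modr R) y (f : hom M K) :
  app (@hrep_hom M y K) (f : lhom (sval M) (sval K)) = app (fmap I f) y.
Proof. by []. Qed.

Definition hrep_el (M : modr R) (t : nat_trans (hrep M) I) : (I M : zmodType) :=
  app (t M) (idm M : lhom (sval M) (sval M)).

Lemma hrep_elE (M K : modr R) (t : nat_trans (hrep M) I) (f : hom M K) :
  app (fmap I f) (hrep_el t) = app (t K) (f : lhom (sval M) (sval K)).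
Proof.
rewrite /hrep_el -nat_app; congr (app _ _).
exact: (@cmpm1 (modr R) M K f).
Qed.

(** Mapping the exact sequence 0 -> (M,-) -> (B,-) -> (A,-) into an injective
    functor shows that this functor is right exact. *)
Lemma injective_right_exact (A B M : modr R) (f : hom A B) (g : hom B M) :
  (forall y, exists x, rapp g x = y) ->
  (forall x, rapp g x = 0 <-> exists z, rapp f z = x) ->
  (forall y, exists x, app (fmap I g) x = y) /\
  (forall x, app (fmap I g) x = 0 <-> exists z, app (fmap I f) z = x).
Proof.
move=> gs fg.
have gf0 : g \oc f = hzero A M by apply: rapp_ext => a; apply/fg; exists a.
have gi : nat_inj (hrep_map g).
  move=> K h h' hh'; apply: (@rapp_ext R M K h h') => m; have [b <-] := gs m.
  by rewrite -!rapp_cmp -!hrep_mapE hh'.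
have ex : nat_exact (hrep_map g) (hrep_map f).
  move=> K h; split=> [hf|[h' <-]].
    have [|h' h'g] := rmod_factor_surj (p := g) (t := h : @hom (modr R) B K) gs.
      move=> x /fg[z <-]; rewrite -rapp_cmp -hrep_mapE hf.
      by [].
    by exists h'.
  rewrite (hrep_mapE g (h' : @hom (modr R) M K)) hrep_mapE -cmpA gf0 cmpm0.
  by [].
split=> [y|x]; last split=> [gx|[z <-]]; last first.
- by rewrite -app_fmapM gf0 fmap0.
- have Cab := abelian_op (abelian_functor_cat (modr R)).
  have ker := nat_exact_kernel gi ex.
  have [|t tP] := @projective_exact (op (modrAb R)) I (hrep B) (hrep A) (hrep M)
    (hrep_map f) (hrep_map g) (hrep_hom x) Cab Iinj ker.
    apply: nat_app_ext => K h.
    rewrite -[LHS]/(app (hrep_hom x K) (app (hrep_map g K) h)).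
    rewrite (hrep_mapE g (h : @hom (modr R) M K)) hrep_homE app_fmapM gx app0.
    by [].
  exists (hrep_el t); rewrite hrep_elE -[f in app _ f](@cmp1m (modr R)).
  rewrite -hrep_mapE -[LHS]/(app (component (t : nat_trans _ _) B) (app (hrep_map f B)
      (idm B : lhom (sval B) (sval B)))).
  rewrite -[LHS]/(app (nat_comp t (hrep_map f) B) (idm B : lhom (sval B) (sval B))).
  by rewrite [nat_comp _ _]tP hrep_homE app_fmap1.
- have [t tP] := Iinj (hrep_hom y : @hom (op (modrAb R)) I (hrep M)) (nat_inj_mono gi).
  exists (hrep_el t); rewrite hrep_elE -[g in app _ g](@cmp1m (modr R)).
  rewrite -hrep_mapE -[LHS]/(app (nat_comp t (hrep_map g) M) (idm M : lhom (sval M)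
      (sval M))).
  by rewrite [nat_comp _ _]tP hrep_homE app_fmap1.
Qed.

(** Two right exact functors, related by a map that is bijective at R, agree on
    free modules of finite rank and then on their cokernels. *)
Lemma counit_injective_iso : @is_iso (modrAb R) _ _ (counit I).
Proof.
pose T := tensorr (evmod I : Mod R).
have bR (y : evmod I) : exists x, app (counit I (RR R)) x = y.
  by exists (tpure (regr1 R) y); exact: counit1.
have bRi : injective (app (counit I (RR R))).
  move=> x y; have [n ->] := one_tensor x; have [n' ->] := one_tensor y.
  by rewrite !counit1 => ->.
have bV n y : exists x, app (counit I (rVr R n)) x = y.
  pose z (j : 'I_n) := projT1 (cid (bR (app (fmap I (rV_proj R j)) y))).
  have zP j : app (counit I (RR R)) (z j) = app (fmap I (rV_proj R j)) y.
    by rewrite /z; case: (cid _).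
  exists (\sum_(j < n) app (fmap T (rV_inj R j)) (z j)).
  rewrite app_sum [RHS](rV_sum (F := I)); apply: eq_bigr => j _.
  by rewrite nat_app zP.
have bVi n : injective (app (counit I (rVr R n))).
  apply: app_inj0 => x x0; rewrite (rV_sum (F := T) x); apply: big1 => j _.
  rewrite (_ : app (fmap T (rV_proj R j)) x = 0) ?app0 //.
  by apply: bRi; rewrite nat_app x0 !app0.
have bM (M : modr R) : (forall y, exists x, app (counit I M) x = y) /\
    injective (app (counit I M)).
  have [m [n [f [g [gs fg]]]]] := modr_presentation M.
  have [Igs Ifg] := injective_right_exact gs fg.
  have [Tgs Tfg] := tensor_right_exact (evmod I : Mod R) gs fg.
  split=> [y|].
    have [y' <-] := Igs y; have [x <-] := bV n y'.
    by exists (app (fmap T g) x); rewrite nat_app.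
  apply: app_inj0 => x; have [x' <-] := Tgs x.
  rewrite (nat_app (counit I) g x') => /Ifg[w].
  have [w' <-] := bV m w; rewrite -(nat_app (counit I) f w') => /bVi fw.
  by apply/Tfg; exists w'.
by apply: nat_bij_iso => M; have [] := bM M.
Qed.

End InjectiveFunctor.
End Counit.

(** * The functor D_L *)

(** Maps from P to F b and maps from x to b are both the maps to y0 modulo those
    coming from y1, because P and x lift along the maps to b. *)
Lemma universal_cokernel (C B : cat) (F : functor B C) (P : C) (x : B) (e : hom P (F x))
    (y1 y0 b : B) (a : hom y1 y0) (p : hom y0 b) :
  abelian C -> projective P ->
  is_cokernel (fmap F a) (fmap F p) -> p \oc a = hzero _ _ ->
  (forall f : hom x b, exists g, p \oc g = f) ->
  bijective (fun f : hom x y0 => fmap F f \oc e) ->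
  bijective (fun f : hom x y1 => fmap F f \oc e) ->
  bijective (fun f : hom x b => fmap F f \oc e).
Proof.
move=> Cab Pp Fap pa lift b0 b1.
have inj0 (f : hom x b) : fmap F f \oc e = hzero _ _ -> f = hzero _ _.
  have [g <-] := lift f; rewrite fmapM -cmpA => /(projective_exact Cab Pp Fap)[k kP].
  have [h hk] := bij_surj b1 k.
  have -> : g = a \oc h.
    by apply: (bij_inj b0); rewrite fmapM -cmpA hk kP.
  by rewrite cmpA pa cmp0m.
apply: bijective_of_surj_inj => [h|f g fg]; last first.
  apply: hsub_eq0; apply: inj0.
  by rewrite fmapB cmpBl fg haddmN.
have [h' h'P] := Pp _ _ (fmap F p) h (is_cokernel_epi Fap).
have [f fP] := bij_surj b0 h'.
by exists (p \oc f); rewrite fmapM -cmpA fP.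
Qed.

Section DL.
Variable R : pzRingType.

Let T := functor_comp (yoneda R) (functor_op (ev R)).

(** [L0_exists] applies because there are enough injectives. *)
Lemma DL_exists : exists DL, @is_DL R DL.
Proof.
apply: L0_exists.
- exact: abelian_op (abelian_functor_cat (modr R)).
- exact: enough_injectives.
- by case: (abelian_fp R).
Qed.

Variables (DA : functor (fp R) (op (modrAb R))).
Hypothesis DAP : is_DA DA.

(** Yoneda identifies transformations (N,-) -> M (x) - with M (x) N. *)
Lemma DA_rep : exists kap : forall N : Mod R, nat_trans (tensorr N) (DA (yoneda R N) :
    modrAb R),
  (forall N, @is_iso (modrAb R) _ _ (kap N)) /\
  (forall (N N' : Mod R) (f : hom N N'),
     nat_comp (kap N') (tensorr_map f) =
     nat_comp (@fmap _ _ DA (yoneda R N') (yoneda R N) (rep_map f)) (kap N)).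
Proof.
have [phi [bij phiD phiN phiF]] := DAP.
have {}phiN F M M' (h : hom M M') s : phi F M' (nat_comp (tensorl_map h) s) =
    app (fmap (DA F : modrAb R) h) (phi F M s) := phiN F M M' h s.
pose k0 (N : Mod R) (M : modr R) (x : tensor (sval M) N) :=
  phi (yoneda R N) M (@ymap R N (tensorl M) x).
have k0D N M x y : k0 N M (x + y) = k0 N M x + k0 N M y.
  rewrite -phiD; congr (phi _ _ _); apply: yel_inj.
  by rewrite yel_ymap -[RHS]/(yel (@ymap R N (tensorl M) x) + yel (@ymap R N (tensorl
      M) y)) !yel_ymap.
have k0N N M M' (h : hom M M') x :
    k0 N M' (app (fmap (tensorr N) h) x) = app (fmap (DA (yoneda R N) : modrAb R) h)
        (k0 N M x).
  rewrite -phiN; congr (phi _ _ _); apply: yel_inj.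
  by rewrite yel_ymap -[RHS]/(app (tensorl_map h N) (yel (@ymap R N (tensorl M) x)))
      yel_ymap.
pose kap N := @mknat _ (tensorr N) (DA (yoneda R N) : modrAb R) (@k0 N) (k0D N) (k0N N).
exists kap; split=> [N|N N' f].
  have ki : nat_inj (kap N).
    by move=> M x y /(bij_inj (bij _ _))/(congr1 (@yel _ _ _)); rewrite !yel_ymap.
  apply: (nat_bij_iso ki) => M y.
  have [t <-] := bij_surj (bij (yoneda R N) M) y.
  by exists (yel t); congr (phi _ _ _); apply: yel_inj; rewrite yel_ymap.
apply: nat_app_ext => M x.
apply: etrans (phiF (yoneda R N') (yoneda R N) (rep_map f) M
  (@ymap R N (tensorl M) x)).
congr (phi _ _ _); apply: yel_inj.
rewrite yel_ymap -[LHS]/(app (fmap (tensorl M) f) x).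
by rewrite -[RHS]/(app (fmap (tensorl M) (idm N' \oc f)) x) cmp1m.
Qed.

Variables (DL DR : functor (op (modrAb R)) (fp R)).
Hypotheses (DLP : is_DL DL) (DRP : is_DR DR).

(** For an injective I the map D_A (I R,-) -> I is the inverse of the isomorphism
    - (x) I R -> D_A (I R,-) followed by the counit.  It is universal for maps from
    D_A (X,-) by the adjunction of - (x) X and evaluation, then for maps from
    D_A F by presenting F. *)
Lemma DL_unit : exists eta : forall G, hom G (DA (DL G)),
  [/\ forall c c' (h : hom c' c), fmap DA (fmap DL h) \oc eta c' = eta c \oc h,
      forall G b, bijective (fun f : hom (DL G) b => fmap DA f \oc eta G) &
      forall G, is_iso (eta G)].
Proof.
have adj := DA_DR_adjoint DAP DRP.
have Cab := abelian_op (abelian_functor_cat (modr R)).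
have [kap [kap_iso kap_nat]] := DA_rep.
pose kap' N : nat_trans (DA (yoneda R N) : modrAb R) (tensorr N) := projT1 (cid
    (kap_iso N)).
have kap'K N : nat_comp (kap' N) (kap N) = nat_id _ := proj1 (projT2 (cid (kap_iso N))).
have kapK' N : nat_comp (kap N) (kap' N) = nat_id _ := proj2 (projT2 (cid (kap_iso N))).
pose ncA (F G H K : modrAb R) (h : nat_trans H K) (g : nat_trans G H) (f : nat_trans F G) :
  nat_comp h (nat_comp g f) = nat_comp (nat_comp h g) f := @cmpA (modrAb R) _ _ _ _ h g f.
pose nc1 (F G : modrAb R) (f : nat_trans F G) : nat_comp f (nat_id F) = f := @cmpm1
    (modrAb R) _ _ f.
pose n1c (F G : modrAb R) (f : nat_trans F G) : nat_comp (nat_id G) f = f := @cmp1m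
    (modrAb R) _ _ f.
have kap'_nat (N N' : Mod R) (f : hom N N') :
    nat_comp (tensorr_map f) (kap' N) =
    nat_comp (kap' N') (@fmap _ _ DA (yoneda R N') (yoneda R N) (rep_map f)).
  rewrite -[LHS]n1c -(kap'K N') -ncA (ncA _ _ _ _ (kap N')) kap_nat -ncA.
  by rewrite kapK' nc1.
pose eta (G : op (modrAb R)) : hom G (DA (T G)) :=
  nat_comp (counit G) (kap' (evmod G)).
apply: (L0_unit Cab (@enough_injectives R) (eta := eta) DLP).
- exact: left_adjoint_cokernel adj.
- move=> c c' h; rewrite -[RHS]/(nat_comp h (nat_comp (counit c) (kap' _))).
  by rewrite ncA counit_natural -ncA kap'_nat ncA.
- move=> I Iinj; have [s [sc cs]] := counit_injective_iso Iinj.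
  exists (nat_comp (kap (evmod I)) s); split.
    rewrite -[LHS]/(nat_comp (nat_comp (counit I) (kap' (evmod I))) (nat_comp (kap
        (evmod I)) s)).
    rewrite -ncA (ncA _ _ _ _ (kap' _)) kap'K n1c; exact: cs.
  rewrite -[LHS]/(nat_comp (nat_comp (kap (evmod I)) s) (nat_comp (counit I) (kap'
      (evmod I)))).
  rewrite -ncA (ncA _ _ _ _ s) (sc : nat_comp s (counit I) = nat_id _) n1c.
  exact: kapK'.
- move=> I b Iinj.
  have rep_case X : bijective (fun f : hom (T I) (yoneda R X) => fmap DA f \oc eta I).
    have E (k : @hom (Mod R) X (evmod I)) :
        fmap DA (rep_map k : hom (T I) (yoneda R X)) \oc eta I =
        nat_comp (nat_comp (counit I) (tensorr_map k)) (kap' X).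
      by rewrite -ncA kap'_nat ncA.
    have rsurj (f : hom (T I) (yoneda R X)) : exists k : @hom (Mod R) X (evmod I),
        rep_map k = f.
      exists (yel f : lhom X (evmod I)); apply: yel_inj.
      exact: (@cmp1m (Mod R)).
    have [K KP] := choice (bij_surj (tensorr_ev_adjoint X I)).
    apply: bijective_of_surj_inj => [t|f g].
      exists (rep_map (K (nat_comp t (kap X)))); rewrite E KP -ncA kapK'.
      exact: nc1.
    have [k <-] := rsurj f; have [l <-] := rsurj g; rewrite !E.
    move/(congr1 (fun z => nat_comp z (kap X))); rewrite -!ncA kap'K !nc1.
    by move/(bij_inj (tensorr_ev_adjoint X I)) ->.
  have /fp_functorP[X [Y [a [p [ps ap]]]]] := svalP b.
  have apc : @is_cokernel (fp R) (yoneda R Y) (yoneda R X) b a p.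
    have [pa pU] := nat_exact_cokernel ps ap.
    by split=> // x; exact: pU.
  apply: (universal_cokernel (a := a : hom (yoneda R Y) (yoneda R X)) (p := p) Cab Iinj).
  + exact: left_adjoint_cokernel adj _ _ _ _ _ apc.
  + exact: (proj1 apc).
  + move=> f; exact: (rep_projective f ps).
  + exact: rep_case.
  + exact: rep_case.
Qed.

Lemma DL_DA_DR_recollement : exists i_upper i_shriek : functor (fp R) (Ker DA),
  recollement (Ker_incl DA) i_upper i_shriek DA DL DR.
Proof.
have [eta [eta_nat eta_bij eta_iso]] := DL_unit.
apply: (triple_recollement eta_nat eta_bij eta_iso (DA_DR_adjoint DAP DRP)).
- exact: abelian_fp.
- exact: abelian_op (abelian_functor_cat (modr R)).
Qed.

End DL.

Theorem theorem5p1 (R : pzRingType) :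
  (exists (DA : functor (fp R) (op (modrAb R)))
          (DL DR : functor (op (modrAb R)) (fp R)),
     is_DA DA /\ is_DL DL /\ is_DR DR) /\
  (forall (DA : functor (fp R) (op (modrAb R)))
          (DL DR : functor (op (modrAb R)) (fp R)),
     is_DA DA -> is_DL DL -> is_DR DR ->
     exists i_upper i_shriek : functor (fp R) (Ker DA),
       recollement (Ker_incl DA) i_upper i_shriek DA DL DR).
Proof.
split=> [|DA DL DR DAP DLP DRP]; last exact: DL_DA_DR_recollement.
have [DA DAP] := DA_exists R; have [DR DRP] := DR_exists R.
by have [DL DLP] := DL_exists R; exists DA, DL, DR.
Qed.
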